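(* Let $N\ge2$ and $R,K\in\mathbf{R}$ with $0<R\le r_K$ (so $0<R\le\pi/(2\sqrt K)$ if $K>0$, and $0<R<\infty$ if $K\le0$). Let $\alpha\in(0,1)$ be such that $$\alpha\le A(\sigma_K,R,N):=\frac{N-1}{\lambda_1(K,R,N)\,\sigma_K(R)^2}.$$ Then the first Dirichlet eigenfunction for $-\Delta$ on a ball $B(R)$ of radius $R$ in $\mathbf{M}^N_K$ is strictly $\alpha$-concave in $B(R)$.
   Context: $\mathbf{M}^N_K$ is the $N$-dimensional simply connected space form of constant curvature $K$: the sphere $\mathbf{S}^N(1/\sqrt K)$ if $K>0$, $\mathbf{R}^N$ if $K=0$, and the hyperbolic space $\mathbf{H}^N(1/\sqrt{-K})$ if $K<0$; $d$ is its Riemannian distance and $\Delta$ its Laplace–Beltrami operator. $B(R)=\{x: d(o,x)<R\}$ for a fixed point $o\in\mathbf{M}^N_K$. $r_K=\pi/(2\sqrt K)$ if $K>0$ and $r_K=\infty$ if $K\le0$. $\sigma_K(r)=\sin(\sqrt K r)/\sqrt K$ if $K>0$, $\sigma_K(r)=r$ if $K=0$, $\sigma_K(r)=\sinh(\sqrt{-K}r)/\sqrt{-K}$ if $K<0$. $\lambda_1(K,R,N)$ is the first Dirichlet eigenvalue of $-\Delta$ on the open metric ball of radius $R$ in $\mathbf{M}^N_K$. The first Dirichlet eigenfunction is a function $\phi$ (unique up to a positive multiple) with $-\Delta\phi=\lambda_1(K,R,N)\phi$ in $B(R)$, $\phi>0$ in $B(R)$, $\phi=0$ on $\partial B(R)$.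 A curve $c:[0,1]\to\mathbf{M}^N_K$ is a minimal geodesic if $d(c(s),c(t))=|s-t|\,d(c(0),c(1))$ for all $s,t\in[0,1]$. For $0<\alpha\le1$, a nonnegative function $u$ on $B(R)$ is strictly $\alpha$-concave in $B(R)$ if $u(c(t))>[(1-t)u(c(0))^\alpha+t\,u(c(1))^\alpha]^{1/\alpha}$ for every nonconstant minimal geodesic $c:[0,1]\to B(R)$ and every $t\in(0,1)$. *)

(* Defs.v *)
From HB Require Import structures.
From mathcomp Require Import all_boot all_order all_algebra.
From mathcomp Require Import all_classical all_reals all_analysis.

Set Implicit Arguments.
Unset Strict Implicit.
Unset Printing Implicit Defensive.

Import Order.TTheory GRing.Theory Num.Theory.
Import numFieldNormedType.Exports.

Local Open Scope classical_set_scope.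
Local Open Scope ring_scope.

(** * Space forms as submanifolds of R^(N+1)

    The ambient space is ['rV[R]_N.+1]; coordinate [ord0] is the
    distinguished ("time-like" when K < 0) one. *)

(* sgn(K) x_0 y_0 + x_1 y_1 + ... + x_N y_N.  The Riemannian metric of the space
   form is the restriction of this form to its tangent spaces. *)
Definition space_form_bilin (R : realType) (N : nat) (K : R)
    (x y : 'rV[R]_N.+1) : R :=
  Num.sg K * (x ord0 ord0 * y ord0 ord0) +
  \sum_(i < N) x ord0 (lift ord0 i) * y ord0 (lift ord0 i).

(* K > 0: the round sphere of radius 1 / sqrt K;
   K < 0: the upper sheet of the hyperboloid <x, x> = 1 / K in R^(1,N);
   K = 0: R^N, as the hyperplane x_0 = 0. *)
Definition space_form (R : realType) (N : nat) (K : R) : set 'rV[R]_N.+1 :=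
  [set x | if 0 < K then space_form_bilin K x x = K^-1
           else if K < 0 then
             space_form_bilin K x x = K^-1 /\ 0 < x ord0 ord0
           else x ord0 ord0 = 0].

(** * Riemannian distance *)

(* Only the values of [c] on [0, 1] matter; every C^1 map on [0, 1] extends to a
   C^1 map of the line into the ambient space, so C^1 on R is no restriction. *)
Definition C1_curve (R : realType) (N : nat) (K : R)
    (c : R -> 'rV[R]_N.+1) : Prop :=
  [/\ forall t, derivable c t 1, continuous (derive1 c) &
      forall t, 0 <= t <= 1 -> space_form K (c t)].

Definition curve_length (R : realType) (N : nat) (K : R)
    (c : R -> 'rV[R]_N.+1) : R :=
  Rintegral (@lebesgue_measure R) `[0, 1]
    (fun t => Num.sqrt (space_form_bilin K (derive1 c t) (derive1 c t))).

Definition riem_dist (R : realType) (N : nat) (K : R)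
    (x y : 'rV[R]_N.+1) : R :=
  inf [set L | exists c : R -> 'rV[R]_N.+1,
    [/\ C1_curve K c, c 0 = x, c 1 = y & L = curve_length K c]].

Definition geod_ball (R : realType) (N : nat) (K : R) (o : 'rV[R]_N.+1)
    (r : R) : set 'rV[R]_N.+1 :=
  [set x | space_form K x /\ riem_dist K o x < r].

(* The space form is closed in the ambient space and balls are open in it, so
   this is the topological boundary relative to the space form. *)
Definition geod_bdry (R : realType) (N : nat) (K : R) (o : 'rV[R]_N.+1)
    (r : R) : set 'rV[R]_N.+1 :=
  closure (geod_ball K o r) `\` geod_ball K o r.

(** * Laplace-Beltrami operator in local coordinates *)

Definition std_basis (R : realType) (n : nat) (i : 'I_n) : 'rV[R]_n :=
  delta_mx ord0 i.

(* [C1_on U f] and [C2_on U f] are meant for open [U]. *)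
Definition C1_on (R : realType) (n : nat) (V : normedModType R)
    (U : set 'rV[R]_n) (f : 'rV[R]_n -> V) : Prop :=
  forall y, U y -> forall i : 'I_n,
    derivable f y (std_basis R i) /\
    {for y, continuous (fun z => 'D_(std_basis R i) f z)}.

Definition C2_on (R : realType) (n : nat) (V : normedModType R)
    (U : set 'rV[R]_n) (f : 'rV[R]_n -> V) : Prop :=
  C1_on U f /\
  forall i : 'I_n, C1_on U (fun z => 'D_(std_basis R i) f z).

(* g_ij = <d_i psi, d_j psi> *)
Definition metric_coef (R : realType) (N : nat) (K : R)
    (psi : 'rV[R]_N -> 'rV[R]_N.+1) (y : 'rV[R]_N) : 'M[R]_N :=
  \matrix_(i, j) space_form_bilin K ('D_(std_basis R i) psi y)
                                    ('D_(std_basis R j) psi y).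

(* (det g)^(-1/2) sum_i d_i ((det g)^(1/2) sum_j g^ij d_j f) *)
Definition laplace_beltrami (R : realType) (n : nat)
    (g : 'rV[R]_n -> 'M[R]_n) (f : 'rV[R]_n -> R) (y : 'rV[R]_n) : R :=
  (Num.sqrt (\det (g y)))^-1 *
  \sum_(i < n) 'D_(std_basis R i) (fun z =>
    Num.sqrt (\det (g z)) *
    \sum_(j < n) invmx (g z) i j * 'D_(std_basis R j) f z) y.

(* Regular C^2 parametrizations, defined on an open set of R^N, of pieces of the
   subset [Omega] of the space form. *)
Definition local_param (R : realType) (N : nat) (K : R)
    (Omega : set 'rV[R]_N.+1) (U : set 'rV[R]_N)
    (psi : 'rV[R]_N -> 'rV[R]_N.+1) : Prop :=
  [/\ open U, C2_on U psi, forall y, U y -> Omega (psi y) &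
      forall y, U y -> metric_coef K psi y \in unitmx].

(* [u] is C^2 on the open subset [Omega] of the space form. *)
Definition C2_on_space_form (R : realType) (N : nat) (K : R)
    (Omega : set 'rV[R]_N.+1) (u : 'rV[R]_N.+1 -> R) : Prop :=
  forall (U : set 'rV[R]_N) (psi : 'rV[R]_N -> 'rV[R]_N.+1),
    local_param K Omega U psi -> C2_on U (u \o psi).

(* Delta u = f on [Omega], read in all local coordinates. *)
Definition laplacian_eq (R : realType) (N : nat) (K : R)
    (Omega : set 'rV[R]_N.+1) (u f : 'rV[R]_N.+1 -> R) : Prop :=
  forall (U : set 'rV[R]_N) (psi : 'rV[R]_N -> 'rV[R]_N.+1),
    local_param K Omega U psi ->
    forall y, U y ->
      laplace_beltrami (metric_coef K psi) (u \o psi) y = f (psi y).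

(** * Dirichlet eigenvalues and the first eigenfunction *)

(* Classical solutions of -Delta u = lam u in B(o, r), u = 0 on the boundary. *)
Definition dirichlet_solution (R : realType) (N : nat) (K : R)
    (o : 'rV[R]_N.+1) (r lam : R) (u : 'rV[R]_N.+1 -> R) : Prop :=
  [/\ C2_on_space_form K (geod_ball K o r) u,
      {within closure (geod_ball K o r), continuous u},
      laplacian_eq K (geod_ball K o r) u (fun x => - (lam * u x)) &
      forall x, geod_bdry K o r x -> u x = 0].

Definition dirichlet_eigenvalue (R : realType) (N : nat) (K : R)
    (o : 'rV[R]_N.+1) (r lam : R) : Prop :=
  exists2 u : 'rV[R]_N.+1 -> R, dirichlet_solution K o r lam u &
    exists2 x, geod_ball K o r x & u x != 0.

(* The least Dirichlet eigenvalue of B(o, r).  It does not depend on the point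
   [o] of the space form, by homogeneity. *)
Definition lambda1 (R : realType) (N : nat) (K : R) (o : 'rV[R]_N.+1)
    (r : R) : R :=
  inf [set lam | dirichlet_eigenvalue K o r lam].

Definition first_dirichlet_eigenfunction (R : realType) (N : nat) (K : R)
    (o : 'rV[R]_N.+1) (r : R) (phi : 'rV[R]_N.+1 -> R) : Prop :=
  dirichlet_solution K o r (lambda1 K o r) phi /\
  forall x, geod_ball K o r x -> 0 < phi x.

(** * The constants r_K, sigma_K and A *)

Definition r_max (R : realType) (K : R) : \bar R :=
  if 0 < K then (pi / (2 * Num.sqrt K))%:E else +oo%E.

Definition hyp_sin (R : realType) (x : R) : R := (expR x - expR (- x)) / 2.

Definition sigma (R : realType) (K r : R) : R :=
  if 0 < K then sin (Num.sqrt K * r) / Num.sqrt K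
  else if K < 0 then hyp_sin (Num.sqrt (- K) * r) / Num.sqrt (- K)
  else r.

Definition A_const (R : realType) (N : nat) (K : R) (o : 'rV[R]_N.+1)
    (r : R) : R :=
  (N%:R - 1) / (lambda1 K o r * sigma K r ^+ 2).

(** * Power concavity along minimal geodesics *)

(* Only the values of [c] on [0, 1] matter. *)
Definition minimal_geodesic (R : realType) (N : nat) (K : R)
    (c : R -> 'rV[R]_N.+1) : Prop :=
  (forall t, 0 <= t <= 1 -> space_form K (c t)) /\
  forall s t, 0 <= s <= 1 -> 0 <= t <= 1 ->
    riem_dist K (c s) (c t) = `|s - t| * riem_dist K (c 0) (c 1).

Definition nonconstant (R : realType) (N : nat)
    (c : R -> 'rV[R]_N.+1) : Prop :=
  exists s t, [/\ 0 <= s <= 1, 0 <= t <= 1 & c s <> c t].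

Definition strictly_concave (R : realType) (N : nat) (K alpha : R)
    (Omega : set 'rV[R]_N.+1) (u : 'rV[R]_N.+1 -> R) : Prop :=
  (forall x, Omega x -> 0 <= u x) /\
  forall c : R -> 'rV[R]_N.+1,
    minimal_geodesic K c -> nonconstant c ->
    (forall t, 0 <= t <= 1 -> Omega (c t)) ->
    forall t, 0 < t < 1 ->
      ((1 - t) * u (c 0) `^ alpha + t * u (c 1) `^ alpha) `^ alpha^-1
        < u (c t).

(* Main.v *)
Require Import Defs.
From HB Require Import structures.
From mathcomp Require Import all_boot all_order all_algebra.
From mathcomp Require Import all_classical all_reals all_analysis.
From mathcomp Require Import ring lra.

(** The eigenfunction is a function of the distance to the centre, and power
    concavity of its profile reduces to a sign that one ordinary differential
    equation controls.

    Distances are measured by [chord p x], half the squared chordal distance in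
    the ambient space.  It is a polynomial, and it equals [vers K] of the
    Riemannian distance, where [vers K] is the primitive of [sigma K].  In the
    variable [z = chord o x] the radial eigenvalue equation reads
      [(2 z - K z^2) F'' + N (1 - K z) F' + lam F = 0];
    here [2 z - K z^2] is [sigma_K^2], and [1 - K z] is [cos_K], the derivative of
    [sigma_K].  The point [z = 0] is a regular singular
    point, and [radial_solution_exists] gives the solution [F] with [F 0 = 1].

    The eigenfunction is a positive solution vanishing on the boundary sphere.
    In the stereographic chart [stereo], where the metric is conformal, such a
    solution is compared with radial functions by the maximum principle: where
    a radial function touches a solution from above, the radial operator is
    nonnegative ([radial_touch_above]).  Comparing with [F] plus constants shows
    that [F] is positive in the ball and tends to [0] at its boundary
    ([profile_gt0], [profile_vanishes]).  Then both [u] and [- u] lie below the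
    multiples of [F] with the same value at the centre ([liouville_above]):
    near the centre the comparison holds by continuity, near the boundary by
    the boundary values, and in between by a barrier built from the second,
    singular, solution of the radial equation.  Hence [u = u(0) F]
    ([positive_solution_radial]).

    Along a geodesic of speed [D] the function [z] satisfies
      [z'' = D^2 (1 - K z)]  and  [z'^2 <= D^2 (2 z - K z^2)]
    ([chord_along_geodesic]), with equality in the second relation when the
    geodesic passes through the centre.  The second derivative of [F(z)^al] is
      [al F^(al - 2) ((F F'' - (1 - al) F'^2) z'^2 + F F' z'')].
    Since [F' < 0] and [K z < 1] the last term is negative; if the coefficient
    of [z'^2] is positive, the bracket is largest for [z'^2 = D^2 (2 z - K z^2)], when
    it equals [- D^2] times
      [Q = (N - 1) (1 - K z) F F' + lam F^2 + (1 - al) (2 z - K z^2) F'^2].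
    So strict concavity follows from [Q > 0], which is [radial_concavity]:
    [Q] is positive at [0], and the equation makes [Q] increase wherever it
    vanishes, as [al lam sigma_K^2 < N - 1] inside the ball.  This is where the
    bound on the exponent enters.

    Finally, the Riemannian distance is an infimum of lengths and geodesics are
    curves realizing distances.  [chord_lt_of_short_curve] computes the distance
    and [minimal_geodesic_arc] shows that minimal geodesics are the explicit
    arcs along which the above computation is made. *)

Set Implicit Arguments.
Unset Strict Implicit.
Unset Printing Implicit Defensive.

Import Order.TTheory GRing.Theory Num.Theory.
Import numFieldNormedType.Exports.

Local Open Scope classical_set_scope.
Local Open Scope ring_scope.

(** * One-variable calculus *)

Section derivative_rules.
Context {R : realType} {V : normedModType R}.
Implicit Types (f g : V -> R) (x v : V).

Lemma is_derive_add f g x v df dg : is_derive x v f df -> is_derive x v g dg ->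
  is_derive x v (fun t => f t + g t) (df + dg).
Proof. exact: is_deriveD. Qed.

Lemma is_derive_sub f g x v df dg : is_derive x v f df -> is_derive x v g dg ->
  is_derive x v (fun t => f t - g t) (df - dg).
Proof. exact: is_deriveB. Qed.

Lemma is_derive_opp f x v df : is_derive x v f df ->
  is_derive x v (fun t => - f t) (- df).
Proof. exact: is_deriveN. Qed.

Lemma is_derive_mul f g x v df dg : is_derive x v f df -> is_derive x v g dg ->
  is_derive x v (fun t => f t * g t) (f x * dg + g x * df).
Proof. exact: is_deriveM. Qed.

Lemma is_derive_scale c f x v df : is_derive x v f df ->
  is_derive x v (fun t => c * f t) (c * df).
Proof. exact: is_deriveZ. Qed.

Lemma is_derive_inv f x v df : f x != 0 -> is_derive x v f df ->
  is_derive x v (fun t => (f t)^-1) (- (f x) ^- 2 * df).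
Proof.
by move=> fx0 [fd <-]; split; [exact: derivableV | rewrite deriveV].
Qed.

Lemma is_derive_pow f n x v df : is_derive x v f df ->
  is_derive x v (fun t => f t ^+ n.+1) (n.+1%:R * f x ^+ n * df).
Proof.
move=> fd; elim: n => [|n IH].
  by rewrite expr0 !mul1r; under eq_fun do rewrite expr1.
under eq_fun do rewrite exprS.
apply: is_derive_eq (is_derive_mul fd IH) _.
by rewrite (natrD _ 1 n.+1) [f x ^+ n.+1]exprS; ring.
Qed.

Lemma is_derive_const (c : R) x v : is_derive x v (fun=> c) 0.
Proof. exact: is_derive_cst. Qed.

Lemma is_derive_var (x : R) : is_derive x 1 (fun t : R => t) 1.
Proof. exact: is_derive_id. Qed.

(** Reduced to the chain rule on the line along [h |-> h *: v + x]. *)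
Lemma is_derive_comp (e : R -> R) f x v de df :
  is_derive (f x) 1 e de -> is_derive x v f df ->
  is_derive x v (fun t => e (f t)) (de * df).
Proof.
move=> ed fd.
have line (k : V -> R) dk : is_derive x v k dk <->
    is_derive (0 : R) 1 (fun h : R => k (h *: v + x)) dk.
  have E : 'D_1 (fun h : R => k (h *: v + x)) 0 = 'D_v k x.
    rewrite /derive; set g1 := fun h => h^-1 *: _; set g2 := fun h => h^-1 *: _.
    suff -> : g1 = g2 by [].
    by apply/funext => h; rewrite /g1 /g2 /= addr0 scale0r add0r [_%:A]mulr1.
  split=> -[d <-]; split.
  - exact: (derivable1P k x v).1 d.
  - exact: E.
  - exact: (derivable1P k x v).2 d.
  - exact: esym E.
apply: (line _ _).2.
have fl := (line f df).1 fd.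
have := @is_derive1_comp R e (fun h : R => f (h *: v + x)) 0 de df.
by apply => //; rewrite scale0r add0r.
Qed.

End derivative_rules.

Section calculus.
Context {R : realType}.
Implicit Types (f g h : R -> R) (a b x t : R).

Lemma is_derive_continuous f x df : is_derive x 1 f df -> {for x, continuous f}.
Proof.
by move=> [fd _]; apply: differentiable_continuous; exact/derivable1_diffP.
Qed.

Lemma is_derive_gt0_near f x d : is_derive x 1 f d -> 0 < d ->
  exists2 e, 0 < e & forall y, `|y - x| < e ->
    (y < x -> f y < f x) /\ (x < y -> f x < f y).
Proof.
move=> /is_derive1_caratheodory[g [fg cg gx]] d0.
have : \forall y \near x, 0 < g y.
  by apply: (cvgr_gt _ cg); rewrite gx.
move=> [e /= e0 ge]; exists e => // y yx.
have gy : 0 < g y by apply: ge; rewrite /ball_/= distrC.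
split=> xy; rewrite -subr_lt0.
  by rewrite fg pmulr_rlt0 // subr_lt0.
by rewrite -opprB oppr_lt0 fg mulr_gt0 // subr_gt0.
Qed.

(** A function starting positive and crossing zero only upwards never vanishes:
    at its first zero it would have to come down. *)
Lemma gt0_of_upward_crossing h h' a b : 0 < h a ->
  (forall t, a <= t < b -> is_derive t 1 h (h' t)) ->
  (forall t, a < t < b -> h t = 0 -> 0 < h' t) ->
  forall t, a <= t < b -> 0 < h t.
Proof.
move=> ha hd hcross t1 /andP[at1 t1b]; rewrite ltNge; apply/negP => ht1.
pose S := [set s | a <= s <= t1 /\ h s <= 0].
have S1 : S t1 by split => //; rewrite at1 lexx.
have Slb : lbound S a by move=> s [/andP[]].
have hS : has_inf S by split; [exists t1 | exists a].
(* [u] is the first zero: [h] is positive before [u] and cannot increase through [0] there *)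
pose u := inf S.
have au : a <= u by apply: lb_le_inf => //; exists t1.
have ut1 : u <= t1 by apply: ge_inf => //; exists a.
have ub : a <= u < b by rewrite au (le_lt_trans ut1).
have cu := is_derive_continuous (hd _ ub).
have below s : a <= s < u -> 0 < h s.
  move=> /andP[as_ su]; rewrite ltNge; apply/negP => hs.
  have : u <= s by apply: ge_inf; [exists a | split => //; rewrite as_ (le_trans (ltW su))].
  by rewrite leNgt su.
have hu0 : h u <= 0.
  rewrite leNgt; apply/negP => hu.
  have [e /= e0 he] : \forall y \near u, 0 < h y by exact: (cvgr_gt _ cu).
  have [s Ss su] := inf_adherent e0 hS.
  have us : u <= s by apply: ge_inf => //; exists a.
  have : 0 < h s.
    apply: he; rewrite /ball_/= distrC ger0_norm ?subr_ge0 //.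
    by rewrite ltrBlDr addrC.
  by case: Ss => _; rewrite leNgt => /negP.
have au' : a < u.
  rewrite lt_neqAle au andbT; apply/eqP => E.
  by move: hu0; rewrite -E leNgt ha.
have hu : h u = 0.
  apply/eqP; rewrite eq_le hu0 leNgt; apply/negP => hun.
  have [e /= e0 he] : \forall y \near u, h y < 0 by exact: (cvgr_lt _ cu).
  pose s := Num.max a (u - e / 2).
  have su : s < u by rewrite gt_max au' ltrBlDr ltrDl divr_gt0.
  have as_ : a <= s by rewrite le_max lexx.
  have : h s < 0.
    apply: he; rewrite /ball_/= gtr0_norm ?subr_gt0 //.
    have : u - e / 2 <= s by rewrite le_max lexx orbT.
    by move=> ?; lra.
  by apply/negP; rewrite -leNgt ltW // below // as_.
have hu' : 0 < h' u by apply: hcross => //; rewrite au' (le_lt_trans ut1).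
have [e e0 he] := is_derive_gt0_near (hd _ ub) hu'.
pose s := Num.max a (u - e / 2).
have su : s < u by rewrite gt_max au' ltrBlDr ltrDl divr_gt0.
have as_ : a <= s by rewrite le_max lexx.
have se : `|s - u| < e.
  rewrite distrC gtr0_norm ?subr_gt0 //.
  have : u - e / 2 <= s by rewrite le_max lexx orbT.
  by move=> ?; lra.
have := (he s se).1 su; rewrite hu; apply/negP; rewrite -leNgt ltW //.
by rewrite below // as_.
Qed.

(** If [f2] were positive, [f1] would be positive just after [x], and the mean
    value theorem would give [f] a value larger than [f x]. *)
Lemma second_derivative_at_max f f1 (f2 x e : R) : 0 < e ->
  (forall y, `|y - x| < e -> is_derive y 1 f (f1 y)) ->
  is_derive x 1 f1 f2 -> (forall y, `|y - x| < e -> f y <= f x) ->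
  f1 x = 0 /\ f2 <= 0.
Proof.
move=> e0 df df1 fmax.
have xe : `|x - x| < e by rewrite subrr normr0.
have f1x : f1 x = 0.
  have [f1n|f1p|//] := ltrgtP (f1 x) 0.
    have dN : is_derive x 1 (fun t => - f t) (- f1 x) by exact: is_deriveN (df _ xe).
    have f1n' : 0 < - f1 x by rewrite oppr_gt0.
    have [d d0 fd] := @is_derive_gt0_near (fun t => - f t) x (- f1 x) dN f1n'.
    pose m := Num.min d e; have m0 : 0 < m by rewrite lt_min d0.
    have md : m <= d by rewrite ge_min lexx.
    have me : m <= e by rewrite ge_min lexx orbT.
    have ym : `|(x - m / 2) - x| < m.
      by rewrite (_ : _ - x = - (m / 2)); [rewrite normrN gtr0_norm; lra | ring].
    have /fd[H _] := lt_le_trans ym md.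
    have : - f (x - m / 2) < - f x by apply: H; lra.
    by rewrite ltrN2 ltNge fmax // (lt_le_trans ym).
  have [d d0 fd] := is_derive_gt0_near (df _ xe) f1p.
  pose m := Num.min d e; have m0 : 0 < m by rewrite lt_min d0.
  have md : m <= d by rewrite ge_min lexx.
  have me : m <= e by rewrite ge_min lexx orbT.
  have ym : `|(x + m / 2) - x| < m.
    by rewrite (_ : _ - x = m / 2); [rewrite gtr0_norm; lra | ring].
  have /fd[_ H] := lt_le_trans ym md.
  have : f x < f (x + m / 2) by apply: H; lra.
  by rewrite ltNge fmax // (lt_le_trans ym).
split=> //; rewrite leNgt; apply/negP => f2p.
have [d d0 fd] := is_derive_gt0_near df1 f2p.
pose m := Num.min d e; have m0 : 0 < m by rewrite lt_min d0.
have md : m <= d by rewrite ge_min lexx.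
have me : m <= e by rewrite ge_min lexx orbT.
have close z : x <= z <= x + m / 2 -> `|z - x| < m.
  by move=> /andP[xz zx]; rewrite ger0_norm ?subr_ge0 //; lra.
have xm : x < x + m / 2 by lra.
have [|c|c] := @MVT R f f1 x (x + m / 2) xm.
- move=> z /[!in_itv]/= /andP[xz zx]; apply: df.
  by apply: lt_le_trans me; apply: close; rewrite !ltW.
- apply: (@derivable_within_continuous R R f `[x, x + m / 2]).
  move=> z /[!in_itv]/= xz; apply: ex_derive; apply: df.
  by apply: lt_le_trans me; exact: close.
rewrite in_itv/= => /andP[xc cx] E.
have f1c : 0 < f1 c.
  rewrite -f1x; apply: (fd c _).2 => //.
  by apply: lt_le_trans md; apply: close; rewrite !ltW.
have : f (x + m / 2) <= f x.
  by apply: fmax; apply: lt_le_trans me; apply: close; rewrite ltW // lexx.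
by rewrite -subr_le0 E leNgt mulr_gt0 // subr_gt0.
Qed.

(** [f] minus its chord cannot have an interior minimum; this second derivative
    test asks for no second derivative at the endpoints. *)
Lemma chord_lt_of_second_derivative (f f1 f2 : R -> R) :
  (forall t, 0 <= t <= 1 -> is_derive t 1 f (f1 t)) ->
  (forall t, 0 < t < 1 -> is_derive t 1 f1 (f2 t) /\ f2 t < 0) ->
  forall t, 0 < t < 1 -> (1 - t) * f 0 + t * f 1 < f t.
Proof.
move=> df df1 t0 t01.
pose g t := f t - ((1 - t) * f 0 + t * f 1).
pose g1 t := f1 t - (f 1 - f 0).
have dg t : 0 <= t <= 1 -> is_derive t 1 g (g1 t).
  move=> tt; apply: is_derive_sub; first exact: df.
  have D1 := is_derive_sub (is_derive_const (1 : R) t 1) (is_derive_var t).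
  have D2 := is_derive_add (is_derive_mul D1 (is_derive_const (f 0) t 1))
    (is_derive_mul (is_derive_var t) (is_derive_const (f 1) t 1)).
  by apply: is_derive_eq D2 _; ring.
have dg1 t : 0 < t < 1 -> is_derive t 1 g1 (f2 t).
  move=> tt; rewrite -[f2 t]subr0; apply: is_derive_sub; exact: (df1 _ tt).1.
have nomin c : 0 < c < 1 -> ~ (forall t, 0 <= t <= 1 -> g c <= g t).
  move=> /[dup] cc /andP[c0 c1] cmin.
  pose e := Num.min c (1 - c).
  have e0 : 0 < e by rewrite lt_min c0 subr_gt0.
  have ec : e <= c by rewrite ge_min lexx.
  have ec1 : e <= 1 - c by rewrite ge_min lexx orbT.
  have near01 y : `|y - c| < e -> 0 <= y <= 1.
    by rewrite ltr_norml => /andP[? ?]; apply/andP; split; lra.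
  have [] := @second_derivative_at_max (fun t => - g t) (fun t => - g1 t)
    (- f2 c) c e e0.
  - by move=> y /near01 /dg; exact: is_deriveN.
  - exact: is_deriveN (dg1 _ cc).
  - by move=> y /near01 /cmin; rewrite lerN2.
  by move=> _; rewrite leNgt oppr_gt0 (df1 _ cc).2.
rewrite -subr_gt0 -/(g t0) ltNge; apply/negP => gt0.
have [] := @EVT_min R g 0 1 ler01.
  apply: derivable_within_continuous => z; rewrite in_itv/= => zz.
  by apply: ex_derive; exact: dg.
move=> c; rewrite in_itv/= => /andP[c0 c1] cmin.
have g00 : g 0 = 0 by rewrite /g; ring.
have g10 : g 1 = 0 by rewrite /g; ring.
have cmin' t : 0 <= t <= 1 -> g c <= g t by move=> tt; apply: cmin; rewrite in_itv.
have [c00|cn0] := eqVneq c 0.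
  apply: (nomin t0) => // t /cmin'; rewrite c00 g00; exact: le_trans.
have [c11|cn1] := eqVneq c 1.
  apply: (nomin t0) => // t /cmin'; rewrite c11 g10; exact: le_trans.
by apply: (nomin c) => //; rewrite !lt_neqAle c0 c1 eq_sym cn0 cn1.
Qed.

Lemma primitive_exists f a b :
  (forall x, a <= x < b -> {for x, continuous f}) ->
  exists F, forall x, a < x < b -> is_derive x 1 F (f x).
Proof.
move=> cf; exists (fun x => \int[@lebesgue_measure R]_(t in `[a, x]) f t)%R.
move=> x /andP[ax xb]; pose u := (x + b) / 2.
have xu : x < u by rewrite /u; lra.
have ub : u < b by rewrite /u; lra.
have ci : (@lebesgue_measure R).-integrable `[a, u] (EFin \o f).
  apply: continuous_compact_integrable; first exact: segment_compact.
  apply/continuous_in_subspaceT => z; rewrite inE/= in_itv/= => /andP[az zu].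
  by apply: cf; rewrite az (le_lt_trans zu).
have cx : {for x, continuous f} by apply: cf; rewrite ltW.
have [dF Fx] := continuous_FTC1_closed xu ci ax cx.
by split; [exact: dF | rewrite -derive1E; exact: Fx].
Qed.

(** The derivative of [F] is two-sided at the endpoints, which spares one-sided
    limits when curves on the whole line are integrated over the unit interval. *)
Lemma Rintegral01_primitive f F : continuous f ->
  (forall x, 0 <= x <= 1 -> is_derive x 1 F (f x)) ->
  Rintegral (@lebesgue_measure R) `[0, 1] f = F 1 - F 0.
Proof.
move=> cf dF.
rewrite /Rintegral (@continuous_FTC2 R f F 0 1) //.
- exact: continuous_subspaceT.
- split.
  + by move=> x; rewrite in_itv/= => /andP[? ?]; apply: ex_derive; apply: dF; rewrite !ltW.
  + apply: cvg_at_right_filter; apply: is_derive_continuous (dF 0 _).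
    by rewrite lexx ler01.
  + apply: cvg_at_left_filter; apply: is_derive_continuous (dF 1 _).
    by rewrite lexx ler01.
- move=> x; rewrite in_itv/= => /andP[? ?]; rewrite derive1E.
  by apply: derive_val; apply: dF; rewrite !ltW.
Qed.

End calculus.

(** * Power series *)

Section power_series.
Context {R : realType}.
Implicit Types (c : nat -> R) (kappa x : R).

(** The radius of convergence is at least [1 / kappa]; in this form the condition
    passes to derived series and is what a recurrence gives directly. *)
Definition geometric_growth kappa c :=
  forall theta, kappa < theta -> exists M, forall n, `|c n| <= M * theta ^+ n.

Lemma geometric_growth_cvg kappa c x : 0 <= kappa -> geometric_growth kappa c ->
  kappa * `|x| < 1 -> cvgn (pseries c x).
Proof.
move=> k0 gc kx; set y := `|x|; have y0 : 0 <= y by exact: normr_ge0.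
pose theta := kappa + (1 - kappa * y) / (2 * (y + 1)).
have y1 : 0 < 2 * (y + 1) by lra.
have kt : kappa < theta by rewrite ltrDl divr_gt0 // subr_gt0.
have t0 : 0 <= theta by rewrite (le_trans k0) ?ltW.
have ty : theta * y < 1.
  have -> : theta * y = (kappa * y * (y + 2) + y) / (2 * (y + 1)).
    by rewrite /theta; field; rewrite gt_eqF //; lra.
  rewrite ltr_pdivrMr // mul1r.
  have : kappa * y * (y + 2) < 1 * (y + 2) by rewrite ltr_pM2r //; lra.
  by lra.
have [M cM] := gc _ kt.
apply: normed_cvg.
apply: (@series_le_cvg R _ (geometric M (theta * y))).
- by move=> n /=.
- by move=> n /=; rewrite exprMn mulrA mulr_ge0 ?exprn_ge0 // (le_trans _ (cM n)).
- by move=> n /=; rewrite normrM normrX exprMn mulrA ler_wpM2r ?exprn_ge0.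
- by apply: is_cvg_geometric_series; rewrite ger0_norm // mulr_ge0.
Qed.

(** The factor [n + 1] is absorbed by a slightly larger ratio, through the
    Bernoulli inequality. *)
Lemma geometric_growth_diffs kappa c : 0 <= kappa ->
  geometric_growth kappa c -> geometric_growth kappa (pseries_diffs c).
Proof.
move=> k0 gc theta kt; pose t := (kappa + theta) / 2.
have kt' : kappa < t by rewrite /t; lra.
have t0 : 0 < t by rewrite (le_lt_trans k0).
have tt : t < theta by rewrite /t; lra.
clearbody t.
have [M cM] := gc _ kt'.
have M0 : 0 <= M by have := cM 0; rewrite expr0 mulr1; apply: le_trans.
pose d := theta / t - 1.
have d0 : 0 < d by rewrite subr_gt0 ltr_pdivlMr // mul1r.
have bern n : 1 + n%:R * d <= (theta / t) ^+ n.
  have -> : theta / t = 1 + d by rewrite addrC subrK.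
  elim: n => [|n IH]; first by rewrite mul0r addr0 expr0.
  rewrite exprS.
  have : (1 + d) * (1 + n%:R * d) <= (1 + d) * (1 + d) ^+ n.
    by rewrite ler_wpM2l //; lra.
  apply: le_trans; rewrite -(natr1 n).
  have : 0 <= n%:R * d * d by rewrite !mulr_ge0 // ltW.
  by lra.
exists (M * t * (1 + d^-1)) => n.
rewrite /pseries_diffs normrM ger0_norm //.
apply: (@le_trans _ _ (n.+1%:R * (M * t ^+ n.+1))); first by rewrite ler_wpM2l.
have -> : theta ^+ n = t ^+ n * (theta / t) ^+ n.
  by rewrite -exprMn; congr (_ ^+ _); field; rewrite gt_eqF.
rewrite exprS.
have -> : n.+1%:R * (M * (t * t ^+ n)) = (M * t * t ^+ n) * n.+1%:R by ring.
have -> : M * t * (1 + d^-1) * (t ^+ n * (theta / t) ^+ n) =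
   (M * t * t ^+ n) * ((1 + d^-1) * (theta / t) ^+ n) by ring.
rewrite ler_wpM2l //; first by rewrite !mulr_ge0 // ?exprn_ge0 ?(ltW t0).
have bn := bern n.
have n0 : 0 <= n%:R :> R by [].
have di : 0 < d^-1 by rewrite invr_gt0.
have : (1 + d^-1) * (1 + n%:R * d) <= (1 + d^-1) * (theta / t) ^+ n.
  by rewrite ler_wpM2l //; lra.
apply: le_trans; rewrite -natr1.
have -> : (1 + d^-1) * (1 + n%:R * d) = (n%:R + 1) + (n%:R * d + d^-1).
  by field; rewrite gt_eqF.
by rewrite lerDl addr_ge0 // ?mulr_ge0 // ltW.
Qed.

Lemma is_derive_pseries kappa c x : 0 <= kappa -> geometric_growth kappa c ->
  kappa * `|x| < 1 ->
  is_derive x 1 (fun x => limn (pseries c x)) (limn (pseries (pseries_diffs c) x)).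
Proof.
move=> k0 gc kx; set y := `|x|; have y0 : 0 <= y by exact: normr_ge0.
pose X := y + (1 - kappa * y) / (2 * (kappa + 1)).
have k1 : 0 < 2 * (kappa + 1) by lra.
have yX : y < X by rewrite ltrDl divr_gt0 // subr_gt0.
have X0 : 0 <= X by rewrite (le_trans y0) ?ltW.
have kX : kappa * `|X| < 1.
  rewrite ger0_norm //.
  have -> : kappa * X = (kappa * y * (kappa + 2) + kappa) / (2 * (kappa + 1)).
    by rewrite /X; field; rewrite gt_eqF //; lra.
  rewrite ltr_pdivrMr // mul1r.
  have : kappa * y * (kappa + 2) < 1 * (kappa + 2) by rewrite ltr_pM2r //; lra.
  by lra.
have gd := geometric_growth_diffs k0 gc.
apply: (@pseries_snd_diffs R c X x).
- exact: geometric_growth_cvg kX.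
- exact: geometric_growth_cvg kX.
- exact: geometric_growth_cvg (geometric_growth_diffs k0 gd) kX.
- by rewrite (ger0_norm X0).
Qed.

Lemma cvg_seq_scale (u : nat -> R) r l : u @ \oo --> l ->
  (fun n => r * u n) @ \oo --> r * l.
Proof. by move=> ul; apply: cvgM => //; exact: cvg_cst. Qed.

(** The Euler operator [x d/dx] multiplies the coefficient of [x^n] by [n]. *)
Lemma series_euler kappa c x : 0 <= kappa -> geometric_growth kappa c ->
  kappa * `|x| < 1 ->
  series (fun n => n%:R * c n * x ^+ n) @ \oo
    --> x * limn (pseries (pseries_diffs c) x).
Proof.
move=> k0 gc kx.
have cd := geometric_growth_cvg k0 (geometric_growth_diffs k0 gc) kx.
have := cvg_seq_scale (r := x) (pseries_diffs_equiv cd).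
have -> : (fun n => x * series (fun i => i%:R * c i * x ^+ i.-1) n) =
  series (fun n => n%:R * c n * x ^+ n) => //.
apply/funext => n; rewrite /series /= mulr_sumr; apply: eq_bigr => i _.
case: i => [|i]; first by rewrite !mul0r mulr0.
by rewrite exprS /=; ring.
Qed.

End power_series.

(** * The radial equation *)

Section radial_series.
Context {R : realType}.
Variables (N : nat) (k lam : R).
Hypothesis N0 : (0 < N)%N.

Let Nr : R := N%:R.

(** The pair [(a_n, c_n)] of the coefficients of [f] and of [(1 + k q) f], where
    [f] is the radial solution in the variable [q], the squared norm in the
    stereographic chart.  Carrying both turns the second order recurrence of
    [f] into a first order system, whose coefficients show the growth rate [`|k|]. *)
Fixpoint radial_coef (n : nat) : R * R :=
  if n is n'.+1 then
    let: (a, c) := radial_coef n' in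
    let c' := ((4 * Nr * k - lam) * a - k * (n'%:R - 1) * (4 * n'%:R - 2 * Nr) * c)
              / (n'.+1%:R * (4 * n'%:R + 2 * Nr)) in
    (c' - k * a, c')
  else (1, 1).

Let a n := (radial_coef n).1.
Let c n := (radial_coef n).2.

Let cS n : c n.+1 =
  ((4 * Nr * k - lam) * a n - k * (n%:R - 1) * (4 * n%:R - 2 * Nr) * c n)
              / (n.+1%:R * (4 * n%:R + 2 * Nr)).
Proof. by rewrite /c /a /=; case: (radial_coef n). Qed.

Let aS n : a n.+1 = c n.+1 - k * a n.
Proof. by rewrite /c /a /=; case: (radial_coef n). Qed.

Let Nr1 : 1 <= Nr.
Proof. by rewrite /Nr ler1n. Qed.

Let den_gt0 n : 0 < n.+1%:R * (4 * n%:R + 2 * Nr).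
Proof.
by apply: mulr_gt0 => //; have := Nr1; have : 0 <= n%:R :> R by []; lra.
Qed.

Let kappa := `|k|.
Let D := `|4 * Nr * k - lam|.

Let c_bound n : `|c n.+1| <= kappa * `|c n| + D / n.+1%:R * `|a n|.
Proof.
have d0 := den_gt0 n.
rewrite cS normrM normfV (gtr0_norm d0) ler_pdivrMr //.
apply: (le_trans (ler_normB _ _)).
have n0 : 0 <= n%:R :> R by [].
have N1 := Nr1.
have E : n.+1%:R = n%:R + 1 :> R by rewrite -natr1.
have -> : (kappa * `|c n| + D / n.+1%:R * `|a n|) * (n.+1%:R * (4 * n%:R + 2 * Nr))
  = (D * `|a n|) * (4 * n%:R + 2 * Nr) +
    (kappa * `|c n|) * (n.+1%:R * (4 * n%:R + 2 * Nr)) by field; rewrite gt_eqF //; lra.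
apply: lerD.
  by rewrite normrM -/D ler_peMr ?(mulr_ge0 (normr_ge0 _) (normr_ge0 _)) //; lra.
rewrite !normrM -/kappa.
have -> : kappa * `|n%:R - 1| * `|4 * n%:R - 2 * Nr| * `|c n| =
   (kappa * `|c n|) * (`|n%:R - 1| * `|4 * n%:R - 2 * Nr|) by ring.
apply: ler_wpM2l; first exact: mulr_ge0 (normr_ge0 _) (normr_ge0 _).
apply: ler_pM => //.
  by rewrite E ler_norml; apply/andP; split; lra.
by rewrite ler_norml; apply/andP; split; lra.
Qed.

(* For [e = theta - kappa], the bounds [`|a n| <= M theta ^ n] and
   [`|c n| <= (e / theta) M theta ^ n] propagate together once
   [n + 1 >= D theta / e ^ 2]; [M] takes care of the earlier terms. *)
Let growth theta : kappa < theta -> exists M, forall n,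
  `|a n| <= M * theta ^+ n /\ `|c n| <= M * theta ^+ n.
Proof.
move=> kt; have k0 : 0 <= kappa by exact: normr_ge0.
have t0 : 0 < theta by exact: le_lt_trans kt.
have [e eE] : exists e, e = theta - kappa by exists (theta - kappa).
have e0 : 0 < e by rewrite eE subr_gt0.
have D0 : 0 <= D by exact: normr_ge0.
have [n0 hn0] : exists n0 : nat, D * theta / e ^+ 2 <= n0.+1%:R.
  exists (Num.bound (D * theta / e ^+ 2)); apply: ltW.
  apply: (lt_le_trans (archi_boundP _)); last by rewrite ler_nat.
  by apply: divr_ge0; [exact: mulr_ge0 (ltW t0) | rewrite exprn_ge0 // ltW].
pose w i := (`|a i| + `|c i| * theta / e) / theta ^+ i.
have w0 i : 0 <= w i.
  rewrite /w divr_ge0 ?exprn_ge0 ?(ltW t0) // addr_ge0 //.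
  by apply: divr_ge0; [exact: mulr_ge0 (normr_ge0 _) (ltW t0) | exact: ltW].
pose M := \sum_(i < n0.+1) w i.
have M0 : 0 <= M by rewrite sumr_ge0.
have small i : (i <= n0)%N -> `|a i| <= M * theta ^+ i /\
    `|c i| * theta <= e * M * theta ^+ i.
  move=> ii; have ii' : (i < n0.+1)%N by [].
  have wM : w i <= M.
    by rewrite /M (bigD1 (Ordinal ii')) //= lerDl sumr_ge0.
  have ti : 0 < theta ^+ i by rewrite exprn_gt0.
  have : w i * theta ^+ i <= M * theta ^+ i by rewrite ler_pM2r.
  rewrite /w divfK ?gt_eqF // => H.
  have A0 : 0 <= `|a i| by [].
  have C0 : 0 <= `|c i| * theta / e.
    by apply: divr_ge0; [exact: mulr_ge0 (normr_ge0 _) (ltW t0) | exact: ltW].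
  split; first by lra.
  have : `|c i| * theta / e <= M * theta ^+ i by lra.
  by rewrite ler_pdivrMr // => /le_trans; apply; lra.
have all i : `|a (n0 + i)%N| <= M * theta ^+ (n0 + i) /\
    `|c (n0 + i)%N| * theta <= e * M * theta ^+ (n0 + i).
  elim: i => [|i [IHa IHc]]; first by rewrite addn0; exact: small.
  rewrite addnS; set n := (n0 + i)%N in IHa IHc *.
  have nn0 : n0.+1%:R <= n.+1%:R :> R by rewrite ler_nat ltnS leq_addr.
  have small_D : D * theta / n.+1%:R <= e ^+ 2.
    rewrite ler_pdivrMr // [e ^+ 2 * _]mulrC -ler_pdivrMr ?exprn_gt0 //.
    exact: le_trans nn0.
  have T0 : 0 <= M * theta ^+ n by rewrite mulr_ge0 // exprn_ge0 // ltW.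
  have Hc : `|c n.+1| <= e * (M * theta ^+ n).
    rewrite -(ler_pM2r t0).
    apply: (@le_trans _ _ (kappa * (`|c n| * theta) + D * theta / n.+1%:R * `|a n|)).
      have := c_bound n; rewrite -(ler_pM2r t0) => /le_trans; apply.
      by rewrite le_eqVlt; apply/orP; left; apply/eqP; ring.
    have H1 : kappa * (`|c n| * theta) <= kappa * (e * M * theta ^+ n).
      by rewrite ler_wpM2l.
    have H2 : D * theta / n.+1%:R * `|a n| <= e ^+ 2 * (M * theta ^+ n).
      apply: ler_pM => //; apply: divr_ge0 => //.
      by rewrite mulr_ge0 ?(ltW t0).
    apply: (le_trans (lerD H1 H2)).
    by rewrite le_eqVlt; apply/orP; left; apply/eqP; rewrite eE; ring.
  split.
    rewrite aS; apply: (le_trans (ler_normB _ _)).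
    rewrite normrM -/kappa exprS.
    have : kappa * `|a n| <= kappa * (M * theta ^+ n) by rewrite ler_wpM2l.
    move=> H; apply: (le_trans (lerD Hc H)).
    by rewrite le_eqVlt; apply/orP; left; apply/eqP; rewrite eE; ring.
  have : `|c n.+1| * theta <= e * (M * theta ^+ n) * theta by rewrite ler_pM2r.
  by move=> /le_trans; apply; rewrite exprS le_eqVlt; apply/orP; left; apply/eqP; ring.
have total n : `|a n| <= M * theta ^+ n /\ `|c n| * theta <= e * M * theta ^+ n.
  have [/small //|/ltnW nn] := leqP n n0.
  by rewrite -(subnKC nn); exact: all.
exists M => n; have [Ha Hc] := total n; split=> //.
rewrite -(ler_pM2r t0); apply: (le_trans Hc).
have T0 : 0 <= M * theta ^+ n by rewrite mulr_ge0 // exprn_ge0 // ltW.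
by rewrite -mulrA mulrC ler_wpM2l // eE; lra.
Qed.

Let ga : geometric_growth kappa a.
Proof. by move=> t /growth[M H]; exists M => n; exact: (H n).1. Qed.

Let gc : geometric_growth kappa c.
Proof. by move=> t /growth[M H]; exists M => n; exact: (H n).2. Qed.

(** [C] is the sum of the series [c_n]; the equation is the radial one for
    [C / (1 + k q)], multiplied by powers of [1 + k q]. *)
Lemma radial_series_exists : exists C C1 C2 : R -> R, C 0 = 1 /\
  forall q, `|k * q| < 1 -> [/\ is_derive q 1 C (C1 q), is_derive q 1 C1 (C2 q) &
   (1 + k * q) * (4 * q * C2 q + 2 * Nr * C1 q
     + k * (4 * q ^+ 2 * C2 q - 2 * Nr * q * C1 q + 2 * Nr * C q))
   = (4 * Nr * k - lam) * C q].
Proof.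
have k0 : 0 <= kappa by exact: normr_ge0.
pose d := pseries_diffs c; pose dd := pseries_diffs d.
have gd : geometric_growth kappa d by exact: geometric_growth_diffs.
pose nc n := n%:R * c n.
exists (fun q => limn (pseries c q)), (fun q => limn (pseries d q)),
  (fun q => limn (pseries dd q)); split.
  apply: (@cvg_lim R) => //.
  apply: cvg_near_cst.
  exists 1%N => // n /= n1; rewrite /pseries /series /=.
  rewrite big_mkord (bigD1 (Ordinal n1)) //= big1 ?addr0; last first.
    by move=> i; rewrite -val_eqE /= -lt0n => i0; rewrite expr0n gtn_eqF //= mulr0.
  by rewrite expr0 mulr1.
move=> q kq; have kq' : kappa * `|q| < 1 by rewrite -normrM.
split; [exact: is_derive_pseries kq' | exact: is_derive_pseries kq' | ].
set C := limn (pseries c q); set C1 := limn (pseries d q).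
set C2 := limn (pseries dd q).
have Sa : series (fun n => a n * q ^+ n) @ \oo --> limn (pseries a q).
  by have := geometric_growth_cvg k0 ga kq'.
set A := limn _ in Sa.
have Sc : series (fun n => c n * q ^+ n) @ \oo --> C.
  by have := geometric_growth_cvg k0 gc kq'.
have Sd : series (fun n => d n * q ^+ n) @ \oo --> C1.
  by have := geometric_growth_cvg k0 gd kq'.
have Enc := series_euler k0 gc kq'; rewrite -/C1 in Enc.
have End := series_euler k0 gd kq'; rewrite -/C2 in End.
have gnc : geometric_growth kappa nc.
  move=> t kt; have t0 : 0 < t by exact: le_lt_trans kt.
  have [M HM] := gd t kt.
  have M0 : 0 <= M by have := HM 0; rewrite expr0 mulr1; apply: le_trans.
  exists (M / t) => -[|n].
    by rewrite /nc mul0r normr0 expr0 mulr1 divr_ge0 // ltW.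
  by rewrite exprS mulrA divfK ?gt_eqF //; exact: HM.
have Ennc := series_euler k0 gnc kq'.
have Lnc : limn (pseries (pseries_diffs nc) q) = q * C2 + C1.
  apply: (@cvg_lim R) => //.
  rewrite (_ : pseries _ q = series (fun n => n%:R * d n * q ^+ n) +
      series (fun n => d n * q ^+ n)); first exact: cvgD End Sd.
  apply/funext => n; rewrite /pseries /series /=.
  rewrite -[RHS]big_split /=.
  by apply: eq_bigr => i _; rewrite /pseries_diffs /nc /d /pseries_diffs; ring.
rewrite Lnc in Ennc.
(* the relation [c_(n+1) = a_(n+1) + k a_n], summed *)
have AC : (1 + k * q) * A = C.
  have S1 : (fun n => series (fun n => a n * q ^+ n) n.+1 +
       (k * q) * series (fun n => a n * q ^+ n) n) @ \oo --> A + (k * q) * A.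
    by apply: cvgD; [rewrite -cvg_shiftS in Sa | exact: cvg_seq_scale].
  have S2 : (fun n => series (fun n => c n * q ^+ n) n.+1) @ \oo --> C.
    by rewrite -cvg_shiftS in Sc.
  have E : (fun n => series (fun n => a n * q ^+ n) n.+1 +
       (k * q) * series (fun n => a n * q ^+ n) n)
     = (fun n => series (fun n => c n * q ^+ n) n.+1).
    apply/funext => n; rewrite /series /= !big_nat_recl //= mulr_sumr.
    rewrite -addrA -big_split /=; congr (_ + _); apply: eq_bigr => i _.
    by rewrite aS exprS; ring.
  rewrite E in S1; rewrite mulrDl mul1r.
  by rewrite -(cvg_lim _ S1) // -(cvg_lim _ S2).
rewrite -AC; set rhs := _ * (_ * A).
suff : 4 * q * C2 + 2 * Nr * C1 + k * (4 * q ^+ 2 * C2 - 2 * Nr * q * C1 + 2 * Nr * C)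
   = (4 * Nr * k - lam) * A.
  move=> E; rewrite /rhs [RHS](_ : _ = (1 + k * q) * ((4 * Nr * k - lam) * A)).
    by rewrite -E AC.
  by ring.
(* The recurrence makes the partial sums of the equation vanish identically;
   [Z] computes their limit through the Euler operator. *)
have Z : (fun n => 4 * series (fun n => n%:R * d n * q ^+ n) n
   + 2 * Nr * series (fun n => d n * q ^+ n) n
   + k * (4 * series (fun n => n%:R * nc n * q ^+ n) n
     - 4 * series (fun n => n%:R * c n * q ^+ n) n
     - 2 * Nr * series (fun n => n%:R * c n * q ^+ n) n
     + 2 * Nr * series (fun n => c n * q ^+ n) n)
   - (4 * Nr * k - lam) * series (fun n => a n * q ^+ n) n) @ \oo -->
   4 * (q * C2) + 2 * Nr * C1 + k * (4 * (q * (q * C2 + C1)) - 4 * (q * C1)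
     - 2 * Nr * (q * C1) + 2 * Nr * C) - (4 * Nr * k - lam) * A.
  apply: cvgB; last exact: cvg_seq_scale.
  apply: cvgD; first by apply: cvgD; exact: cvg_seq_scale.
  apply: cvg_seq_scale; apply: cvgD; last exact: cvg_seq_scale.
  by apply: cvgB; [apply: cvgB; exact: cvg_seq_scale | exact: cvg_seq_scale].
have Z0 : (fun n => 4 * series (fun n => n%:R * d n * q ^+ n) n
   + 2 * Nr * series (fun n => d n * q ^+ n) n
   + k * (4 * series (fun n => n%:R * nc n * q ^+ n) n
     - 4 * series (fun n => n%:R * c n * q ^+ n) n
     - 2 * Nr * series (fun n => n%:R * c n * q ^+ n) n
     + 2 * Nr * series (fun n => c n * q ^+ n) n)
   - (4 * Nr * k - lam) * series (fun n => a n * q ^+ n) n) = fun=> 0.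
  apply/funext => n; rewrite /series /= !mulr_sumr -!sumrB -!big_split /=.
  rewrite mulr_sumr -!big_split /= -sumrB big1 // => i _.
  rewrite /nc /d /pseries_diffs cS.
  have := den_gt0 i; move: (i.+1%:R) (pnatr_eq0 R i.+1) => m m0 /gt_eqF.
  rewrite mulf_eq0 m0 /= => h.
  by field; rewrite h m0.
rewrite Z0 in Z.
have Z1 := cvg_lim (@Rhausdorff R) Z; rewrite lim_cst // in Z1.
by apply/esym/eqP; rewrite -subr_eq0 -oppr_eq0 opprB; apply/eqP; rewrite {}Z1; ring.
Qed.

End radial_series.

Section radial_solution.
Context {R : realType}.

(** The radial eigenvalue equation, written in the variable
    [z = (1 - cos (sqrt K rho)) / K]; it is solved by a power series in
    [q = 4 z / (2 - K z)], for which the half-plane [K z < 1] becomes the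
    disc of convergence. *)
Lemma radial_solution_exists (N : nat) (K lam : R) : (0 < N)%N ->
  exists F F1 F2 : R -> R, F 0 = 1 /\
  forall z, K * z < 1 -> [/\ is_derive z 1 F (F1 z), is_derive z 1 F1 (F2 z) &
   (2 * z - K * z ^+ 2) * F2 z + N%:R * (1 - K * z) * F1 z + lam * F z = 0].
Proof.
move=> N0; have [C [C1 [C2 [C0 HC]]]] := @radial_series_exists R N (K / 4) lam N0.
pose q z := 4 * z / (2 - K * z).
(* [1 - K z / 2 = (1 + K / 4 * q)^-1], so this is [f], not [(1 + K / 4 * q) f] *)
exists (fun z => C (q z) * (1 - K * z / 2)),
  (fun z => 4 * C1 (q z) / (2 - K * z) - C (q z) * K / 2),
  (fun z => 32 * C2 (q z) / (2 - K * z) ^+ 3); split.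
  by rewrite /q !mulr0 !mul0r C0 subr0 mulr1.
move=> z Kz.
have d0 : 2 - K * z != 0 by rewrite gt_eqF //; lra.
have kq : `|K / 4 * q z| < 1.
  have -> : K / 4 * q z = K * z / (2 - K * z) by rewrite /q; field.
  rewrite normrM normfV (gtr0_norm (x := 2 - K * z)); last by lra.
  rewrite ltr_pdivrMr; last by lra.
  by rewrite mul1r ltr_norml; apply/andP; split; lra.
have [dC dC1 E] := HC _ kq.
have dlin : is_derive z 1 (fun z => 2 - K * z) (- K).
  have := is_derive_sub (is_derive_const (2 : R) z 1) (is_derive_scale K (is_derive_var z)).
  by move=> H; apply: is_derive_eq H _; ring.
have dinv : is_derive z 1 (fun z => (2 - K * z)^-1) (K / (2 - K * z) ^+ 2).
  by apply: is_derive_eq (is_derive_inv (f := fun z => 2 - K * z) d0 dlin) _; field.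
have dq : is_derive z 1 q (8 / (2 - K * z) ^+ 2).
  apply: is_derive_eq (is_derive_mul (is_derive_scale 4 (is_derive_var z)) dinv) _.
  by field.
have dCq := is_derive_comp dC dq.
have dC1q := is_derive_comp dC1 dq.
split.
- have dl2 : is_derive z 1 (fun z => 1 - K * z / 2) (- K / 2).
    have := is_derive_sub (is_derive_const (1 : R) z 1)
      (is_derive_mul (is_derive_scale K (is_derive_var z)) (is_derive_const (2^-1 : R) z 1)).
    by move=> H; apply: is_derive_eq H _; ring.
  by apply: is_derive_eq (is_derive_mul dCq dl2) _; field.
- have := is_derive_sub (is_derive_mul (is_derive_scale 4 dC1q) dinv)
    (is_derive_mul (is_derive_mul dCq (is_derive_const K z 1)) (is_derive_const (2^-1 : R) z 1)).
  by move=> H; apply: is_derive_eq H _; field.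
- have k1 : 1 + K / 4 * q z = 2 / (2 - K * z) by rewrite /q; field.
  move: E; rewrite k1 => E.
  have E' : (4 * N%:R * (K / 4) - lam) * C (q z) * (1 - K * z / 2) =
     4 * q z * C2 (q z) + 2 * N%:R * C1 (q z) +
     K / 4 * (4 * q z ^+ 2 * C2 (q z) - 2 * N%:R * q z * C1 (q z) + 2 * N%:R * C (q z)).
    by rewrite -E; field.
  have -> : lam * (C (q z) * (1 - K * z / 2)) = (4 * N%:R * (K / 4)) * C (q z) * (1 - K * z / 2)
     - (4 * N%:R * (K / 4) - lam) * C (q z) * (1 - K * z / 2) by ring.
  rewrite E'; set c2 := C2 _; set c1 := C1 _; set c0 := C _.
  by rewrite /q; field.
Qed.

End radial_solution.

(** * The functions sigma_K and their primitives *)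

Section model_functions.
Context {R : realType}.
Implicit Types (K r s : R).

(** The derivative of [sigma K]. *)
Definition cos_K K r : R :=
  if 0 < K then cos (Num.sqrt K * r)
  else if K < 0 then (expR (Num.sqrt (- K) * r) + expR (- (Num.sqrt (- K) * r))) / 2
  else 1.

(** The primitive of [sigma K] vanishing at [0], that is [(1 - cos_K) / K] when
    [K != 0] and [r ^ 2 / 2] when [K = 0]; the half angle avoids dividing by [K]. *)
Definition vers K r : R := 2 * sigma K (r / 2) ^+ 2.

(** [r] does not exceed the diameter of the space form. *)
Definition within_diam K r := 0 < K -> Num.sqrt K * r <= pi.

Lemma curvature_case K : [\/ 0 < K, K < 0 | K = 0].
Proof.
by have [?|?|?] := ltrgtP K 0; [constructor 2|constructor 1|constructor 3].
Qed.

Lemma is_derive_sigma K r : is_derive r 1 (sigma K) (cos_K K r).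
Proof.
rewrite /sigma /cos_K; case: (curvature_case K) => HK.
- rewrite HK; have k0 : Num.sqrt K != 0 by rewrite gt_eqF // sqrtr_gt0.
  have D := is_derive_comp (is_derive_sin (Num.sqrt K * r))
    (is_derive_scale (Num.sqrt K) (is_derive_var r)).
  by apply: is_derive_eq (is_derive_mul D (is_derive_const (Num.sqrt K)^-1 r 1)) _; field.
- rewrite HK ltNge (ltW HK) /= /hyp_sin; set k := Num.sqrt (- K).
  have k0 : k != 0 by rewrite gt_eqF // sqrtr_gt0 oppr_gt0.
  have D1 := is_derive_comp (f := fun t => k * t) (is_derive_expR (k * r)) (is_derive_scale k (is_derive_var r)).
  have DN : is_derive r 1 (fun t => - (k * t)) (- k).
    by apply: is_derive_eq (is_derive_opp (is_derive_scale k (is_derive_var r))) _; ring.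
  have D2 := is_derive_comp (f := fun t => - (k * t)) (is_derive_expR (- (k * r))) DN.
  have D3 := is_derive_mul (is_derive_mul (is_derive_sub D1 D2)
    (is_derive_const (2^-1 : R) r 1)) (is_derive_const k^-1 r 1).
  by apply: is_derive_eq D3 _; field.
- by rewrite HK ltxx; exact: is_derive_var.
Qed.

Lemma is_derive_cos_K K r : is_derive r 1 (cos_K K) (- (K * sigma K r)).
Proof.
rewrite /sigma /cos_K; case: (curvature_case K) => HK.
- rewrite HK; have k0 : Num.sqrt K != 0 by rewrite gt_eqF // sqrtr_gt0.
  have D := is_derive_comp (is_derive_cos (Num.sqrt K * r))
    (is_derive_scale (Num.sqrt K) (is_derive_var r)).
  by apply: is_derive_eq D _; rewrite -{3}[K]sqr_sqrtr ?ltW //; field.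
- rewrite HK ltNge (ltW HK) /= /hyp_sin.
  have E : - K = Num.sqrt (- K) ^+ 2 by rewrite sqr_sqrtr // oppr_ge0 ltW.
  move: E; set k := Num.sqrt (- K) => E.
  have k0 : k != 0 by rewrite gt_eqF // sqrtr_gt0 oppr_gt0.
  have D1 := is_derive_comp (f := fun t => k * t) (is_derive_expR (k * r)) (is_derive_scale k (is_derive_var r)).
  have DN : is_derive r 1 (fun t => - (k * t)) (- k).
    by apply: is_derive_eq (is_derive_opp (is_derive_scale k (is_derive_var r))) _; ring.
  have D2 := is_derive_comp (f := fun t => - (k * t)) (is_derive_expR (- (k * r))) DN.
  have D3 := is_derive_mul (is_derive_add D1 D2) (is_derive_const (2^-1 : R) r 1).
  have E' : K = - k ^+ 2 by rewrite -E opprK.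
  by apply: is_derive_eq D3 _; rewrite {1}E'; field.
- by rewrite HK ltxx mul0r oppr0; exact: is_derive_const.
Qed.

Lemma sigma0 K : sigma K 0 = 0.
Proof.
rewrite /sigma /hyp_sin !mulr0 sin0 oppr0 subrr !mul0r.
by case: ifP => // _; case: ifP.
Qed.

Lemma cos_K_sigma_sqr K r : cos_K K r ^+ 2 + K * sigma K r ^+ 2 = 1.
Proof.
rewrite /sigma /cos_K; case: (curvature_case K) => HK.
- rewrite HK; have k0 : Num.sqrt K != 0 by rewrite gt_eqF // sqrtr_gt0.
  rewrite -[RHS](cos2Dsin2 (Num.sqrt K * r)); congr (_ + _).
  by rewrite expr_div_n sqr_sqrtr ?ltW // mulrCA divff ?mulr1 // gt_eqF.
- rewrite HK ltNge (ltW HK) /= /hyp_sin.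
  have E : - K = Num.sqrt (- K) ^+ 2 by rewrite sqr_sqrtr // oppr_ge0 ltW.
  move: E; set k := Num.sqrt (- K) => E.
  have k0 : k != 0 by rewrite gt_eqF // sqrtr_gt0 oppr_gt0.
  have := expRxMexpNx_1 (k * r); move: (expR _) (expR _) => a b ab.
  have -> : K = - k ^+ 2 by rewrite -E opprK.
  by rewrite -[RHS]ab; field.
- by rewrite HK ltxx mul0r addr0 expr1n.
Qed.

Lemma cos_KB K r s : cos_K K (r - s) =
  cos_K K r * cos_K K s + K * (sigma K r * sigma K s).
Proof.
rewrite /sigma /cos_K; case: (curvature_case K) => HK.
- rewrite HK; have k0 : Num.sqrt K != 0 by rewrite gt_eqF // sqrtr_gt0.
  have E : K = Num.sqrt K ^+ 2 by rewrite sqr_sqrtr // ltW.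
  move: k0 E; set k := Num.sqrt K => k0 E.
  by rewrite mulrBr cosB {1}E; field.
- rewrite HK ltNge (ltW HK) /= /hyp_sin.
  have E : - K = Num.sqrt (- K) ^+ 2 by rewrite sqr_sqrtr // oppr_ge0 ltW.
  move: E; set k := Num.sqrt (- K) => E.
  have k0 : k != 0 by rewrite gt_eqF // sqrtr_gt0 oppr_gt0.
  rewrite mulrBr opprB !expRD ![expR (- _)]expRN.
  have := expR_gt0 (k * r); have := expR_gt0 (k * s).
  move: (expR _) (expR _) => a b a0 b0.
  have -> : K = - k ^+ 2 by rewrite -E opprK.
  by field; rewrite k0 !gt_eqF.
- by rewrite HK ltxx mul0r addr0 mulr1.
Qed.

Lemma sigma_double K r : sigma K r = 2 * sigma K (r / 2) * cos_K K (r / 2).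
Proof.
rewrite /sigma /cos_K; case: (curvature_case K) => HK.
- rewrite HK; have -> : Num.sqrt K * r = (Num.sqrt K * (r / 2)) *+ 2.
    by rewrite -mulr_natl; field.
  by rewrite sin_mulr2n -mulr_natl; ring.
- rewrite HK ltNge (ltW HK) /= /hyp_sin; set k := Num.sqrt (- K).
  have k0 : k != 0 by rewrite gt_eqF // sqrtr_gt0 oppr_gt0.
  have -> : k * r = k * (r / 2) + k * (r / 2) by field.
  rewrite opprD !expRD; move: (expR _) (expR _) => a b; field.
  by [].
- by rewrite HK ltxx; field.
Qed.

(** This and [is_derive_vers] let every formula be written with [vers] alone: it
    stays meaningful for [K = 0], where [cos_K] is constant. *)
Lemma cos_K_vers K r : K * vers K r = 1 - cos_K K r.
Proof.
have := cos_KB K (r / 2) (- (r / 2)).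
rewrite opprK -splitr => ->.
have sN : sigma K (- (r / 2)) = - sigma K (r / 2).
  rewrite /sigma /hyp_sin !mulrN sinN opprK.
  by case: ifP => _; [ring | case: ifP => _; [ring | ]].
have cN : cos_K K (- (r / 2)) = cos_K K (r / 2).
  rewrite /cos_K !mulrN cosN opprK.
  by case: ifP => // _; case: ifP => // _; rewrite addrC.
rewrite sN cN /vers.
have := cos_K_sigma_sqr K (r / 2); move: (cos_K _ _) (sigma _ _) => a b E.
by lra.
Qed.

Lemma vers0 K : vers K 0 = 0.
Proof. by rewrite /vers mul0r sigma0 expr0n mulr0. Qed.

Lemma vers_flat r : vers 0 r = r ^+ 2 / 2.
Proof. by rewrite /vers /sigma ltxx; field. Qed.

Lemma is_derive_vers K r : is_derive r 1 (vers K) (sigma K r).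
Proof.
have D1 := is_derive_mul (is_derive_var r) (is_derive_const (2^-1 : R) r 1).
have D2 := is_derive_comp (f := fun t : R => t / 2) (is_derive_sigma K (r / 2)) D1.
by apply: is_derive_eq (is_derive_scale 2 (is_derive_pow 1 D2)) _;
  rewrite [RHS]sigma_double; field.
Qed.

Lemma sigma_sqr_vers K r : sigma K r ^+ 2 = 2 * vers K r - K * vers K r ^+ 2.
Proof.
have -> : 2 * vers K r - K * vers K r ^+ 2 = vers K r * (2 - K * vers K r) by ring.
rewrite cos_K_vers sigma_double.
have := cos_K_vers K r; have := cos_K_sigma_sqr K (r / 2).
rewrite /vers; move: (cos_K K r) (sigma _ _) (cos_K _ _) => c b a E1 E2.
have -> : c = 1 - 2 * K * b ^+ 2 by lra.
by rewrite !exprMn (_ : a ^+ 2 = 1 - K * b ^+ 2); [ring | lra].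
Qed.

Lemma versB K r s : vers K (r - s) =
  vers K r + vers K s - K * vers K r * vers K s - sigma K r * sigma K s.
Proof.
have [->|K0] := eqVneq K 0.
  by rewrite !vers_flat /sigma !ltxx; field.
apply: (mulfI K0); rewrite (cos_K_vers K (r - s)) cos_KB !mulrBr mulrDr.
have -> : K * (K * vers K r * vers K s) = (K * vers K r) * (K * vers K s) by ring.
by rewrite !cos_K_vers; ring.
Qed.

Lemma sigma_gt0 K r : 0 < r -> (0 < K -> Num.sqrt K * r < pi) -> 0 < sigma K r.
Proof.
move=> r0; rewrite /sigma; case: (curvature_case K) => HK Hr.
- have k0 : 0 < Num.sqrt K by rewrite sqrtr_gt0.
  by rewrite HK divr_gt0 // sin_gt0_pi // mulr_gt0 //= Hr.
- have k0 : 0 < Num.sqrt (- K) by rewrite sqrtr_gt0 oppr_gt0.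
  have HK' : (0 < K) = false by rewrite ltNge ltW.
  rewrite HK' HK divr_gt0 // /hyp_sin divr_gt0 // subr_gt0 ltr_expR.
  have : 0 < Num.sqrt (- K) * r by rewrite mulr_gt0.
  by lra.
- by rewrite HK ltxx.
Qed.

Lemma vers_lt K r s : 0 <= r -> r < s -> within_diam K s -> vers K r < vers K s.
Proof.
move=> r0 rs sK.
have [||c] := @MVT R (vers K) (sigma K) r s rs.
- by move=> x _; exact: is_derive_vers.
- by apply: derivable_within_continuous => x _; apply: ex_derive; exact: is_derive_vers.
rewrite in_itv/= => /andP[rc cs] E.
rewrite -subr_gt0 E; apply: mulr_gt0; last by rewrite subr_gt0.
apply: sigma_gt0; first exact: le_lt_trans rc.
move=> K0.
by apply: lt_le_trans (sK K0); rewrite ltr_pM2l // sqrtr_gt0.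
Qed.

(** For [K <= 0] the crude bound [sigma K s >= s / 2] shows that [vers K] takes
    values above [v]. *)
Lemma vers_surj K v : 0 <= v -> (0 < K -> K * v <= 2) ->
  exists r, [/\ 0 <= r, within_diam K r & vers K r = v].
Proof.
move=> v0 Kv.
suff [b [b0 bK vb]] : exists b, [/\ 0 <= b, within_diam K b & v <= vers K b].
  have [||c] := @IVT R (vers K) 0 b v b0.
  - by apply: derivable_within_continuous => x _; apply: ex_derive; exact: is_derive_vers.
  - by rewrite vers0 ge_min v0 le_max vb orbT.
  rewrite in_itv/= => /andP[c0 cb] E; exists c; split=> // K0.
  by apply: le_trans (bK K0); rewrite ler_wpM2l // sqrtr_ge0.
have [K0|K0] := ltP 0 K.
  have k0 : 0 < Num.sqrt K by rewrite sqrtr_gt0.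
  exists (pi / Num.sqrt K); split.
  - by rewrite divr_ge0 ?pi_ge0 // ltW.
  - by move=> _; rewrite mulrCA divff ?mulr1 // gt_eqF.
  rewrite -(ler_pM2l K0) cos_K_vers /cos_K K0 mulrCA divff ?mulr1 ?gt_eqF // cospi.
  by have := Kv K0; lra.
exists (Num.sqrt (8 * v)); split; first exact: sqrtr_ge0.
  by move=> ?; lra.
set b := Num.sqrt _; have b0 : 0 <= b by exact: sqrtr_ge0.
have b2 : b ^+ 2 = 8 * v by rewrite sqr_sqrtr // mulr_ge0.
suff : b / 4 <= sigma K (b / 2).
  move=> H; have : (b / 4) ^+ 2 <= sigma K (b / 2) ^+ 2.
    by rewrite ler_pXn2r // nnegrE ?divr_ge0 // (le_trans _ H) // divr_ge0.
  rewrite /vers expr_div_n b2; lra.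
rewrite /sigma; case: (curvature_case K) => HK; first by lra.
  have HK' : (0 < K) = false by rewrite ltNge ltW.
  rewrite HK' HK /hyp_sin; set k := Num.sqrt (- K).
  have k0 : 0 < k by rewrite sqrtr_gt0 oppr_gt0.
  rewrite ler_pdivlMr //.
  have H1 := expR_ge1Dx (k * (b / 2)).
  have H2 : expR (- (k * (b / 2))) <= 1.
    by rewrite expR_le1 oppr_le0 mulr_ge0 ?(ltW k0) // divr_ge0.
  have : k * (b / 2) <= expR (k * (b / 2)) - expR (- (k * (b / 2))) by lra.
  lra.
by rewrite HK ltxx; lra.
Qed.

End model_functions.

(** * The bilinear form and the space form *)

Section bilinear_form.
Context {R : realType} {N : nat}.
Implicit Types (K a : R) (x y z : 'rV[R]_N.+1).

Local Notation B := space_form_bilin.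

Lemma bilinC K x y : B K x y = B K y x.
Proof.
rewrite /space_form_bilin [x _ _ * y _ _]mulrC; congr (_ + _).
by apply: eq_bigr => i _; rewrite mulrC.
Qed.

Lemma bilinDl K x y z : B K (x + y) z = B K x z + B K y z.
Proof.
rewrite /space_form_bilin mxE.
under eq_bigr do rewrite mxE mulrDl.
by rewrite big_split /=; ring.
Qed.

Lemma bilinZl K a x z : B K (a *: x) z = a * B K x z.
Proof.
rewrite /space_form_bilin mxE.
under eq_bigr do rewrite mxE -mulrA.
by rewrite -mulr_sumr; ring.
Qed.

Lemma bilinDr K x y z : B K z (x + y) = B K z x + B K z y.
Proof. by rewrite ![B K z _]bilinC bilinDl. Qed.

Lemma bilinZr K a x z : B K z (a *: x) = a * B K z x.
Proof. by rewrite ![B K z _]bilinC bilinZl. Qed.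

Lemma bilinNl K x z : B K (- x) z = - B K x z.
Proof. by rewrite -scaleN1r bilinZl mulN1r. Qed.

Lemma bilinNr K x z : B K z (- x) = - B K z x.
Proof. by rewrite -scaleN1r bilinZr mulN1r. Qed.

Lemma bilin0l K z : B K 0 z = 0.
Proof. by rewrite -(scale0r 0) bilinZl mul0r. Qed.

Lemma bilin0r K z : B K z 0 = 0.
Proof. by rewrite bilinC bilin0l. Qed.

Definition bilinE := (bilinDl, bilinDr, bilinZl, bilinZr, bilinNl, bilinNr).

Lemma bilin_suml K I (r : seq I) (F : I -> 'rV[R]_N.+1) z :
  B K (\sum_(i <- r) F i) z = \sum_(i <- r) B K (F i) z.
Proof.
elim: r => [|i r IH]; first by rewrite !big_nil bilin0l.
by rewrite !big_cons bilinDl IH.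
Qed.

Lemma bilin_sumr K I (r : seq I) (F : I -> 'rV[R]_N.+1) z :
  B K z (\sum_(i <- r) F i) = \sum_(i <- r) B K z (F i).
Proof.
by rewrite bilinC bilin_suml; apply: eq_bigr => i _; rewrite bilinC.
Qed.

(** Isolates the Euclidean product [B 0] of the last [N] coordinates, the only
    definite part available when [K < 0]. *)
Lemma bilin_split K x y :
  B K x y = Num.sg K * (x ord0 ord0 * y ord0 ord0) + B 0 x y.
Proof. by rewrite /space_form_bilin sgr0 mul0r add0r. Qed.

Lemma bilin_flat_ge0 x : 0 <= B 0 x x.
Proof.
rewrite /space_form_bilin sgr0 mul0r add0r; apply: sumr_ge0 => i _.
by rewrite -expr2 sqr_ge0.
Qed.

Lemma bilin_flat_eq0 x : x ord0 ord0 = 0 -> B 0 x x = 0 -> x = 0.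
Proof.
move=> x0; rewrite /space_form_bilin sgr0 mul0r add0r => /eqP.
rewrite psumr_eq0 => [/allP H|i _]; last by rewrite -expr2 sqr_ge0.
apply/rowP => j; rewrite !mxE.
have [<-//|j0] := eqVneq ord0 j.
have [i -> _] := unlift_some j0.
by have := H i (mem_index_enum _); rewrite /= mulf_eq0 orbb => /eqP.
Qed.

(** The argument behind the Cauchy-Schwarz inequality; when [c <= 0], the
    assumption forces [c = 0] and [b = 0]. *)
Lemma discriminant_le (a b c : R) :
  (forall s, 0 <= a + 2 * s * b + s ^+ 2 * c) -> b ^+ 2 <= a * c.
Proof.
move=> H; have a0 : 0 <= a by have := H 0; rewrite expr0n /=; lra.
have [c0|c0] := ltP 0 c.
  have := H (- b / c).
  have -> : a + 2 * (- b / c) * b + (- b / c) ^+ 2 * c = (a * c - b ^+ 2) / c.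
    by field; rewrite gt_eqF.
  by rewrite pmulr_lge0 ?invr_gt0 // subr_ge0.
have c00 : c = 0.
  apply/eqP; rewrite eq_le c0 /= leNgt; apply/negP => cn.
  pose s := 1 + (a + 1) / (- c); have c' : 0 < - c by rewrite oppr_gt0.
  have q0 : 0 <= (a + 1) / (- c) by rewrite divr_ge0 ?(ltW c') //; lra.
  have s1 : s <= s ^+ 2 by rewrite expr2 ler_peMr /s //; lra.
  have : (a + 1) / (- c) * (- c) <= s ^+ 2 * (- c).
    by rewrite ler_pM2r // (le_trans _ s1) // /s; lra.
  rewrite divfK ?gt_eqF //.
  have := H s; have := H (- s); rewrite sqrrN; lra.
have [->|b0] := eqVneq b 0; first by rewrite c00 expr0n /= mulr0.
have := H (- (a + 1) / (2 * b)).
rewrite c00 mulr0 addr0.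
have -> : a + 2 * (- (a + 1) / (2 * b)) * b = -1 by field.
by rewrite lerNr oppr0 ler10.
Qed.

Lemma bilin_flat_CS x y : B 0 x y ^+ 2 <= B 0 x x * B 0 y y.
Proof.
apply: discriminant_le => s.
have := bilin_flat_ge0 (x + s *: y).
by rewrite !bilinE (bilinC _ y x); congr (0 <= _); ring.
Qed.

End bilinear_form.

Section space_form_theory.
Context {R : realType} {N : nat} (K : R).
Implicit Types (c o p x y v w : 'rV[R]_N.+1).

Local Notation B := (space_form_bilin K).
Local Notation SF := (@space_form R N K).

(** Orthogonality to [c] describes the tangent space when [K != 0]; it becomes void
    for [K = 0], when the tangent space is the hyperplane [x_0 = 0]. *)
Definition tangent c v := K * B c v = 0 /\ (K = 0 -> v ord0 ord0 = 0).

Lemma tangentZ c a v : tangent c v -> tangent c (a *: v).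
Proof.
move=> [cv v0]; split; first by rewrite bilinZr mulrCA cv mulr0.
by move=> /v0 E; rewrite mxE E mulr0.
Qed.

Lemma tangentD c v w : tangent c v -> tangent c w -> tangent c (v + w).
Proof.
move=> [cv v0] [cw w0]; split; first by rewrite bilinDr mulrDr cv cw addr0.
by move=> /[dup] /v0 E /w0 E'; rewrite mxE E E' addr0.
Qed.

Lemma space_form_norm x : SF x -> K != 0 -> K * B x x = 1.
Proof.
move=> + K0; rewrite /space_form /=; case: (curvature_case K) => HK.
- by rewrite HK => ->; rewrite divff.
- by rewrite HK ltNge (ltW HK) /= => -[-> _]; rewrite divff.
- by rewrite HK eqxx in K0.
Qed.

Lemma space_form_norm2 x : SF x -> K * (K * B x x) = K.
Proof.
move=> xS; have [->|K0] := eqVneq K 0; first by rewrite mul0r.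
by rewrite (space_form_norm xS K0) mulr1.
Qed.

Lemma space_form_time x : SF x -> K < 0 -> 0 < x ord0 ord0.
Proof. by rewrite /space_form /= => + HK; rewrite HK ltNge (ltW HK) => -[]. Qed.

Lemma space_form_flat x : SF x -> K = 0 -> x ord0 ord0 = 0.
Proof. by rewrite /space_form /= => + K0; rewrite K0 ltxx. Qed.

Lemma hyperbolic_space_part x : K < 0 -> 0 < K * B x x ->
  space_form_bilin 0 x x < x ord0 ord0 ^+ 2.
Proof.
move=> HK; rewrite nmulr_rgt0 // bilin_split ltr0_sg //; lra.
Qed.

(** The metric is positive definite.  For [K < 0], a tangent vector is orthogonal to
    the time-like [c], and the Euclidean Cauchy-Schwarz inequality makes it
    space-like. *)
Lemma tangent_bilin c v : SF c -> tangent c v ->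
  0 <= B v v /\ (B v v = 0 -> v = 0).
Proof.
move=> cS [cv v0]; case: (curvature_case K) => HK.
- rewrite bilin_split gtr0_sg // mul1r.
  have := bilin_flat_ge0 v; have := sqr_ge0 (v ord0 ord0) => q0 f0; split.
    by rewrite -expr2 addr_ge0.
  move=> /eqP; rewrite -expr2 paddr_eq0 // sqrf_eq0 => /andP[/eqP a /eqP b].
  exact: bilin_flat_eq0.
- have K0 : K != 0 by rewrite lt_eqF.
  have c0 := space_form_time cS HK.
  have sc : space_form_bilin 0 c c < c ord0 ord0 ^+ 2.
    by apply: hyperbolic_space_part => //; rewrite space_form_norm.
  have := mulfI K0; move=> /(_ (B c v) 0); rewrite mulr0 => /(_ cv).
  rewrite !(bilin_split K) ltr0_sg // !mulN1r => H.
  have := bilin_flat_CS c v.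
  have -> : space_form_bilin 0 c v = c ord0 ord0 * v ord0 ord0 by lra.
  rewrite exprMn -[v ord0 ord0 * _]expr2.
  have := bilin_flat_ge0 v; have := sqr_ge0 (v ord0 ord0).
  move E1 : (space_form_bilin 0 v v) => V.
  move E2 : (v ord0 ord0 ^+ 2) => q.
  move: sc; set C := space_form_bilin 0 c c; set p := c ord0 ord0 ^+ 2.
  move=> Cp q0 V0 CS.
  have qV : q <= V.
    have p0 : 0 < p by rewrite exprn_gt0.
    rewrite -(ler_pM2l p0); apply: le_trans CS _.
    by rewrite ler_wpM2r // ltW.
  split; first by lra.
  move=> E; have qVe : q = V by lra.
  have : (p - C) * V <= 0 by rewrite mulrBl; rewrite qVe in CS; lra.
  rewrite pmulr_rle0 ?subr_gt0 // => Vn.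
  have V00 : V = 0 by lra.
  apply: bilin_flat_eq0; last by rewrite E1.
  by apply/eqP; rewrite -sqrf_eq0 E2 qVe V00.
- have E : B v v = space_form_bilin 0 v v by rewrite HK.
  rewrite E; split; first exact: bilin_flat_ge0.
  by apply: bilin_flat_eq0; exact: v0.
Qed.

Lemma tangent_CS c v w : SF c -> tangent c v -> tangent c w ->
  B v w ^+ 2 <= B v v * B w w.
Proof.
move=> cS tv tw; apply: discriminant_le => s.
have [+ _] := tangent_bilin cS (tangentD tv (tangentZ s tw)).
by rewrite !bilinE (bilinC _ w v); congr (0 <= _); ring.
Qed.

(** Half the squared chordal distance; it equals [vers K] of the Riemannian
    distance, and it is a polynomial in the ambient coordinates. *)
Definition chord p x := B (x - p) (x - p) / 2.

Lemma chordC p x : chord p x = chord x p.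
Proof. by rewrite /chord -opprB bilinNl bilinNr opprK. Qed.

(** When [K != 0], both sides equal [1 - K B(c, p)]; the factor [K] lets the identity hold for
    [K = 0]. *)
Lemma chord_bilin c p : SF c -> SF p -> K * B c (c - p) = K * chord p c.
Proof.
move=> cS pS; have [->|K0] := eqVneq K 0; first by rewrite !mul0r.
have := space_form_norm cS K0; have := space_form_norm pS K0.
rewrite /chord !bilinE (bilinC _ p c) => Hp Hc.
lra.
Qed.

Lemma chord_cos c p : SF c -> SF p -> K != 0 -> K * B c p = 1 - K * chord p c.
Proof.
move=> cS pS K0; have := chord_bilin cS pS; rewrite bilinDr bilinNr.
by have := space_form_norm cS K0; lra.
Qed.

(** The tangential part of the chord [c - p] points away from [p], and by
    [bilin_proj] its length is [sigma K] of the distance. *)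
Lemma tangent_proj c p : SF c -> SF p ->
  tangent c ((c - p) - (K * chord p c) *: c).
Proof.
move=> cS pS; split=> [|K0].
  rewrite bilinDr bilinNr bilinZr mulrDr chord_bilin // -{1}(space_form_norm2 cS).
  by ring.
by rewrite !mxE (space_form_flat cS K0) (space_form_flat pS K0) K0; ring.
Qed.

Lemma bilin_proj c p : SF c -> SF p ->
  let w := (c - p) - (K * chord p c) *: c in
  B w w = 2 * chord p c - K * chord p c ^+ 2.
Proof.
move=> cS pS /=.
have E0 : B (c - p) (c - p) = 2 * chord p c by rewrite /chord; field.
have E1 := chord_bilin cS pS; have E2 := space_form_norm2 cS.
move: E0 E1; move: (c - p) => d E0 E1.
rewrite !bilinE (bilinC _ d c) E0.
move: E1 E2; set z := chord _ _; set b := B c d; set q := B c c => E1 E2.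
have -> : K * z * b = z * (K * z) by rewrite -[in RHS]E1; ring.
have -> : K * z * - (K * z * q) = - (z ^+ 2 * (K * (K * q))) by ring.
by rewrite E2; ring.
Qed.

(** Moving with velocity [v] at [c] changes [chord p] at most as fast as moving
    away from [p] along a geodesic. *)
Lemma chord_speed c p v : SF c -> SF p -> tangent c v ->
  B v (c - p) ^+ 2 <= B v v * (2 * chord p c - K * chord p c ^+ 2).
Proof.
move=> cS pS tv; rewrite -bilin_proj //.
have -> : B v (c - p) = B v ((c - p) - (K * chord p c) *: c).
  rewrite [RHS]bilinDr bilinNr bilinZr (bilinC _ v c).
  have -> : K * chord p c * B c v = chord p c * (K * B c v) by ring.
  by rewrite tv.1 mulr0 subr0.
exact: (tangent_CS cS tv (tangent_proj cS pS)).
Qed.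

Lemma space_form_bilin_gt0 x p : K < 0 -> SF x -> SF p -> 0 < K * B x p.
Proof.
move=> HK xS pS; rewrite nmulr_rgt0 // bilin_split ltr0_sg // mulN1r.
have x0 := space_form_time xS HK; have p0 := space_form_time pS HK.
have K0 : K != 0 by rewrite lt_eqF.
have sx : space_form_bilin 0 x x < x ord0 ord0 ^+ 2.
  by apply: hyperbolic_space_part => //; rewrite space_form_norm.
have sp : space_form_bilin 0 p p < p ord0 ord0 ^+ 2.
  by apply: hyperbolic_space_part => //; rewrite space_form_norm.
have CS := bilin_flat_CS x p.
suff : space_form_bilin 0 x p < x ord0 ord0 * p ord0 ord0 by lra.
have xp0 : 0 < x ord0 ord0 * p ord0 ord0 by rewrite mulr_gt0.
have [|b0] := ltP (space_form_bilin 0 x p) 0; first by move=> ?; lra.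
rewrite -(ltr_pXn2r (n := 2)) // ?nnegrE ?(ltW xp0) //.
apply: le_lt_trans CS _; rewrite exprMn.
by apply: ltr_pM => //; exact: bilin_flat_ge0.
Qed.

(** For [K >= 0] the form is nonnegative.  In general [z (2 - K z)] is a squared
    length, by [bilin_proj], and for [K < 0] two points of
    the upper sheet satisfy [K B(x, p) > 0], which excludes [z < 0]. *)
Lemma chord_ge0 p x : SF p -> SF x -> 0 <= chord p x.
Proof.
move=> pS xS; have [w0 _] := tangent_bilin xS (tangent_proj xS pS).
move: w0; rewrite bilin_proj //; set z := chord p x.
have [HK|HK] := leP 0 K.
  move=> _; rewrite /z /chord mulr_ge0 // bilin_split addr_ge0 //.
    by rewrite mulr_ge0 ?sgr_ge0 // -expr2 sqr_ge0.
  exact: bilin_flat_ge0.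
have K0 : K != 0 by rewrite lt_eqF.
have := space_form_bilin_gt0 HK xS pS; rewrite chord_cos // -/z => H.
have -> : 2 * z - K * z ^+ 2 = z * (2 - K * z) by ring.
by rewrite pmulr_lge0 //; lra.
Qed.

Lemma chord_eq0 p x : SF p -> SF x -> chord p x = 0 -> x = p.
Proof.
move=> pS xS z0; have [_] := tangent_bilin xS (tangent_proj xS pS).
rewrite bilin_proj // z0 expr0n !mulr0 subrr scale0r subr0 => /(_ erefl) /eqP.
by rewrite subr_eq0 => /eqP.
Qed.

Lemma chord_le2 p x : SF p -> SF x -> 0 < K -> K * chord p x <= 2.
Proof.
move=> pS xS K0; have [w0 _] := tangent_bilin xS (tangent_proj xS pS).
move: w0; rewrite bilin_proj //; have := chord_ge0 pS xS; set z := chord p x.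
rewrite le_eqVlt => /orP[/eqP <- _|z0]; first by rewrite mulr0.
have -> : 2 * z - K * z ^+ 2 = z * (2 - K * z) by ring.
by rewrite pmulr_rge0 // subr_ge0.
Qed.

(** For [K < 0], the sheet of the hyperboloid is recognized by the sign of the
    product with a point already known to lie on the upper one. *)
Lemma space_form_intro p x : SF p ->
  (K != 0 -> K * B x x = 1) -> (K < 0 -> 0 < K * B x p) ->
  (K = 0 -> x ord0 ord0 = 0) -> SF x.
Proof.
move=> pS x1 xp x0; rewrite /space_form /=; case: (curvature_case K) => HK.
- by rewrite HK; apply: (mulfI (lt0r_neq0 HK)); rewrite x1 ?divff ?gt_eqF.
- have K0 : K != 0 by rewrite lt_eqF.
  have HK' : (0 < K) = false by rewrite ltNge ltW.
  rewrite HK HK'; split; first by apply: (mulfI K0); rewrite x1 // divff.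
  have p0 := space_form_time pS HK.
  have sp : space_form_bilin 0 p p < p ord0 ord0 ^+ 2.
    by apply: hyperbolic_space_part => //; rewrite space_form_norm.
  have sx : space_form_bilin 0 x x < x ord0 ord0 ^+ 2.
    by apply: hyperbolic_space_part => //; rewrite x1.
  have := xp HK; rewrite nmulr_rgt0 // bilin_split ltr0_sg // mulN1r => H.
  rewrite ltNge; apply/negP => xn.
  have Hxp : 0 <= - x ord0 ord0 * p ord0 ord0 by rewrite mulr_ge0 ?oppr_ge0 // ltW.
  have CS := bilin_flat_CS x p.
  have : (- x ord0 ord0 * p ord0 ord0) ^+ 2 < space_form_bilin 0 x p ^+ 2.
    rewrite -[ltRHS]sqrrN ltr_pXn2r // ?nnegrE //; lra.
  move=> /lt_le_trans /(_ CS); rewrite exprMn sqrrN ltNge => /negP; apply.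
  by apply: ler_pM; rewrite ?bilin_flat_ge0 // ltW.
- by rewrite HK ltxx; exact: x0.
Qed.

End space_form_theory.

(** * Orthonormal frames and geodesics *)

Section frames.
Context {R : realType} {N : nat} (K : R).
Implicit Types (o x w : 'rV[R]_N.+1).

Local Notation B := (space_form_bilin K).

Lemma bilin_basis0 x : B (delta_mx ord0 ord0) x = Num.sg K * x ord0 ord0.
Proof.
rewrite /space_form_bilin mxE !eqxx mul1r big1 ?addr0 // => i _.
by rewrite mxE /= mul0r.
Qed.

Lemma bilin_basis i x : B (delta_mx ord0 (lift ord0 i)) x = x ord0 (lift ord0 i).
Proof.
rewrite /space_form_bilin mxE /= mul0r mulr0 add0r (bigD1 i) //= mxE !eqxx mul1r.
rewrite big1 ?addr0 // => j ji.
by rewrite mxE (inj_eq lift_inj) (negbTE ji) andbF mul0r.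
Qed.

(** For [K != 0], the reflection in the hyperplane orthogonal to [m = n + s E0], with [n] the
    normalization of [o] and [E0] the pole, exchanges [E0] and [- s n], so it
    carries the standard frame at the pole to a frame at [o].  The sign [s] keeps
    [B m m], which is a multiple of [1 + s n_0], away from zero. *)
Lemma frame_exists o : space_form K o -> exists e : 'I_N -> 'rV[R]_N.+1,
  [/\ forall i, tangent K o (e i), forall i j, B (e i) (e j) = (i == j)%:R &
      forall w, tangent K o w -> w = \sum_i B (e i) w *: e i].
Proof.
move=> oS; pose eps := Num.sg K.
have [n nE] : exists n, n = Num.sqrt `|K| *: o by exists (Num.sqrt `|K| *: o).
pose n0 := n ord0 ord0; pose s : R := if 0 <= n0 then 1 else -1.
have s2 : s * s = 1 by rewrite /s; case: ifP => _; rewrite ?mulrNN mulr1.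
have sn0 : 0 <= s * n0.
  by rewrite /s; case: ifPn => [?|]; rewrite ?mul1r // -ltNge => /ltW; rewrite mulN1r oppr_ge0.
have d0 : 1 + s * n0 != 0 by rewrite gt_eqF //; lra.
have e3 : eps * (eps * eps) = eps.
  by rewrite /eps; case: (curvature_case K) => HK; rewrite ?(gtr0_sg HK) ?(ltr0_sg HK) ?HK ?sgr0; ring.
have e2 : K != 0 -> eps * eps = 1.
  by move=> K0; rewrite -expr2 sqr_sg K0.
have nn : B n n = eps.
  rewrite nE bilinZl bilinZr mulrA -expr2 sqr_sqrtr //.
  have [K0|K0] := eqVneq K 0; first by rewrite /eps K0 normr0 sgr0 mul0r.
  by rewrite normrEsg -mulrA space_form_norm // mulr1.
pose E i : 'rV[R]_N.+1 := delta_mx ord0 (lift ord0 i).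
pose E0 : 'rV[R]_N.+1 := delta_mx ord0 ord0.
pose ni i := n ord0 (lift ord0 i).
have [m mE] : exists m, m = n + s *: E0 by exists (n + s *: E0).
have E0n : B E0 n = eps * n0 by exact: bilin_basis0.
have E0E0 : B E0 E0 = eps by rewrite bilin_basis0 mxE !eqxx mulr1.
have mm : B m m = 2 * eps * (1 + s * n0).
  rewrite mE !bilinE (bilinC _ n E0) nn E0n E0E0.
  have -> : eps + s * (eps * n0) + s * (eps * n0 + s * eps) =
    (1 + s * s) * eps + 2 * s * eps * n0 by ring.
  by rewrite s2; ring.
have Em i : B (E i) m = ni i.
  by rewrite bilin_basis mE !mxE /= mulr0 addr0.
have nm : B n m = eps * (1 + s * n0).
  by rewrite mE bilinDr bilinZr nn (bilinC _ n) E0n; ring.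
pose e i := E i - (eps * ni i / (1 + s * n0)) *: m.
have on v : B o v = 0 <-> (K = 0 -> B o v = 0) /\ (K != 0 -> B n v = 0).
  split=> [H|[H0 H1]]; first by split=> // _; rewrite nE bilinZl H mulr0.
  have [/H0 //|K0] := eqVneq K 0.
  have := H1 K0; rewrite nE bilinZl => /eqP; rewrite mulf_eq0 sqrtr_eq0 normr_le0.
  by rewrite (negbTE K0) => /eqP.
have te i : tangent K o (e i).
  split.
    have [->|K0] := eqVneq K 0; first by rewrite mul0r.
    suff -> : B o (e i) = 0 by rewrite mulr0.
    apply/on; split=> [/eqP|_]; first by rewrite (negbTE K0).
    rewrite /e bilinDr bilinNr bilinZr nm (bilinC _ n) bilin_basis -/(ni i).
    have -> : eps * ni i / (1 + s * n0) * (eps * (1 + s * n0)) = (eps * eps) * ni i by field.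
    by rewrite e2 // mul1r subrr.
  by move=> K0; rewrite !mxE /= /eps K0 sgr0 !mul0r subr0.
have ee i j : B (e i) (e j) = (i == j)%:R.
  rewrite /e !bilinE Em (bilinC _ m (E j)) Em mm.
  rewrite bilin_basis mxE eqxx (inj_eq lift_inj) /=.
  set d := 1 + s * n0 in d0 *.
  rewrite [LHS](_ : _ = (i == j)%:R + 2 * ni i * ni j / d * (eps * (eps * eps) - eps)).
    by rewrite e3 subrr mulr0 addr0.
  by field.
exists e; split=> //.
move=> w tw; apply/eqP; rewrite -subr_eq0; apply/eqP.
(* the remainder [w'] is tangent and orthogonal to the frame *)
set w' := w - _.
have tw' : tangent K o w'.
  apply: tangentD => //; rewrite -scaleN1r; apply: tangentZ.
  elim/big_ind : _ => [|x y|i _].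
  - by split=> [|_]; rewrite ?bilin0r ?mulr0 // mxE.
  - exact: tangentD.
  - exact: tangentZ.
have ew' i : B (e i) w' = 0.
  rewrite /w' bilinDr bilinNr bilin_sumr (bigD1 i) //= bilinZr ee eqxx mulr1.
  rewrite big1 ?addr0 ?subrr // => j ji.
  by rewrite bilinZr ee eq_sym (negbTE ji) mulr0.
clearbody w'.
have w'i i : w' ord0 (lift ord0 i) = eps * ni i / (1 + s * n0) * B m w'.
  have := ew' i; rewrite /e bilinDl bilinNl bilinZl bilin_basis => /eqP.
  by rewrite subr_eq0 => /eqP.
suff w0 : w' ord0 ord0 = 0 /\ (K != 0 -> B m w' = 0).
  apply/rowP => j; rewrite [RHS]mxE.
  have [<-|j0] := eqVneq ord0 j; first exact: w0.1.
  have [i -> _] := unlift_some j0; rewrite w'i.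
  have [K0|K0] := eqVneq K 0; first by rewrite /eps K0 sgr0 !mul0r.
  by rewrite w0.2 // mulr0.
have [K0|K0] := eqVneq K 0.
  by split=> //; exact: tw'.2.
have nw' : B n w' = 0.
  rewrite nE bilinZl; have := tw'.1 => /eqP; rewrite mulf_eq0 (negbTE K0) => /eqP ->.
  by rewrite mulr0.
have mw' : B m w' = s * eps * w' ord0 ord0.
  by rewrite mE bilinDl nw' add0r bilinZl bilin_basis0 mulrA.
(* Orthogonality to the frame expresses [w'] by its coordinate [w'_0] alone, and
   [B n w' = 0] then forces [w'_0 = 0]. *)
have : B n w' = eps * n0 * w' ord0 ord0 +
    s * w' ord0 ord0 / (1 + s * n0) * space_form_bilin 0 n n.
  rewrite bilin_split -/eps -/n0 mulrA; congr (_ + _).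
  rewrite /space_form_bilin !sgr0 !mul0r !add0r mulr_sumr; apply: eq_bigr => i _.
  rewrite w'i mw' -/(ni i).
  have -> : eps * ni i / (1 + s * n0) * (s * eps * w' ord0 ord0) =
     (eps * eps) * (ni i / (1 + s * n0) * (s * w' ord0 ord0)) by ring.
  by rewrite e2 // mul1r; ring.
have -> : space_form_bilin 0 n n = eps * (1 - (s * n0) * (s * n0)).
  have -> : s * n0 * (s * n0) = (s * s) * (n0 * n0) by ring.
  rewrite s2 mul1r mulrBr mulr1.
  by have := nn; rewrite bilin_split -/eps -/n0; lra.
rewrite nw'.
have -> : eps * n0 * w' ord0 ord0 + s * w' ord0 ord0 / (1 + s * n0) *
   (eps * (1 - s * n0 * (s * n0))) =
   eps * w' ord0 ord0 * (s + n0 * (1 - s * s)) by field.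
rewrite s2 subrr mulr0 addr0 => /esym/eqP.
have epsn0 : eps != 0 by rewrite sgr_eq0.
have s0 : s != 0 by apply/eqP => s0; move: s2; rewrite s0 mul0r => /eqP; rewrite eq_sym oner_eq0.
rewrite !mulf_eq0 (negbTE epsn0) (negbTE s0) orbF /= => /eqP w0.
by split=> // _; rewrite mw' w0 mulr0.
Qed.

End frames.

Section geodesics.
Context {R : realType} {N : nat} (K : R).
Implicit Types (o p q m v w : 'rV[R]_N.+1).

Local Notation B := (space_form_bilin K).
Local Notation SF := (@space_form R N K).
Local Notation ct := (cos_K K).
Local Notation sn := (sigma K).

Definition geodesic p v s := ct s *: p + sn s *: v.

Definition unit_tangent p v := tangent K p v /\ B v v = 1.

Lemma geodesic_space_form p v s : SF p -> unit_tangent p v -> SF (geodesic p v s).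
Proof.
move=> pS [[tv v0] v1]; apply: (space_form_intro pS) => [K0|HK|K0].
- have p1 := space_form_norm pS K0.
  rewrite /geodesic !bilinE (bilinC _ v p) v1.
  rewrite [LHS](_ : _ = ct s ^+ 2 * (K * B p p) + 2 * ct s * sn s * (K * B p v)
    + K * sn s ^+ 2); last by ring.
  by rewrite p1 tv mulr1 mulr0 addr0 cos_K_sigma_sqr.
- rewrite /geodesic !bilinE (bilinC _ v p).
  rewrite [ltRHS](_ : _ = ct s * (K * B p p) + sn s * (K * B p v)); last by ring.
  rewrite tv space_form_norm // ?lt_eqF // mulr1 mulr0 addr0.
  have HK' : (0 < K) = false by rewrite ltNge ltW.
  by rewrite /cos_K HK' HK divr_gt0 // addr_gt0 // expR_gt0.
- by rewrite !mxE (space_form_flat pS K0) (v0 K0) !mulr0 addr0.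
Qed.

Lemma geodesicB p v s : geodesic p v s - p = sn s *: v - (K * vers K s) *: p.
Proof. by rewrite /geodesic cos_K_vers scalerBl scale1r opprB [_ *: p + _]addrC -addrA. Qed.

(** The law of cosines. *)
Lemma chord_geodesic p v s m : SF p -> SF m -> unit_tangent p v ->
  chord K m (geodesic p v s) = chord K p m + vers K s
     - K * vers K s * chord K p m - sn s * B (m - p) v.
Proof.
move=> pS mS [[tv _] v1].
have -> : chord K m (geodesic p v s) =
    chord K p m + B (geodesic p v s - p) (geodesic p v s - p) / 2
    - B (m - p) (geodesic p v s - p).
  rewrite {1}/chord.
  have -> : geodesic p v s - m = (geodesic p v s - p) - (m - p).
    by rewrite opprB addrA subrK.
  rewrite /chord; move: (geodesic p v s - p) (m - p) => a b.
  by rewrite !bilinE (bilinC _ a b); field.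
have Epm : K * B (m - p) p = - (K * chord K p m).
  rewrite chordC -chord_bilin // -opprB bilinNl bilinC mulrN.
  by [].
have -> : B (m - p) (geodesic p v s - p) =
    sn s * B (m - p) v + K * vers K s * chord K p m.
  rewrite geodesicB bilinDr bilinNr !bilinZr.
  have -> : K * vers K s * B (m - p) p = vers K s * (K * B (m - p) p) by ring.
  by rewrite Epm; ring.
have -> : B (geodesic p v s - p) (geodesic p v s - p) = 2 * vers K s.
  rewrite geodesicB bilinDl !bilinDr !bilinNl !bilinNr !bilinZl !bilinZr.
  rewrite (bilinC _ v p) v1.
  have -> : K * vers K s * (K * vers K s * B p p) = (K * (K * B p p)) * vers K s ^+ 2 by ring.
  have -> : K * vers K s * (sn s * B p v) = vers K s * sn s * (K * B p v) by ring.
  have -> : sn s * (K * vers K s * B p v) = vers K s * sn s * (K * B p v) by ring.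
  by rewrite tv space_form_norm2 // mulr1 -expr2 sigma_sqr_vers; ring.
by field.
Qed.

(** The direction is the tangential part at [p] of [q - p], normalized; when
    [sigma K D] vanishes, [q] is [p] or its antipode and every direction serves. *)
Lemma geodesic_through p q D : (0 < N)%N -> SF p -> SF q ->
  vers K D = chord K p q ->
  exists2 v, unit_tangent p v & q = geodesic p v D.
Proof.
move=> N0 pS qS E.
have tw := tangent_proj pS qS; have ww := bilin_proj pS qS.
rewrite /= chordC -E -sigma_sqr_vers in ww; rewrite chordC -E in tw.
pose w := q - ct D *: p.
have wE : w = - ((p - q) - (K * vers K D) *: p).
  rewrite /w cos_K_vers scalerBl scale1r !opprB.
  by rewrite [RHS]addrC subrKA.
have {}tw : tangent K p w by rewrite wE -scaleN1r; exact: tangentZ.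
have {}ww : B w w = sn D ^+ 2 by rewrite wE bilinNl bilinNr opprK.
have [s0|s0] := eqVneq (sn D) 0.
  have [e [te ee _]] := frame_exists pS.
  exists (e (Ordinal N0)); first by split=> //; rewrite ee eqxx.
  have := (tangent_bilin pS tw).2; rewrite ww s0 expr0n => /(_ erefl) /eqP.
  by rewrite subr_eq0 => /eqP ->; rewrite /geodesic s0 scale0r addr0.
exists ((sn D)^-1 *: w).
  split; first exact: tangentZ.
  by rewrite bilinZl bilinZr ww; field.
by rewrite /geodesic scalerA divff // scale1r addrC subrK.
Qed.

End geodesics.

(** * Calculus of curves in the ambient space *)

Section vector_calculus.
Context {R : realType} {V : normedModType R}.

Lemma is_derive_row n (c : V -> 'rV[R]_n) x v dc :
  is_derive x v c dc <->
  (forall j, is_derive x v (fun t => c t ord0 j) (dc ord0 j)).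
Proof.
split=> [[dcx <-] j|H].
  split; first by have := (derivable_mxP c x v).1 dcx ord0 j.
  by rewrite derive_mx // mxE.
have dcx : derivable c x v.
  by apply/derivable_mxP => i j; rewrite (ord1 i); apply: ex_derive; exact: H.
split=> //; apply/rowP => j; rewrite derive_mx // mxE.
by apply: derive_val; exact: H.
Qed.

Lemma is_derive_big (W : normedModType R) I (r : seq I) (f : I -> V -> W) x v
    (df : I -> W) :
  (forall i, is_derive x v (f i) (df i)) ->
  is_derive x v (fun t => \sum_(i <- r) f i t) (\sum_(i <- r) df i).
Proof.
move=> H; elim: r => [|i r IH].
  by rewrite big_nil; under eq_fun do rewrite big_nil; exact: is_derive_cst.
by rewrite big_cons; under eq_fun do rewrite big_cons; exact: is_deriveD.
Qed.

Lemma is_derive_scalel n (f : V -> R) x v df (w : 'rV[R]_n) :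
  is_derive x v f df -> is_derive x v (fun t => f t *: w) (df *: w).
Proof.
move=> fd; apply/is_derive_row => j; rewrite mxE; under eq_fun do rewrite mxE.
by apply: is_derive_eq (is_derive_mul fd (is_derive_const (w ord0 j) x v)) _; ring.
Qed.

Lemma is_derive_vadd n (f g : V -> 'rV[R]_n) x v df dg :
  is_derive x v f df -> is_derive x v g dg ->
  is_derive x v (fun t => f t + g t) (df + dg).
Proof. exact: is_deriveD. Qed.

Lemma is_derive_bilin N K (f g : V -> 'rV[R]_N.+1) x v df dg :
  is_derive x v f df -> is_derive x v g dg ->
  is_derive x v (fun t => space_form_bilin K (f t) (g t))
    (space_form_bilin K (f x) dg + space_form_bilin K df (g x)).
Proof.
move=> /is_derive_row fd /is_derive_row gd; rewrite /space_form_bilin.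
have D1 := is_derive_scale (Num.sg K) (is_derive_mul (fd ord0) (gd ord0)).
have D2 := is_derive_big (index_enum 'I_N)
  (fun i => is_derive_mul (fd (lift ord0 i)) (gd (lift ord0 i))).
apply: is_derive_eq (is_derive_add D1 D2) _.
by rewrite big_split /= [X in _ + X = _](_ : _ = \sum_(i < N) f x ord0 (lift ord0 i) * dg ord0 (lift ord0 i)
  + \sum_(i < N) df ord0 (lift ord0 i) * g x ord0 (lift ord0 i));
  [ring | congr (_ + _); apply: eq_bigr => i _; rewrite mulrC].
Qed.

End vector_calculus.

Section vector_limits.
Context {R : realType} {T : Type} (F : set_system T) {FF : Filter F}.

Lemma cvg_sumr (W : normedModType R) I (r : seq I) (f : I -> T -> W) (l : I -> W) :
  (forall i, f i x @[x --> F] --> l i) ->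
  (fun t => \sum_(i <- r) f i t) @ F --> \sum_(i <- r) l i.
Proof.
move=> H; elim: r => [|i r IH].
  by rewrite big_nil; under eq_fun do rewrite big_nil; exact: cvg_cst.
by rewrite big_cons; under eq_fun do rewrite big_cons; exact: cvgD.
Qed.

Lemma cvg_coord n (f : T -> 'rV[R]_n) (a : 'rV[R]_n) j : f x @[x --> F] --> a ->
  (fun t => f t ord0 j) @ F --> a ord0 j.
Proof.
move=> fa; have H := @coord_continuous R 1 n ord0 j a.
by apply: (cvg_comp f (fun M : 'rV[R]_n => M ord0 j)); [exact: fa | exact: H].
Qed.

Lemma cvg_bilin N K (f g : T -> 'rV[R]_N.+1) (a b : 'rV[R]_N.+1) :
  f x @[x --> F] --> a -> g x @[x --> F] --> b ->
  (fun t => space_form_bilin K (f t) (g t)) @ F --> space_form_bilin K a b.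
Proof.
move=> fa gb; rewrite /space_form_bilin; apply: cvgD.
  by apply: cvgM; [exact: cvg_cst | apply: cvgM; exact: cvg_coord].
by apply: cvg_sumr => i; apply: cvgM; exact: cvg_coord.
Qed.

End vector_limits.

(** * The Riemannian distance *)

Section distance.
Context {R : realType} {N : nat} (K : R).
Implicit Types (o p q m v w : 'rV[R]_N.+1).

Local Notation B := (space_form_bilin K).
Local Notation SF := (@space_form R N K).

Lemma is_derive_geodesic p v (D t : R) :
  is_derive t 1 (fun t : R => geodesic K p v (t * D))
    ((- (K * sigma K (t * D)) * D) *: p + (cos_K K (t * D) * D) *: v).
Proof.
have Dt : is_derive t 1 (fun t : R => t * D) D.
  by apply: is_derive_eq (is_derive_mul (is_derive_var t) (is_derive_const D t 1)) _; ring.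
apply: is_derive_vadd; apply: is_derive_scalel.
  exact: (is_derive_comp (f := fun t : R => t * D) (is_derive_cos_K K (t * D)) Dt).
exact: (is_derive_comp (f := fun t : R => t * D) (is_derive_sigma K (t * D)) Dt).
Qed.

Lemma geodesic_speed p v (s : R) : SF p -> unit_tangent K p v ->
  let w := (- (K * sigma K s)) *: p + cos_K K s *: v in B w w = 1.
Proof.
move=> pS [[tv _] v1] /=; rewrite !bilinE (bilinC _ v p) v1.
set S := sigma K s; set C := cos_K K s.
rewrite [LHS](_ : _ = S ^+ 2 * (K * (K * B p p)) - 2 * S * C * (K * B p v) + C ^+ 2).
  rewrite space_form_norm2 // tv mulr0 subr0.
  by have := cos_K_sigma_sqr K s; rewrite -/S -/C; lra.
by ring.
Qed.

Lemma geodesic_curve p v (D : R) : SF p -> unit_tangent K p v -> 0 <= D ->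
  C1_curve K (fun t : R => geodesic K p v (t * D)) /\
  curve_length K (fun t : R => geodesic K p v (t * D)) = D.
Proof.
move=> pS pv D0.
have E : derive1 (fun t : R => geodesic K p v (t * D)) =
   fun t => (- (K * sigma K (t * D)) * D) *: p + (cos_K K (t * D) * D) *: v.
  by apply/funext => t; rewrite derive1E; apply: derive_val; exact: is_derive_geodesic.
split.
  split=> [t||t _]; last exact: geodesic_space_form.
    by apply: ex_derive; exact: is_derive_geodesic.
  rewrite E => t.
  have Dt : is_derive t 1 (fun t : R => t * D) D.
    by apply: is_derive_eq (is_derive_mul (is_derive_var t) (is_derive_const D t 1)) _; ring.
  have cs : {for t, continuous (fun t : R => sigma K (t * D))}.
    exact: (is_derive_continuous (is_derive_comp (f := fun t : R => t * D) (is_derive_sigma K (t * D)) Dt)).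
  have cc : {for t, continuous (fun t : R => cos_K K (t * D))}.
    exact: (is_derive_continuous (is_derive_comp (f := fun t : R => t * D) (is_derive_cos_K K (t * D)) Dt)).
  apply: cvgD; apply: cvgZl.
    apply: cvgM; last exact: cvg_cst.
    by apply: cvgN; apply: cvgM; [exact: cvg_cst | exact: cs].
  by apply: cvgM; [exact: cc | exact: cvg_cst].
rewrite /curve_length E.
have -> : (fun t => Num.sqrt (B ((- (K * sigma K (t * D)) * D) *: p + (cos_K K (t * D) * D) *: v)
    ((- (K * sigma K (t * D)) * D) *: p + (cos_K K (t * D) * D) *: v))) = fun=> D.
  apply/funext => t; set w := _ + _.
  have -> : w = D *: ((- (K * sigma K (t * D))) *: p + cos_K K (t * D) *: v).
    by rewrite scalerDr !scalerA ![D * _]mulrC.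
  by rewrite bilinZl bilinZr (geodesic_speed _ pS pv) mulr1 -expr2 sqrtr_sqr ger0_norm.
have dD (x : R) : 0 <= x <= 1 -> is_derive x 1 (fun t : R => t * D) D.
  move=> _.
  by apply: is_derive_eq (is_derive_mul (is_derive_var x) (is_derive_const D x 1)) _; ring.
have cD : continuous (fun _ : R => D) by move=> x; exact: cst_continuous.
by rewrite (Rintegral01_primitive cD dD) mul1r mul0r subr0.
Qed.

Lemma derive_of_constant (f : R -> R) (k t df : R) : 0 < t < 1 ->
  (forall s, 0 <= s <= 1 -> f s = k) -> is_derive t 1 f df -> df = 0.
Proof.
move=> t01 fk fd.
have E : \near t, f t = k.
  have : t \in `]0, 1[ by rewrite in_itv.
  move=> /near_in_itvoo; apply: filterS => s; rewrite in_itv/= => /andP[? ?].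
  by rewrite fk // !ltW.
have [_ <-] := near_eq_is_derive E fd.
exact: derive_cst.
Qed.

(** The velocity is tangent because [K B(c, c)], or the coordinate [c_0] when
    [K = 0], is constant.  The argument needs [c t] to stay on the space form near
    [t], hence [t] in the open interval. *)
Lemma C1_curve_tangent (c : R -> 'rV[R]_N.+1) (t : R) : C1_curve K c -> 0 < t < 1 ->
  is_derive t 1 c (derive1 c t) /\ tangent K (c t) (derive1 c t).
Proof.
move=> [dc _ cS] t01.
have D : is_derive t 1 c (derive1 c t) by rewrite derive1E; exact: derivableP.
split=> //; split=> [|K0].
  have DB := is_derive_scale K (is_derive_bilin K D D).
  have [K0|K0] := eqVneq K 0; first by rewrite K0 mul0r.
  have := derive_of_constant (k := 1) t01 _ DB.
  move=> /(_ (fun s ss => space_form_norm (cS s ss) K0)).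
  by rewrite (bilinC _ (derive1 c t)) => H; lra.
apply: (derive_of_constant (k := 0) t01 _ ((is_derive_row c t 1 _).1 D ord0)).
by move=> s /cS sS; rewrite (space_form_flat sS K0).
Qed.

(** A curve of length less than [D] stays within chord distance [vers K D].
    The comparison is made with a point moving along a geodesic slightly faster
    than the curve; where the two chord distances agree, the second grows faster. *)
Lemma chord_lt_of_short_curve (c : R -> 'rV[R]_N.+1) D : C1_curve K c ->
  within_diam K D -> curve_length K c < D -> chord K (c 0) (c 1) < vers K D.
Proof.
move=> cC DK.
pose sp (t : R) : R := Num.sqrt (B (derive1 c t) (derive1 c t)).
rewrite /curve_length -/sp => LD.
have csp : continuous sp.
  move=> t; apply: (cvg_comp (fun t => B (derive1 c t) (derive1 c t)) Num.sqrt);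
    last exact: sqrt_continuous.
  by have [_ cc _] := cC; apply: cvg_bilin; exact: cc.
have [G dG] : exists G : R -> R, forall x : R, -1 < x < 2 -> is_derive x 1 G (sp x).
  by apply: primitive_exists => x _; exact: csp.
have dG01 (x : R) : 0 <= x <= 1 -> is_derive x 1 G (sp x).
  by move=> /andP[? ?]; apply: dG; apply/andP; split; lra.
rewrite (Rintegral01_primitive csp dG01) in LD.
have G_mono (s t : R) : 0 <= s -> s <= t -> t <= 1 -> G s <= G t.
  move=> s0; rewrite le_eqVlt => /orP[/eqP -> //|st] t1.
  have [||x] := @MVT R G sp s t st.
  - by move=> x /[!in_itv]/= /andP[? ?]; apply: dG01; apply/andP; split; lra.
  - apply: derivable_within_continuous => x /[!in_itv]/= /andP[? ?].
    by apply: ex_derive; apply: dG01; apply/andP; split; lra.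
  move=> _ E; rewrite -subr_ge0 E mulr_ge0 ?sqrtr_ge0 // subr_ge0 ltW //.
have L0 : 0 <= G 1 - G 0 by rewrite subr_ge0 G_mono.
(* [l] is the arc length increased by a margin [eta (1 + t)], at most [2 eta], which
   makes the comparison strict at the start and in speed *)
pose eta := (D - (G 1 - G 0)) / 4; have eta0 : 0 < eta by rewrite /eta; lra.
have etaE : 4 * eta = D - (G 1 - G 0) by rewrite /eta; field.
clearbody eta; pose l (t : R) := G t - G 0 + eta * (1 + t).
have lD (t : R) : 0 <= t -> t <= 1 -> 0 < l t < D.
  move=> t0 t1; have := G_mono 0 t (lexx _) t0 t1; have := G_mono t 1 t0 t1 (lexx _).
  have : 0 <= eta * t <= eta by rewrite mulr_ge0 ?(ltW eta0) //= ler_piMr // ltW.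
  by move=> /andP[? ?] ? ?; rewrite /l mulrDr; apply/andP; split; lra.
have dl (t : R) : 0 <= t <= 1 -> is_derive t 1 l (sp t + eta).
  move=> tt; have D1 := is_derive_sub (dG01 _ tt) (is_derive_const (G 0) t 1).
  have D2 := is_derive_scale eta (is_derive_add (is_derive_const (1 : R) t 1) (is_derive_var t)).
  by apply: is_derive_eq (is_derive_add D1 D2) _; ring.
pose h (t : R) := vers K (l t) - chord K (c 0) (c t).
pose h' (t : R) := sigma K (l t) * (sp t + eta) - B (derive1 c t) (c t - c 0).
have dh (t : R) : 0 <= t <= 1 -> is_derive t 1 h (h' t).
  move=> tt; apply: is_derive_sub.
    exact: (is_derive_comp (is_derive_vers K (l t)) (dl _ tt)).
  have Dc : is_derive t 1 (fun t => c t - c 0) (derive1 c t).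
    have [dc _ _] := cC.
    have D1 : is_derive t 1 c (derive1 c t) by rewrite derive1E; exact: derivableP.
    by apply: is_derive_eq (is_deriveB D1 (is_derive_cst (c 0) t 1)) _; rewrite subr0.
  apply: is_derive_eq (is_derive_mul (is_derive_bilin K Dc Dc) (is_derive_const (2^-1 : R) t 1)) _.
  by rewrite (bilinC _ (c t - c 0)); field.
have [_ _ cS] := cC.
have c0S : SF (c 0) by apply: cS; rewrite lexx ler01.
have hpos (t : R) : 0 <= t < 1 -> 0 < h t.
  apply: (gt0_of_upward_crossing (h' := h')).
  - rewrite /h /chord subrr bilin0l mul0r subr0.
    have /andP[l0 lD0] := lD 0 (lexx _) ler01.
    suff : vers K 0 < vers K (l 0) by rewrite vers0.
    apply: vers_lt => // K0; apply: le_trans (DK K0).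
    by rewrite ler_wpM2l ?sqrtr_ge0 // ltW.
  - by move=> {}t /andP[? ?]; apply: dh; apply/andP; split; lra.
  move=> {}t t01 ht; have /andP[t0 t1] := t01.
  have [_ tt] := C1_curve_tangent cC t01.
  have ctS : SF (c t) by apply: cS; rewrite !ltW.
  have := chord_speed ctS c0S tt.
  have -> : chord K (c 0) (c t) = vers K (l t) by move: ht; rewrite /h; lra.
  rewrite -sigma_sqr_vers.
  have /andP[l0 lDt] := lD t (ltW t0) (ltW t1).
  have sl : 0 < sigma K (l t).
    apply: sigma_gt0 => // K0; apply: lt_le_trans (DK K0).
    by rewrite ltr_pM2l // sqrtr_gt0.
  have spp : B (derive1 c t) (derive1 c t) = sp t ^+ 2.
    by rewrite sqr_sqrtr //; exact: (tangent_bilin ctS tt).1.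
  have sp0 : 0 <= sp t by exact: sqrtr_ge0.
  rewrite spp -exprMn => CS.
  have : B (derive1 c t) (c t - c 0) <= sp t * sigma K (l t).
    apply: (le_trans (ler_norm _)).
    rewrite -(ger0_norm (x := sp t * _)); last by rewrite mulr_ge0 // ltW.
    by rewrite -ler_sqr ?nnegrE ?normr_ge0 // -!normrX !ger0_norm ?sqr_ge0.
  move=> H; rewrite /h' subr_gt0; apply: (le_lt_trans H).
  by rewrite mulrC ltr_pM2l // ltrDl.
have h1 : 0 <= h 1.
  rewrite leNgt; apply/negP => hn.
  have c1 : {for 1, continuous h}.
    by apply: is_derive_continuous (dh 1 _); rewrite lexx ler01.
  have [e /= e0 he] : \forall y \near (1 : R), h y < 0 by exact: (cvgr_lt _ c1).
  pose m := Num.min (e / 2) (1 / 2).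
  have m0 : 0 < m by rewrite lt_min; apply/andP; split; lra.
  have me : m <= e / 2 by rewrite ge_min lexx.
  have m1 : m <= 1 / 2 by rewrite ge_min lexx orbT.
  have : h (1 - m) < 0.
    by apply: he; rewrite /ball_/= opprB addrC subrK gtr0_norm //; lra.
  by apply/negP; rewrite -leNgt ltW // hpos //; apply/andP; split; lra.
have /andP[l0 l1] := lD 1 ler01 (lexx _).
have : vers K (l 1) < vers K D by apply: vers_lt => //; exact: ltW.
by move: h1; rewrite /h; lra.
Qed.

(** The arc [geodesic] of length [D] is a competitor, and shorter curves do not
    reach [q]. *)
Lemma riem_dist_vers p q D : (0 < N)%N -> SF p -> SF q -> 0 <= D ->
  within_diam K D -> vers K D = chord K p q -> riem_dist K p q = D.
Proof.
move=> N0 pS qS D0 DK E.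
have [v pv qE] := geodesic_through N0 pS qS E.
have [cC cL] := geodesic_curve pS pv D0.
have LB : lbound [set L | exists c : R -> 'rV[R]_N.+1,
    [/\ C1_curve K c, c 0 = p, c 1 = q & L = curve_length K c]] D.
  move=> L [c [cc c0 c1 ->]]; rewrite leNgt; apply/negP => /(chord_lt_of_short_curve cc DK).
  by rewrite c0 c1 E ltxx.
have HD : [set L | exists c : R -> 'rV[R]_N.+1,
    [/\ C1_curve K c, c 0 = p, c 1 = q & L = curve_length K c]] D.
  exists (fun t : R => geodesic K p v (t * D)); split=> //.
    by rewrite mul0r /geodesic sigma0 scale0r addr0 -[RHS]scale1r;
      congr (_ *: _); have := cos_K_vers K 0; rewrite vers0 mulr0; lra.
  by rewrite mul1r.
apply/eqP; rewrite eq_le; apply/andP; split.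
  by apply: ge_inf => //; exists D.
by apply: lb_le_inf => //; exists D.
Qed.

Lemma riem_distP p q : (0 < N)%N -> SF p -> SF q ->
  [/\ 0 <= riem_dist K p q, within_diam K (riem_dist K p q) &
      vers K (riem_dist K p q) = chord K p q].
Proof.
move=> N0 pS qS.
have [D [D0 DK E]] := vers_surj (chord_ge0 pS qS) (chord_le2 pS qS).
by rewrite (riem_dist_vers N0 pS qS D0 DK E).
Qed.

Lemma geod_ball_chord o r : (0 < N)%N -> SF o -> 0 < r -> within_diam K r ->
  geod_ball K o r = [set x | SF x /\ chord K o x < vers K r].
Proof.
move=> N0 oS r0 rK; apply/seteqP; split=> x /= [xS H]; split=> //;
  have [d0 dK dE] := riem_distP N0 oS xS.
  by rewrite -dE; exact: vers_lt.
rewrite ltNge; apply/negP; rewrite le_eqVlt => /orP[/eqP rd|rd].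
  by move: H; rewrite rd dE ltxx.
have := vers_lt (ltW r0) rd dK; rewrite dE => /lt_trans /(_ H).
by rewrite ltxx.
Qed.

(** Between points at distance less than the diameter, minimal geodesics are
    the arcs [geodesic]: the distances of [c t] to both ends determine the
    component of [c t] along [v], and then its chord to the arc vanishes. *)
Lemma minimal_geodesic_arc (c : R -> 'rV[R]_N.+1) : (0 < N)%N ->
  minimal_geodesic K c -> nonconstant c ->
  (0 < K -> K * chord K (c 0) (c 1) < 2) ->
  exists v D, [/\ unit_tangent K (c 0) v, 0 < D &
    forall t, 0 <= t <= 1 -> c t = geodesic K (c 0) v (t * D)].
Proof.
move=> N0 [cS cd] [s0 [t0 [s01 t01 cst]]] far.
have in0 : 0 <= (0 : R) <= 1 by rewrite lexx ler01.
have in1 : 0 <= (1 : R) <= 1 by rewrite lexx ler01.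
set p := c 0 in far *; set q := c 1 in far *.
pose D := riem_dist K p q.
have pS : SF p by exact: cS.
have qS : SF q by exact: cS.
have [D0 DK DE] := riem_distP N0 pS qS; rewrite -/D in D0 DK DE.
have Dpos : 0 < D.
  rewrite lt_neqAle D0 andbT; apply/eqP => D00; apply: cst.
  have := cd s0 t0 s01 t01; rewrite -/p -/q -/D -D00 mulr0 => E.
  have [_ _] := riem_distP N0 (cS _ s01) (cS _ t01); rewrite E vers0.
  by move=> /esym /(chord_eq0 (cS _ s01) (cS _ t01)).
have sD : 0 < sigma K D.
  have s2 : 0 < sigma K D ^+ 2.
    rewrite sigma_sqr_vers DE.
    have z0 : 0 < chord K p q by rewrite -DE; have := vers_lt (lexx 0) Dpos DK; rewrite vers0.
    have -> : 2 * chord K p q - K * chord K p q ^+ 2 = chord K p q * (2 - K * chord K p q) by ring.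
    rewrite pmulr_rgt0 // subr_gt0; have [/far //|K0] := ltP 0 K.
    by apply: le_lt_trans (ltr0n R 2); rewrite mulr_le0_ge0 // ltW.
  have : 0 <= sigma K D.
    rewrite /sigma; have [K0|K0] := ltP 0 K.
      by rewrite divr_ge0 ?sqrtr_ge0 // sin_ge0_pi // mulr_ge0 ?sqrtr_ge0 //= DK.
    have := @sigma_gt0 R K D Dpos; rewrite /sigma ltNge K0 /= => H.
    by apply: ltW; apply: H.
  by rewrite le_eqVlt => /orP[/eqP E|//]; rewrite -E expr0n ltxx in s2.
have [v pv qE] := geodesic_through N0 pS qS DE.
exists v, D; split=> // t tt; set m := c t.
have mS : SF m by exact: cS.
have [_ _ E0] := riem_distP N0 pS mS.
have [_ _ E1] := riem_distP N0 mS qS.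
have d0 : riem_dist K p m = t * D.
  by rewrite (cd 0 t in0 tt) sub0r normrN ger0_norm //; case/andP: tt.
have d1 : riem_dist K m q = D - t * D.
  rewrite (cd t 1 tt in1) distrC ger0_norm ?subr_ge0 ?mulrBl ?mul1r //.
  by case/andP: tt.
rewrite d0 in E0; rewrite d1 in E1.
(* the law of cosines at [p], applied to [q], can be solved for this product as
   [sigma K D > 0] *)
have beta : B (m - p) v = sigma K (t * D).
  have := chord_geodesic D pS mS pv; rewrite -qE -E1 -E0 versB => E.
  apply: (mulfI (lt0r_neq0 sD)); move: E; rewrite (mulrC (K * _)).
  move: (vers K D) (vers K (t * D)) => a b; lra.
apply: (chord_eq0 (geodesic_space_form _ pS pv) mS).
rewrite chordC chord_geodesic // -E0 beta -versB subrr.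
exact: vers0.
Qed.

End distance.

(** * The stereographic chart *)

Section C2_functions.
Context {R : realType} {n : nat} {W : normedModType R}.

Lemma is_derive_line (f : 'rV[R]_n -> W) y v (t : R) df :
  is_derive (y + t *: v) v f df ->
  is_derive t 1 (fun s : R => f (y + s *: v)) df.
Proof.
have E : (fun h : R => h^-1 *: (((fun s : R => f (y + s *: v)) \o shift t) (h *: 1)
    - (fun s : R => f (y + s *: v)) t))
  = (fun h : R => h^-1 *: ((f \o shift (y + t *: v)) (h *: v) - f (y + t *: v))).
  apply/funext => h /=; rewrite [h *: 1]mulr1 scalerDl addrCA.
  by [].
by move=> [d e]; split; rewrite /derivable /derive ?E.
Qed.

Lemma near_eq_continuous (f g : 'rV[R]_n -> W) y :
  (\near y, f y = g y) -> {for y, continuous f} -> {for y, continuous g}.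
Proof.
move=> E cf; rewrite /prop_for /continuous_at -(nbhs_singleton E).
by apply: cvg_trans cf; exact: (@near_eq_cvg _ _ (nbhs y) _ f g E).
Qed.

(** [C2_on] is about the operators ['D_v] themselves; here it is obtained from
    explicit candidates for the derivatives, which agree with them on [U] only. *)
Lemma C2_on_intro (U : set 'rV[R]_n) (f : 'rV[R]_n -> W)
    (df : 'I_n -> 'rV[R]_n -> W) (ddf : 'I_n -> 'I_n -> 'rV[R]_n -> W) :
  open U ->
  (forall y i, U y -> is_derive y (std_basis R i) f (df i y)) ->
  (forall y i j, U y -> is_derive y (std_basis R j) (df i) (ddf i j y)) ->
  (forall y i, U y -> {for y, continuous (df i)}) ->
  (forall y i j, U y -> {for y, continuous (ddf i j)}) ->
  C2_on U f.
Proof.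
move=> oU H1 H2 C1 C2.
have nU y : U y -> \near y, U y by move=> Uy; apply: open_nbhs_nbhs; split.
have E1 y i : U y -> \near y, 'D_(std_basis R i) f y = df i y.
  by move=> /nU; apply: filterS => z /H1 - /(_ i) [].
have N1 y i : U y -> \near y, df i y = 'D_(std_basis R i) f y.
  by move=> /E1 - /(_ i); apply: filterS => z.
have D2 y i j : U y -> is_derive y (std_basis R j) ('D_(std_basis R i) f) (ddf i j y).
  by move=> Uy; apply: near_eq_is_derive (H2 y i j Uy); exact: N1.
have N2 y i j : U y ->
    \near y, ddf i j y = 'D_(std_basis R j) ('D_(std_basis R i) f) y.
  by move=> /nU; apply: filterS => z /D2 - /(_ i j) [].
split.
  move=> y Uy i; split; first by apply: ex_derive; exact: H1.
  exact: near_eq_continuous (N1 y i Uy) (C1 y i Uy).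
move=> i y Uy j; split; first by apply: ex_derive; exact: D2.
exact: near_eq_continuous (N2 y i j Uy) (C2 y i j Uy).
Qed.

End C2_functions.

Section conformal_factor.
Context {R : realType} {N : nat} (K : R).
Implicit Types (y : 'rV[R]_N).

Definition sqnorm y : R := \sum_(i < N) y ord0 i ^+ 2.

(** All of the chart for [K >= 0], the Poincare ball for [K < 0]. *)
Definition conf_domain y := 0 < 1 + K / 4 * sqnorm y.

(** The metric of the space form is [conf y ^ 2] times the Euclidean one. *)
Definition conf y : R := (1 + K / 4 * sqnorm y)^-1.

(** [chord K o] read in the chart. *)
Definition chord_coord y : R := conf y * sqnorm y / 2.

Local Notation e_ i := (std_basis R i).

Lemma conf_eq y : conf_domain y -> conf y * (1 + K / 4 * sqnorm y) = 1.
Proof. by move=> /lt0r_neq0 H; rewrite mulVf. Qed.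

Lemma conf_gt0 y : conf_domain y -> 0 < conf y.
Proof. by move=> H; rewrite invr_gt0. Qed.

Lemma chord_coordE y : conf_domain y -> 1 - K * chord_coord y = 2 * conf y - 1.
Proof. by move=> /conf_eq; rewrite /chord_coord; lra. Qed.

Lemma is_derive_coord y i j : is_derive y (e_ i) (fun y : 'rV[R]_N => y ord0 j) (j == i)%:R.
Proof.
have := (is_derive_row (fun y : 'rV[R]_N => y) y (e_ i) (e_ i)).1 (is_derive_id y _) j.
by rewrite /std_basis mxE eqxx.
Qed.

Lemma is_derive_sqnorm y i : is_derive y (e_ i) sqnorm (2 * y ord0 i).
Proof.
have D := is_derive_big (index_enum 'I_N) (fun j => is_derive_pow 1 (is_derive_coord y i j)).
apply: is_derive_eq D _; rewrite (bigD1 i) //= eqxx big1 ?addr0 ?mulr1 ?expr1 // => j ji.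
by rewrite (negbTE ji) mulr0.
Qed.

Lemma is_derive_conf y i : conf_domain y ->
  is_derive y (e_ i) conf (- (K / 2) * conf y ^+ 2 * y ord0 i).
Proof.
move=> yU; have D1 := is_derive_add (is_derive_const (1 : R) y (e_ i))
  (is_derive_scale (K / 4) (is_derive_sqnorm y i)).
have D2 := is_derive_inv (f := fun y : 'rV[R]_N => 1 + K / 4 * sqnorm y) (lt0r_neq0 yU) D1.
apply: is_derive_eq D2 _; rewrite /conf; move: (lt0r_neq0 yU); move: (1 + _) => a a0.
by field.
Qed.

Lemma is_derive_conf_pow y i m : conf_domain y ->
  is_derive y (e_ i) (fun y => conf y ^+ m)
    (m%:R * conf y ^+ m * (- (K / 2) * conf y * y ord0 i)).
Proof.
move=> yU; case: m => [|m].
  by rewrite !mul0r; under eq_fun do rewrite expr0; exact: is_derive_const.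
by apply: is_derive_eq (is_derive_pow m (is_derive_conf i yU)) _; rewrite [conf y ^+ m.+1]exprS; ring.
Qed.

Lemma is_derive_chord_coord y i : conf_domain y ->
  is_derive y (e_ i) chord_coord (conf y ^+ 2 * y ord0 i).
Proof.
move=> yU; have D := is_derive_mul (is_derive_mul (is_derive_conf i yU) (is_derive_sqnorm y i))
  (is_derive_const (2^-1 : R) y (e_ i)).
apply: is_derive_eq D _.
have E := conf_eq yU; set m := conf y in E *; set q := sqnorm y in E *.
have -> : 2^-1 * (m * (2 * y ord0 i) + q * (- (K / 2) * m ^+ 2 * y ord0 i)) =
  m * y ord0 i * (m * (1 + K / 4 * q) - K / 4 * q * m) + (m * y ord0 i) * (1 - m * (1 + K / 4 * q)).
  by field.
rewrite mulr0 add0r E; have -> : 1 - K / 4 * q * m = m by rewrite -{1}E; ring.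
by ring.
Qed.

Lemma is_derive_chord_coord2 y i : conf_domain y ->
  is_derive y (e_ i) (fun y => conf y ^+ 2 * y ord0 i)
    (conf y ^+ 2 - K * conf y ^+ 3 * y ord0 i ^+ 2).
Proof.
move=> yU; have D := is_derive_mul (is_derive_conf_pow i 2 yU) (is_derive_coord y i i).
by apply: is_derive_eq D _; rewrite eqxx mulr1; field.
Qed.

Lemma continuous_sqnorm : continuous sqnorm.
Proof.
move=> y; apply: (@cvg_sumr R _ (nbhs y) _ _ _ _ (fun i (z : 'rV[R]_N) => z ord0 i ^+ 2)
  (fun i => y ord0 i ^+ 2)) => i.
under eq_fun do rewrite expr2.
by rewrite expr2; apply: cvgM; exact: coord_continuous.
Qed.

Lemma continuous_conf y : conf_domain y -> {for y, continuous conf}.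
Proof.
move=> yU; have C : (fun z => 1 + K / 4 * sqnorm z) @ nbhs y --> 1 + K / 4 * sqnorm y.
  apply: cvgD; first exact: cvg_cst.
  by apply: cvgM; [exact: cvg_cst | exact: continuous_sqnorm].
exact: (cvgV (lt0r_neq0 yU) C).
Qed.

Lemma continuous_chord_coord y : conf_domain y -> {for y, continuous chord_coord}.
Proof.
move=> yU.
have C : (fun z => conf z * sqnorm z / 2) @ nbhs y --> conf y * sqnorm y / 2.
  apply: cvgM; last exact: cvg_cst.
  by apply: cvgM; [exact: (continuous_conf yU) | exact: (@continuous_sqnorm y)].
exact: C.
Qed.

Lemma open_sqnorm_lt S : open [set y | sqnorm y < S].
Proof.
apply: (@open_comp _ _ sqnorm [set x | x < S]); last exact: open_lt.
by move=> y _; exact: continuous_sqnorm.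
Qed.

Lemma conf_domain_bounded y Z : K * Z < 2 -> 0 <= Z -> sqnorm y <= 4 * Z / (2 - K * Z) ->
  conf_domain y.
Proof.
move=> KZ Z0 qS; rewrite /conf_domain.
have d0 : 0 < 2 - K * Z by lra.
have q0 : 0 <= sqnorm y by apply: sumr_ge0 => i _; exact: sqr_ge0.
have [K0|K0] := leP 0 K.
  have : 0 <= K / 4 * sqnorm y by rewrite mulr_ge0 // divr_ge0.
  by lra.
have : K / 4 * (4 * Z / (2 - K * Z)) <= K / 4 * sqnorm y by rewrite ler_wnM2l //; lra.
have -> : K / 4 * (4 * Z / (2 - K * Z)) = 2 / (2 - K * Z) - 1 by field; rewrite gt_eqF.
have : 0 < 2 / (2 - K * Z) by rewrite divr_gt0.
by lra.
Qed.

Lemma chord_coord_lt y Z : K * Z < 2 -> conf_domain y ->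
  (chord_coord y < Z) = (sqnorm y < 4 * Z / (2 - K * Z)).
Proof.
move=> KZ yU; have d0 : 0 < 2 - K * Z by lra.
rewrite /chord_coord /conf -mulrA mulrC ltr_pdivrMr // ltr_pdivlMr //.
by apply/idP/idP => ?; lra.
Qed.

Lemma chord_coord_le y Z : K * Z < 2 -> conf_domain y ->
  (chord_coord y <= Z) = (sqnorm y <= 4 * Z / (2 - K * Z)).
Proof.
move=> KZ yU; have d0 : 0 < 2 - K * Z by lra.
rewrite /chord_coord /conf -mulrA mulrC ler_pdivrMr // ler_pdivlMr //.
by apply/idP/idP => ?; lra.
Qed.

End conformal_factor.

Section stereographic.
Context {R : realType} {N : nat} (K : R) (o : 'rV[R]_N.+1) (e : 'I_N -> 'rV[R]_N.+1).
Hypothesis oS : space_form K o.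
Hypothesis te : forall i, tangent K o (e i).
Hypothesis ee : forall i j, space_form_bilin K (e i) (e j) = (i == j)%:R.
Hypothesis e_full : forall w, tangent K o w -> w = \sum_i space_form_bilin K (e i) w *: e i.
Implicit Types (y : 'rV[R]_N) (x : 'rV[R]_N.+1).

Local Notation B := (space_form_bilin K).
Local Notation SF := (@space_form R N K).
Local Notation e_ i := (std_basis R i).
Local Notation conf := (conf K).
Local Notation conf_domain := (conf_domain K).
Local Notation chord_coord := (chord_coord K).

(** For [K != 0], the inverse of the stereographic projection from
    [- o]; for [K = 0], the affine chart given by the frame [e]. *)
Definition stereo y : 'rV[R]_N.+1 :=
  (2 * conf y - 1) *: o + \sum_i (conf y * y ord0 i) *: e i.

(* The factor [K] makes [bilin_combo] true for [K = 0] as well, where [o] need not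
   be orthogonal to the frame. *)
Let combo (a : R) (f : 'I_N -> R) : 'rV[R]_N.+1 := (K * a) *: o + \sum_i f i *: e i.

Let sum_delta (F : 'I_N -> R) j : \sum_i F i * (i == j)%:R = F j.
Proof.
rewrite (bigD1 j) //= eqxx mulr1 big1 ?addr0 // => i ij.
by rewrite (negbTE ij) mulr0.
Qed.

Let bilin_o_combo a f : K * B o (combo a f) = K * a.
Proof.
rewrite /combo bilinDr bilinZr bilin_sumr mulrDr mulr_sumr big1 ?addr0.
  rewrite [LHS](_ : _ = a * (K * (K * B o o))); last by ring.
  by rewrite space_form_norm2 // mulrC.
by move=> i _; rewrite bilinZr mulrCA (te i).1 mulr0.
Qed.

Let bilin_combo a f b g : B (combo a f) (combo b g) = K * a * b + \sum_i f i * g i.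
Proof.
have oe c h : (K * c) * B o (\sum_i h i *: e i) = 0.
  have := bilin_o_combo 0 h; rewrite /combo !mulr0 scale0r add0r => E.
  by rewrite mulrAC E mul0r.
rewrite {1}/combo bilinDl bilinZl.
have -> : K * a * B o (combo b g) = K * a * b.
  by rewrite mulrAC bilin_o_combo; ring.
congr (_ + _); rewrite /combo bilinDr bilinZr bilinC oe add0r bilin_suml.
apply: eq_bigr => i _; rewrite bilinZl bilin_sumr; congr (_ * _).
rewrite -[RHS]sum_delta; apply: eq_bigr => j _.
by rewrite bilinZr ee eq_sym.
Qed.

Lemma stereoB y : conf_domain y ->
  stereo y - o = combo (- chord_coord y) (fun i => conf y * y ord0 i).
Proof.
move=> yU; rewrite /stereo /combo addrAC; congr (_ + _).
rewrite -[X in _ - X]scale1r -scalerBl; congr (_ *: _).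
by have := chord_coordE yU; lra.
Qed.

Lemma sqnorm_ge0 y : 0 <= sqnorm y.
Proof. by apply: sumr_ge0 => i _; exact: sqr_ge0. Qed.

Lemma chord_coord_ge0 y : conf_domain y -> 0 <= chord_coord y.
Proof.
move=> yU; rewrite /chord_coord divr_ge0 // mulr_ge0 ?sqnorm_ge0 //.
exact: ltW (conf_gt0 yU).
Qed.

Lemma chord_stereo y : conf_domain y -> chord K o (stereo y) = chord_coord y.
Proof.
move=> yU; rewrite /chord stereoB // bilin_combo.
have -> : \sum_i conf y * y ord0 i * (conf y * y ord0 i) = conf y ^+ 2 * sqnorm y.
  by rewrite mulr_sumr; apply: eq_bigr => i _; ring.
have E := conf_eq yU; rewrite /chord_coord; set m := conf y in E *; set q := sqnorm y in E *.
have -> : K * - (m * q / 2) * - (m * q / 2) + m ^+ 2 * q = m * q * (m * (1 + K / 4 * q)).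
  by field.
by rewrite E mulr1.
Qed.

Lemma stereo_space_form y : conf_domain y -> SF (stereo y).
Proof.
move=> yU; have E : stereo y = o + (stereo y - o) by rewrite addrC subrK.
have Eo : K * B o (stereo y - o) = - (K * chord_coord y).
  by rewrite stereoB // bilin_o_combo mulrN.
have Ed : B (stereo y - o) (stereo y - o) = 2 * chord_coord y.
  by rewrite -chord_stereo // /chord; field.
apply: (space_form_intro oS) => [K0|HK|K0].
- rewrite E; move: Eo Ed; move: (stereo y - o) => d Eo Ed.
  rewrite !bilinE (bilinC _ d o) Ed.
  by have := space_form_norm oS K0; lra.
- rewrite E; move: Eo; move: (stereo y - o) => d Eo.
  rewrite bilinDl (bilinC _ d o) mulrDr Eo space_form_norm ?lt_eqF //.
  have : K * chord_coord y <= 0 by rewrite nmulr_rle0 // chord_coord_ge0.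
  by lra.
- rewrite !mxE (space_form_flat oS K0) mulr0 add0r summxE big1 // => i _.
  by rewrite mxE (te i).2 // mulr0.
Qed.

(** Only the antipode of [o], where [K * chord K o x = 2], is missed. *)
Lemma stereo_surj x : SF x -> K * chord K o x < 2 ->
  exists2 y, conf_domain y & stereo y = x.
Proof.
move=> xS; set z := chord K o x => Kz.
pose w := (x - o) + (K * z) *: o.
have wE : w = - ((o - x) - (K * chord K x o) *: o).
  by rewrite /w opprB opprB chordC -/z addrC.
have tw : tangent K o w.
  by rewrite wE -scaleN1r; apply: tangentZ; exact: tangent_proj.
have ww : B w w = 2 * z - K * z ^+ 2.
  by rewrite wE bilinNl bilinNr opprK bilin_proj // chordC.
pose m := 1 - K * z / 2; have m0 : 0 < m by rewrite /m; lra.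
pose y : 'rV[R]_N := \row_i (B (e i) w / m).
have qy : sqnorm y = 2 * z / m.
  have -> : sqnorm y = B w w / m ^+ 2.
    rewrite {2}(e_full tw) bilin_sumr mulr_suml; apply: eq_bigr => i _.
    by rewrite mxE bilinZr (bilinC _ w); field; rewrite gt_eqF.
  rewrite ww; have -> : 2 * z - K * z ^+ 2 = 2 * z * m by rewrite /m; field.
  by field; rewrite gt_eqF.
have dy : 1 + K / 4 * sqnorm y = m^-1.
  rewrite qy; have -> : K / 4 * (2 * z / m) = (1 - m) / m.
    by rewrite {2}/m; field; rewrite gt_eqF.
  by field; rewrite gt_eqF.
have yU : conf_domain y by rewrite /conf_domain dy invr_gt0.
exists y => //.
have cm : conf y = m by rewrite /conf dy invrK.
rewrite /stereo cm.
have -> : \sum_i (m * y ord0 i) *: e i = w.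
  rewrite [RHS](e_full tw); apply: eq_bigr => i _; congr (_ *: _).
  by rewrite mxE; field; rewrite gt_eqF.
have -> : 2 * m - 1 = 1 - K * z by rewrite /m; field.
by rewrite /w scalerBl scale1r addrC -addrA subrKC subrK.
Qed.

Let dconf i y := - (K / 2) * conf y ^+ 2 * y ord0 i.

Let ddconf i j y :=
  - (K / 2) * (conf y ^+ 2 * (i == j)%:R + 2 * conf y * y ord0 i * dconf j y).

Definition dstereo i y : 'rV[R]_N.+1 :=
  (2 * dconf i y) *: o + \sum_k (dconf i y * y ord0 k + conf y * (k == i)%:R) *: e k.

Let ddstereo i j y : 'rV[R]_N.+1 :=
  (2 * ddconf i j y) *: o + \sum_k (ddconf i j y * y ord0 k + dconf i y * (k == j)%:R
     + dconf j y * (k == i)%:R) *: e k.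

Let is_derive_dconf y i j : conf_domain y ->
  is_derive y (e_ j) (dconf i) (ddconf i j y).
Proof.
move=> yU; have D := is_derive_scale (- (K / 2))
  (is_derive_mul (is_derive_pow 1 (is_derive_conf j yU)) (is_derive_coord y j i)).
have E : (fun t => - (K / 2) * (conf t ^+ 2 * t ord0 i)) = dconf i.
  by apply/funext => t; rewrite /dconf; ring.
rewrite E in D; apply: is_derive_eq D _.
by rewrite /ddconf /dconf; ring.
Qed.

Lemma is_derive_stereo y i : conf_domain y -> is_derive y (e_ i) stereo (dstereo i y).
Proof.
move=> yU; apply: is_derive_vadd.
  apply: is_derive_scalel.
  have D := is_derive_sub (is_derive_scale 2 (is_derive_conf i yU)) (is_derive_const (1 : R) y (e_ i)).
  by apply: is_derive_eq D _; rewrite /dconf; ring.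
apply: is_derive_big => k; apply: is_derive_scalel.
apply: is_derive_eq (is_derive_mul (is_derive_conf i yU) (is_derive_coord y i k)) _.
by rewrite /dconf; ring.
Qed.

Let is_derive_dstereo y i j : conf_domain y ->
  is_derive y (e_ j) (dstereo i) (ddstereo i j y).
Proof.
move=> yU; have D0 := is_derive_dconf i j yU; apply: is_derive_vadd.
  by apply: is_derive_scalel; exact: is_derive_scale.
apply: is_derive_big => k; apply: is_derive_scalel.
have D := is_derive_add (is_derive_mul D0 (is_derive_coord y j k))
   (is_derive_mul (is_derive_conf j yU) (is_derive_const ((k == i)%:R : R) y (e_ j))).
by apply: is_derive_eq D _; rewrite /dconf; ring.
Qed.

Let continuous_dconf y i : conf_domain y -> {for y, continuous (dconf i)}.
Proof.
move=> yU; have C := continuous_conf yU.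
have C2 : (fun z => conf z ^+ 2) @ nbhs y --> conf y ^+ 2.
  by under eq_fun do rewrite expr2; rewrite expr2; apply: cvgM; exact: C.
have H : (fun z : 'rV[R]_N => - (K / 2) * conf z ^+ 2 * z ord0 i) @ nbhs y -->
    - (K / 2) * conf y ^+ 2 * y ord0 i.
  apply: cvgM; last exact: coord_continuous.
  by apply: cvgM; [exact: cvg_cst | exact: C2].
exact: H.
Qed.

Let continuous_ddconf y i j : conf_domain y -> {for y, continuous (ddconf i j)}.
Proof.
move=> yU; have C := continuous_conf yU; have C1 := continuous_dconf (i := j) yU.
have C2 : (fun z => conf z ^+ 2) @ nbhs y --> conf y ^+ 2.
  by under eq_fun do rewrite expr2; rewrite expr2; apply: cvgM; exact: C.
have H : (fun z : 'rV[R]_N => - (K / 2) * (conf z ^+ 2 * (i == j)%:R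
    + 2 * conf z * z ord0 i * dconf j z)) @ nbhs y --> ddconf i j y.
  apply: cvgM; first exact: cvg_cst.
  apply: cvgD; first by apply: cvgM; [exact: C2 | exact: cvg_cst].
  apply: cvgM; last exact: C1.
  apply: cvgM; last exact: coord_continuous.
  by apply: cvgM; [exact: cvg_cst | exact: C].
exact: H.
Qed.

Let cvg_combination (f0 : 'rV[R]_N -> R) (f : 'I_N -> 'rV[R]_N -> R) y :
  {for y, continuous f0} -> (forall k, {for y, continuous (f k)}) ->
  {for y, continuous (fun y => f0 y *: o + \sum_k f k y *: e k)}.
Proof.
move=> C0 C.
have H : (fun z => f0 z *: o + \sum_k f k z *: e k) @ nbhs y --> f0 y *: o + \sum_k f k y *: e k.
  apply: cvgD; first by apply: cvgZl; exact: C0.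
  apply: (@cvg_sumr R _ (nbhs y) _ _ _ _ (fun k z => f k z *: e k) (fun k => f k y *: e k)) => k.
  by apply: cvgZl; exact: (C k).
exact: H.
Qed.

Let scalar_continuous (f g : 'rV[R]_N -> R) y : {for y, continuous f} ->
  {for y, continuous g} -> {for y, continuous (fun y => f y * g y)}.
Proof. by move=> cf cg; apply: continuousM. Qed.

Let coord_continuous_at y k : {for y, continuous (fun y : 'rV[R]_N => y ord0 k)}.
Proof. exact: coord_continuous. Qed.

Let continuous_dstereo y i : conf_domain y -> {for y, continuous (dstereo i)}.
Proof.
move=> yU; have C := continuous_dconf (i := i) yU.
apply: cvg_combination => [|k].
  have H : (fun z => 2 * dconf i z) @ nbhs y --> 2 * dconf i y.
    by apply: cvgM; [exact: cvg_cst | exact: C].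
  exact: H.
have H : (fun z : 'rV[R]_N => dconf i z * z ord0 k + conf z * (k == i)%:R) @ nbhs y -->
  dconf i y * y ord0 k + conf y * (k == i)%:R.
  apply: cvgD; first exact: (scalar_continuous C (@coord_continuous_at y k)).
  by apply: cvgM; [exact: (continuous_conf yU) | exact: cvg_cst].
exact: H.
Qed.

Lemma continuous_stereo y : conf_domain y -> {for y, continuous stereo}.
Proof.
move=> yU; have C := continuous_conf yU; apply: cvg_combination => [|k].
  have H : (fun z => 2 * conf z - 1) @ nbhs y --> 2 * conf y - 1.
    apply: cvgB; last exact: cvg_cst.
    by apply: cvgM; [exact: cvg_cst | exact: C].
  exact: H.
exact: (scalar_continuous C (@coord_continuous_at y k)).
Qed.

Let continuous_ddstereo y i j : conf_domain y -> {for y, continuous (ddstereo i j)}.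
Proof.
move=> yU; have C := continuous_ddconf (i := i) (j := j) yU.
apply: cvg_combination => [|k].
  have H : (fun z => 2 * ddconf i j z) @ nbhs y --> 2 * ddconf i j y.
    by apply: cvgM; [exact: cvg_cst | exact: C].
  exact: H.
have H : (fun z : 'rV[R]_N => ddconf i j z * z ord0 k + dconf i z * (k == j)%:R
     + dconf j z * (k == i)%:R) @ nbhs y -->
  ddconf i j y * y ord0 k + dconf i y * (k == j)%:R + dconf j y * (k == i)%:R.
  apply: cvgD; last by apply: cvgM; [exact: (continuous_dconf (i := j) yU) | exact: cvg_cst].
  apply: cvgD; first exact: (scalar_continuous C (@coord_continuous_at y k)).
  by apply: cvgM; [exact: (continuous_dconf (i := i) yU) | exact: cvg_cst].
exact: H.
Qed.

Lemma metric_stereo y : conf_domain y ->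
  metric_coef K stereo y = (conf y ^+ 2)%:M.
Proof.
move=> yU; apply/matrixP => i j; rewrite !mxE.
have [_ ->] := is_derive_stereo i yU; have [_ ->] := is_derive_stereo j yU.
have E k : dstereo k y = combo (- (conf y ^+ 2 * y ord0 k))
   (fun l => dconf k y * y ord0 l + conf y * (l == k)%:R).
  by rewrite /dstereo /combo /dconf; congr (_ *: _ + _); field.
rewrite !E bilin_combo.
have -> : \sum_l (dconf i y * y ord0 l + conf y * (l == i)%:R) *
    (dconf j y * y ord0 l + conf y * (l == j)%:R) =
  dconf i y * dconf j y * sqnorm y + conf y * dconf j y * y ord0 i +
  (conf y * dconf i y * y ord0 j + conf y ^+ 2 * (i == j)%:R).
  rewrite -(sum_delta (fun l => conf y * dconf j y * y ord0 l) i).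
  rewrite -(sum_delta (fun l => conf y * dconf i y * y ord0 l + conf y ^+ 2 * (i == l)%:R) j).
  rewrite /sqnorm mulr_sumr -!big_split /=; apply: eq_bigr => l _.
  by rewrite [i == l]eq_sym; ring.
have Ec := conf_eq yU; rewrite /dconf; set m := conf y in Ec *; set q := sqnorm y in Ec *.
rewrite [LHS](_ : _ = m ^+ 2 * (i == j)%:R +
   K * m ^+ 3 * y ord0 i * y ord0 j * (m * (1 + K / 4 * q) - 1)); last by field.
by rewrite Ec subrr mulr0 addr0 mulr_natr.
Qed.

Lemma stereo_local_param (Omega : set 'rV[R]_N.+1) (U : set 'rV[R]_N) :
  open U -> (forall y, U y -> conf_domain y) -> (forall y, U y -> Omega (stereo y)) ->
  local_param K Omega U stereo.
Proof.
move=> oU Uc UO; split; [exact: oU | | exact: UO | ].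
  apply: (C2_on_intro (df := dstereo) (ddf := ddstereo) oU).
  - by move=> y i /Uc; exact: is_derive_stereo.
  - by move=> y i j /Uc; exact: is_derive_dstereo.
  - by move=> y i /Uc; exact: continuous_dstereo.
  - by move=> y i j /Uc; exact: continuous_ddstereo.
move=> y /Uc yU; rewrite metric_stereo // unitmxE det_scalar unitfE.
by rewrite !expf_neq0 // gt_eqF // conf_gt0.
Qed.

(** In the stereographic chart the eigenvalue equation loses its divergence
    form, the metric being conformal. *)
Lemma laplacian_stereo (U : set 'rV[R]_N) (u f : 'rV[R]_N -> R) y : (2 <= N)%N ->
  open U -> (forall y, U y -> conf_domain y) -> C2_on U u -> U y ->
  laplace_beltrami (metric_coef K stereo) u y = f y ->
  \sum_i ('D_(e_ i) ('D_(e_ i) u) y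
     - (N - 2)%:R * (K / 2) * conf y * y ord0 i * 'D_(e_ i) u y) = conf y ^+ 2 * f y.
Proof.
move=> N2 oU Uc [C1 C2] Uy <-; have yU := Uc _ Uy.
have m0 := conf_gt0 yU.
rewrite /laplace_beltrami metric_stereo // det_scalar -exprM mulnC exprM sqrtr_sqr.
rewrite ger0_norm ?exprn_ge0 ?(ltW m0) //.
have ED i : 'D_(e_ i) (fun z => Num.sqrt (\det (metric_coef K stereo z)) *
    \sum_(j < N) invmx (metric_coef K stereo z) i j * 'D_(e_ j) u z) y =
  conf y ^+ (N - 2) * ('D_(e_ i) ('D_(e_ i) u) y
     - (N - 2)%:R * (K / 2) * conf y * y ord0 i * 'D_(e_ i) u y).
  (* [sqrt (det g) g^-1] is the scalar [conf ^ (N - 2)], whose logarithmic derivative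
     gives the first order term *)
  have near_flux : \near y, conf y ^+ (N - 2) * 'D_(e_ i) u y =
     Num.sqrt (\det (metric_coef K stereo y)) *
    \sum_(j < N) invmx (metric_coef K stereo y) i j * 'D_(e_ j) u y.
    have : \near y, U y by apply: open_nbhs_nbhs; split.
    apply: filterS => z /Uc zU; have z0 := conf_gt0 zU.
    rewrite metric_stereo // det_scalar -exprM mulnC exprM sqrtr_sqr.
    rewrite ger0_norm ?exprn_ge0 ?(ltW z0) //.
    rewrite invmx_scalar (bigD1 i) //= big1 ?addr0.
      rewrite mxE eqxx mulr1n.
      have -> : conf z ^+ N = conf z ^+ (N - 2) * conf z ^+ 2 by rewrite -exprD subnK.
      by rewrite mulrA mulfK // expf_neq0 // gt_eqF.
    by move=> j ji; rewrite mxE eq_sym (negbTE ji) mulr0n mul0r.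
  have [dDu _] := C2 i y Uy i.
  have D := is_derive_mul (is_derive_conf_pow i (N - 2) yU) (derivableP dDu).
  have [_ ->] := near_eq_is_derive near_flux D.
  by ring.
under [X in _ = _ * (_ * X)]eq_bigr do rewrite ED.
rewrite -mulr_sumr [RHS]mulrA [RHS]mulrA.
have -> : conf y ^+ 2 * (conf y ^+ N)^-1 * conf y ^+ (N - 2) = 1.
  by rewrite mulrAC -exprD subnKC // divff // expf_neq0 // gt_eqF.
by rewrite mul1r.
Qed.

End stereographic.

(** * Comparison with radial functions *)

Section touching.
Context {R : realType} {N : nat} (K lam : R).
Implicit Types (y : 'rV[R]_N).

Local Notation e_ i := (std_basis R i).
Local Notation conf := (conf K).
Local Notation conf_domain := (conf_domain K).
Local Notation chord_coord := (chord_coord K).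

(** The operator [Delta + lam] on functions of [z = chord K o x]: for
    [z = vers K r], [2 z - K z ^ 2] is [sigma K r ^ 2] and [1 - K z] is
    [cos_K K r]. *)
Definition radial_op (e0 e1 e2 z : R) : R :=
  (2 * z - K * z ^+ 2) * e2 + N%:R * (1 - K * z) * e1 + lam * e0.

(** The eigenvalue equation in the stereographic chart, see [laplacian_stereo]. *)
Definition eigen_eq (U : set 'rV[R]_N) (u : 'rV[R]_N -> R) :=
  forall y, U y -> \sum_i ('D_(e_ i) ('D_(e_ i) u) y
     - (N - 2)%:R * (K / 2) * conf y * y ord0 i * 'D_(e_ i) u y)
   = conf y ^+ 2 * - (lam * u y).

Lemma near_line (P : set 'rV[R]_N) y v : (\near y, P y) ->
  exists2 d : R, 0 < d & forall t, `|t| < d -> P (y + t *: v).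
Proof.
move=> Py; have C : (fun t : R => y + t *: v) @ nbhs (0 : R) --> y + 0 *: v.
  by apply: cvgD; [exact: cvg_cst | apply: cvgZl; exact: cvg_id].
rewrite scale0r addr0 in C.
have [d /= d0 H] := C _ Py; exists d => // t td.
by apply: H; rewrite /ball_/= sub0r normrN.
Qed.

(** If a radial function touches a solution from above, their first derivatives agree
    and its second derivatives dominate in each coordinate direction; summing
    gives the inequality for the operators, and the solution has operator [0]. *)
Lemma radial_touch_above (U : set 'rV[R]_N) (u : 'rV[R]_N -> R) y
    (e e1 : R -> R) (e2 eta : R) : (2 <= N)%N ->
  open U -> (forall y, U y -> conf_domain y) -> C2_on U u -> eigen_eq U u -> U y ->
  0 < eta ->
  (forall z, `|z - chord_coord y| < eta -> is_derive z 1 e (e1 z)) ->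
  is_derive (chord_coord y) 1 e1 e2 ->
  (\near y, u y <= e (chord_coord y)) -> u y = e (chord_coord y) ->
  0 <= radial_op (e (chord_coord y)) (e1 (chord_coord y)) e2 (chord_coord y).
Proof.
move=> N2 oU Uc [C1 C2] eqU Uy eta0 de de1 ule uy.
have yU := Uc _ Uy.
pose P := [set x | [/\ U x, u x <= e (chord_coord x) &
   `|chord_coord x - chord_coord y| < eta]].
have nP : \near y, P y.
  have H1 : \near y, U y by apply: open_nbhs_nbhs; split.
  have H2 : \forall x \near y, `|chord_coord x - chord_coord y| < eta.
    have := continuous_chord_coord yU => /cvgrPdist_lt /(_ _ eta0).
    by apply: filterS => x; rewrite distrC.
  by apply: filterS3 H1 ule H2 => x; split.
have key i : 'D_(e_ i) u y = e1 (chord_coord y) * (conf y ^+ 2 * y ord0 i) /\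
    'D_(e_ i) ('D_(e_ i) u) y <= e2 * (conf y ^+ 2 * y ord0 i) ^+ 2 +
       e1 (chord_coord y) * (conf y ^+ 2 - K * conf y ^+ 3 * y ord0 i ^+ 2).
  have [d d0 Pd] := near_line (e_ i) nP.
  pose k x := 'D_(e_ i) u x - e1 (chord_coord x) * (conf x ^+ 2 * x ord0 i).
  pose f t := u (y + t *: e_ i) - e (chord_coord (y + t *: e_ i)).
  have y0 : y + (0 : R) *: e_ i = y by rewrite scale0r addr0.
  have df (t : R) : `|t - 0| < d -> is_derive t 1 f (k (y + t *: e_ i)).
    rewrite subr0 => /Pd[Ut _ Et]; have tU := Uc _ Ut.
    apply: (@is_derive_line R N _ (fun x => u x - e (chord_coord x))).
    apply: is_derive_sub; first exact: derivableP (C1 _ Ut i).1.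
    exact: is_derive_comp (de _ Et) (is_derive_chord_coord i tU).
  have dk : is_derive (0 : R) 1 (fun t : R => k (y + t *: e_ i))
     ('D_(e_ i) ('D_(e_ i) u) y - (e1 (chord_coord y) * (conf y ^+ 2 - K * conf y ^+ 3 * y ord0 i ^+ 2)
       + (conf y ^+ 2 * y ord0 i) * (e2 * (conf y ^+ 2 * y ord0 i)))).
    apply: (@is_derive_line R N _ k); rewrite y0; apply: is_derive_sub.
      exact: derivableP (C2 i _ Uy i).1.
    apply: is_derive_mul; last exact: is_derive_chord_coord2.
    exact: is_derive_comp de1 (is_derive_chord_coord i yU).
  have [|k0 k1] := second_derivative_at_max d0 df dk.
    move=> t; rewrite subr0 => /Pd[_ H _]; rewrite /f y0 uy subrr.
    by rewrite subr_le0.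
  split; first by apply/eqP; rewrite -subr_eq0 -[X in X == _]/(k y) -y0 k0.
  by move: k1; rewrite subr_le0; lra.
have E := eqU y Uy; have Ec := conf_eq yU; have m0 := conf_gt0 yU.
have : \sum_i ('D_(e_ i) ('D_(e_ i) u) y
     - (N - 2)%:R * (K / 2) * conf y * y ord0 i * 'D_(e_ i) u y) <=
  \sum_(i < N) (e1 (chord_coord y) * conf y ^+ 2 + (e2 * conf y ^+ 4 -
     e1 (chord_coord y) * (K * conf y ^+ 3 + (N - 2)%:R * (K / 2) * conf y ^+ 3)) * y ord0 i ^+ 2).
  apply: ler_sum => i _; have [-> H] := key i.
  apply: le_trans (lerB H (lexx _)) _.
  by rewrite le_eqVlt; apply/orP; left; apply/eqP; ring.
rewrite E uy big_split /= sumr_const card_ord -mulr_sumr -/(sqnorm y).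
rewrite natrB //.
have zE : chord_coord y = conf y * sqnorm y / 2 by [].
move: zE E Ec m0; set z := chord_coord y; set m := conf y; set q := sqnorm y.
move=> zE E Ec m0 H.
have SE : 2 * z - K * z ^+ 2 = m ^+ 2 * q.
  have -> : m ^+ 2 * q = m * q * (1 - (m * (1 + K / 4 * q) - m)) by rewrite Ec; ring.
  by rewrite zE; field.
have -> : radial_op (e z) (e1 z) e2 z = (m ^+ 2)^-1 * (N%:R * (e1 z * m ^+ 2) +
   (e2 * m ^+ 4 - e1 z * (K * m ^+ 3 + (N%:R - 2) * (K / 2) * m ^+ 3)) * q
   - m ^+ 2 * - (lam * e z)).
  by rewrite /radial_op SE zE; field; rewrite gt_eqF.
have m2 : 0 <= (m ^+ 2)^-1 by rewrite invr_ge0 sqr_ge0.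
apply: mulr_ge0 => //; rewrite subr_ge0.
by move: H; rewrite -(mulr_natl (e1 z * m ^+ 2)).
Qed.

Lemma eigen_eqN (U : set 'rV[R]_N) u : open U -> C2_on U u -> eigen_eq U u ->
  C2_on U (fun y => - u y) /\ eigen_eq U (fun y => - u y).
Proof.
move=> oU [C1 C2] eqU.
have nU y : U y -> \near y, U y by move=> Uy; apply: open_nbhs_nbhs; split.
have d1 y i : U y -> is_derive y (e_ i) (fun y => - u y) (- 'D_(e_ i) u y).
  by move=> Uy; apply: is_derive_opp; apply: derivableP; exact: (C1 _ Uy i).1.
have d2 y i j : U y -> is_derive y (e_ j) (fun y => - 'D_(e_ i) u y) (- 'D_(e_ j) ('D_(e_ i) u) y).
  by move=> Uy; apply: is_derive_opp; apply: derivableP; exact: (C2 i _ Uy j).1.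
split.
  apply: (C2_on_intro (df := fun i y => - 'D_(e_ i) u y)
    (ddf := fun i j y => - 'D_(e_ j) ('D_(e_ i) u) y) oU d1 d2).
  - by move=> y i /C1 - /(_ i) [_ c]; apply: continuousN.
  - by move=> y i j Uy; have [_ c] := C2 i y Uy j; apply: continuousN.
move=> y Uy; have := eqU y Uy.
have E i : 'D_(e_ i) (fun y => - u y) y = - 'D_(e_ i) u y by have [_ ->] := d1 y i Uy.
have EE i : 'D_(e_ i) ('D_(e_ i) (fun y => - u y)) y = - 'D_(e_ i) ('D_(e_ i) u) y.
  have near_d : \near y, (- 'D_(e_ i) u y) = 'D_(e_ i) (fun y => - u y) y.
    by apply: filterS (nU _ Uy) => z /d1 - /(_ i) [_ ->].
  by have [_ ->] := near_eq_is_derive near_d (d2 y i i Uy).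
under [X in _ -> X = _]eq_bigr do rewrite E EE.
move=> H; rewrite -[LHS]opprK -sumrN.
rewrite [X in - X = _](_ : _ = conf y ^+ 2 * - (lam * u y)); first by ring.
by rewrite -H; apply: eq_bigr => i _; ring.
Qed.

End touching.
Arguments radial_op {R} N K lam e0 e1 e2 z.

(** * The radial profile *)

Section radial_profile.
Context {R : realType} (N : nat) (K lam Z : R) (F F1 F2 : R -> R).
Hypothesis N0 : (0 < N)%N.
Hypothesis Z0 : 0 < Z.
Hypothesis KZ : K * Z <= 1.
Hypothesis lam0 : 0 < lam.
Hypothesis F0 : F 0 = 1.
Hypothesis F_ode : forall z, K * z < 1 -> [/\ is_derive z 1 F (F1 z),
  is_derive z 1 F1 (F2 z) & radial_op N K lam (F z) (F1 z) (F2 z) z = 0].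

Lemma curvature_lt1 z : 0 <= z < Z -> K * z < 1.
Proof.
move=> /andP[z0 zZ]; have [K0|K0] := leP K 0.
  by apply: (@le_lt_trans _ _ 0) => //; rewrite mulr_le0_ge0.
by apply: lt_le_trans KZ; rewrite ltr_pM2l.
Qed.

Lemma sigma_sqr_gt0 z : 0 < z -> K * z < 1 -> 0 < 2 * z - K * z ^+ 2.
Proof.
move=> z0 Kz; have -> : 2 * z - K * z ^+ 2 = z * (2 - K * z) by ring.
by rewrite mulr_gt0 //; lra.
Qed.

Lemma F1_at0 : F1 0 = - lam / N%:R.
Proof.
have K0 : K * 0 < 1 by rewrite mulr0.
have [_ _] := F_ode K0; rewrite /radial_op F0 => E.
have Nn0 : N%:R != 0 :> R by rewrite pnatr_eq0 -lt0n.
apply: (mulfI Nn0); rewrite mulrCA divff // mulr1.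
by move: E; rewrite expr0n /=; lra.
Qed.

Lemma F2_ode z : K * z < 1 ->
  (2 * z - K * z ^+ 2) * F2 z = - N%:R * (1 - K * z) * F1 z - lam * F z.
Proof. by move=> /F_ode[_ _]; rewrite /radial_op; lra. Qed.

Hypothesis F_gt0 : forall z, 0 <= z < Z -> 0 < F z.

(** At a zero of [F1] the equation gives [F2 < 0], so [- F1], positive at [0], can
    cross zero only upwards. *)
Lemma F1_lt0 z : 0 <= z < Z -> F1 z < 0.
Proof.
move=> zZ; rewrite -oppr_gt0.
apply: (gt0_of_upward_crossing (h := fun z => - F1 z) (h' := fun z => - F2 z)
  (a := 0) (b := Z)) zZ.
- by rewrite F1_at0 mulNr opprK divr_gt0 // ltr0n.
- by move=> t /curvature_lt1 /F_ode[_ d _]; exact: is_derive_opp.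
move=> t /andP[t0 tZ] /eqP; rewrite oppr_eq0 => /eqP E.
have tZ' : 0 <= t < Z by rewrite ltW.
have Kt := curvature_lt1 tZ'.
have S0 := sigma_sqr_gt0 t0 Kt.
have := F2_ode Kt; rewrite E mulr0 sub0r => H.
rewrite -(pmulr_rgt0 _ S0) mulrN H opprK mulr_gt0 //; exact: F_gt0.
Qed.

Lemma F_decr s t : 0 <= s -> s < t -> t < Z -> F t < F s.
Proof.
move=> s0 st tZ.
have sub x : s <= x <= t -> 0 <= x < Z.
  by move=> /andP[sx xt]; rewrite (le_trans s0) //= (le_lt_trans xt).
have [||c] := @MVT R F F1 s t st.
- move=> x /[!in_itv]/= /andP[? ?].
  by have [] := F_ode (curvature_lt1 (sub x _)); rewrite // !ltW.
- apply: derivable_within_continuous => x /[!in_itv]/= /sub /curvature_lt1 /F_ode[d _ _].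
  exact: ex_derive.
rewrite in_itv/= => /andP[sc ct] E.
rewrite -subr_lt0 E nmulr_rlt0 ?subr_gt0 //; apply: F1_lt0; apply: sub.
by rewrite !ltW.
Qed.

Lemma F_le1 z : 0 <= z < Z -> F z <= 1.
Proof.
move=> /andP[]; rewrite le_eqVlt => /orP[/eqP <- _|z0 zZ]; first by rewrite F0.
by rewrite -F0 ltW // F_decr.
Qed.

(** [- F1] cannot cross the affine function [2 lam (1 + k z)]: at a contact point
    the equation makes it grow more slowly.  The bound is what keeps the barrier
    of [barrier_exists] above a multiple of [1 / F]. *)
Lemma F1_bounded : exists2 C, 0 < C & forall z, 0 <= z < Z -> - F1 z <= C.
Proof.
pose k := Num.max K 0.
have k0 : 0 <= k by rewrite le_max lexx orbT.
have Kk : K <= k by rewrite le_max lexx.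
exists (2 * lam * (1 + k * Z)); first by rewrite !mulr_gt0 // ltr_pwDl // mulr_ge0 // ltW.
suff H z : 0 <= z < Z -> 0 < 2 * lam * (1 + k * z) + F1 z.
  move=> z /[dup] /H Hz /andP[z0 zZ].
  have : 2 * lam * (1 + k * z) <= 2 * lam * (1 + k * Z).
    by rewrite ler_pM2l ?mulr_gt0 // lerD2l ler_wpM2l // ltW.
  by lra.
apply: (gt0_of_upward_crossing (a := 0) (b := Z)
  (h := fun z => 2 * lam * (1 + k * z) + F1 z) (h' := fun z => 2 * lam * k + F2 z)).
- rewrite mulr0 addr0 mulr1 F1_at0.
  have : lam / N%:R <= lam.
    by rewrite ler_pdivrMr ?ltr0n // ler_peMr ?ler1n // ltW.
  by rewrite mulNr; move: (lam / N%:R) lam0 => q; lra.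
- move=> t /curvature_lt1 /F_ode[_ d _]; apply: is_derive_add d.
  have D := is_derive_scale (2 * lam) (is_derive_add (is_derive_const (1 : R) t 1)
    (is_derive_scale k (is_derive_var t))).
  by apply: is_derive_eq D _; ring.
move=> t /andP[t0 tZ] E.
have tZ' : 0 <= t < Z by rewrite ltW.
have Kt := curvature_lt1 tZ'.
have S0 := sigma_sqr_gt0 t0 Kt.
rewrite -(pmulr_rgt0 _ S0) mulrDr F2_ode //.
have -> : F1 t = - (2 * lam * (1 + k * t)) by lra.
have Ft := F_le1 tZ'.
have N1 : 1 <= N%:R :> R by rewrite ler1n.
have lF : lam * F t <= lam by rewrite ler_piMr // ltW.
suff : 1 <= (2 * t - K * t ^+ 2) * k + N%:R * ((1 - K * t) * (1 + k * t)).
  move=> H; have : lam * 2 * 1 <= lam * 2 * ((2 * t - K * t ^+ 2) * k + N%:R * ((1 - K * t) * (1 + k * t))).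
    by rewrite ler_pM2l // mulr_gt0.
  rewrite mulr1 => {}H; apply: (@lt_le_trans _ _ (lam * 2 - lam * F t)); first by have := lam0; lra.
  apply: (le_trans (lerB H (lexx (lam * F t)))).
  by rewrite le_eqVlt; apply/orP; left; apply/eqP; ring.
have A0 : 0 <= (1 - K * t) * (1 + k * t).
  by rewrite mulr_ge0 //; [lra | rewrite addr_ge0 // mulr_ge0 // ltW].
have : 1 * ((1 - K * t) * (1 + k * t)) <= N%:R * ((1 - K * t) * (1 + k * t)).
  by rewrite ler_wpM2r.
suff : 1 <= (2 * t - K * t ^+ 2) * k + (1 - K * t) * (1 + k * t) by lra.
have [K0|K0] := leP K 0.
  have -> : k = 0 by rewrite /k; apply/max_idPr.
  have : K * t <= 0 by rewrite mulr_le0_ge0 // ltW.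
  by lra.
have -> : k = K by rewrite /k; apply/max_idPl; rewrite ltW.
have -> : (2 * t - K * t ^+ 2) * K + (1 - K * t) * (1 + K * t) =
  1 + 2 * (K * t) * (1 - K * t) by ring.
by rewrite lerDl !mulr_ge0 // ?subr_ge0 ltW.
Qed.

(** The quantity [Q] below is, up to a positive factor, minus the second derivative
    of [F ^ al] along a radial geodesic.  It equals [lam / N] at the centre.  With
    [S = 2 z - K z ^ 2], its derivative at a zero satisfies
      [S F Q' = - F' (F ^ 2 (N - 1 - al lam S) + al (1 - al) S ^ 2 F' ^ 2)],
    which is positive, so [Q] can cross zero only upwards. *)
Lemma radial_concavity al z : 0 < al -> al < 1 ->
  al * lam * (2 * Z - K * Z ^+ 2) <= N%:R - 1 -> 0 <= z < Z ->
  0 < (N%:R - 1) * (1 - K * z) * F1 z * F z + lam * F z ^+ 2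
      + (1 - al) * (2 * z - K * z ^+ 2) * F1 z ^+ 2.
Proof.
move=> al0 al1 alA.
have N1 : 1 <= N%:R :> R by rewrite ler1n.
apply: (gt0_of_upward_crossing (a := 0) (b := Z) (h := fun z =>
   (N%:R - 1) * (1 - K * z) * F1 z * F z + lam * F z ^+ 2
   + (1 - al) * (2 * z - K * z ^+ 2) * F1 z ^+ 2) (h' := fun z =>
   (N%:R - 1) * (- K * F1 z * F z + (1 - K * z) * (F2 z * F z + F1 z ^+ 2))
   + 2 * lam * F z * F1 z
   + (1 - al) * ((2 - 2 * K * z) * F1 z ^+ 2 + 2 * (2 * z - K * z ^+ 2) * F1 z * F2 z))).
- rewrite F0 F1_at0 expr0n /= !mulr0 !subr0 mulr0 mul0r addr0 !mulr1 expr1n mulr1.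
  have Nn : 0 < N%:R :> R by rewrite ltr0n.
  have -> : (N%:R - 1) * (- lam / N%:R) + lam = lam / N%:R by field; rewrite gt_eqF.
  exact: divr_gt0.
- move=> t /curvature_lt1 /F_ode[d d1 _].
  have Dl := is_derive_sub (is_derive_const (1 : R) t 1) (is_derive_scale K (is_derive_var t)).
  have DS := is_derive_sub (is_derive_scale 2 (is_derive_var t))
     (is_derive_scale K (is_derive_pow 1 (is_derive_var t))).
  have D1 := is_derive_mul (is_derive_mul (is_derive_scale (N%:R - 1) Dl) d1) d.
  have D2 := is_derive_scale lam (is_derive_pow 1 d).
  have D3 := is_derive_mul (is_derive_scale (1 - al) DS) (is_derive_pow 1 d1).
  by apply: is_derive_eq (is_derive_add (is_derive_add D1 D2) D3) _; ring.
move=> t /andP[t0 tZ] E.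
have tZ' : 0 <= t < Z by rewrite ltW.
have Kt := curvature_lt1 tZ'.
have S0 := sigma_sqr_gt0 t0 Kt.
have f0 := F_gt0 tZ'; have f1 := F1_lt0 tZ'.
have ode := F2_ode Kt.
have SZ : 2 * t - K * t ^+ 2 < 2 * Z - K * Z ^+ 2.
  have -> : 2 * Z - K * Z ^+ 2 = 2 * t - K * t ^+ 2 + (Z - t) * ((1 - K * t) + (1 - K * Z)) by ring.
  by rewrite ltrDl mulr_gt0 //; have := KZ; lra.
have alS : al * lam * (2 * t - K * t ^+ 2) < N%:R - 1.
  by apply: lt_le_trans alA; rewrite ltr_pM2l // mulr_gt0.
have SF0 : 0 < (2 * t - K * t ^+ 2) * F t by rewrite mulr_gt0.
rewrite -(pmulr_rgt0 _ SF0).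
move: E ode f0 f1 alS S0; clear SZ SF0; move: (F t) (F1 t) (F2 t) => f g g2.
move ES : (2 * t - K * t ^+ 2) => S; move Ec : (1 - K * t) => c.
move=> E ode f0 f1 alS S0.
have cS : K * S = 1 - c ^+ 2 by rewrite -ES -Ec; ring.
have -> : 2 - 2 * K * t = 2 * c by rewrite -Ec; ring.
have -> : S * f * ((N%:R - 1) * (- K * g * f + c * (g2 * f + g ^+ 2)) + 2 * lam * f * g
     + (1 - al) * (2 * c * g ^+ 2 + 2 * S * g * g2)) =
  f * ((N%:R - 1) * (- (K * S) * g * f + c * (f * (S * g2) + S * g ^+ 2)) + 2 * lam * S * f * g
     + (1 - al) * (2 * c * S * g ^+ 2 + 2 * S * g * (S * g2))) by ring.
rewrite ode cS.
(* the last factor is [Q], which vanishes at the point considered *)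
have -> : f * ((N%:R - 1) * (- (1 - c ^+ 2) * g * f
       + c * (f * (- N%:R * c * g - lam * f) + S * g ^+ 2)) + 2 * lam * S * f * g
     + (1 - al) * (2 * c * S * g ^+ 2 + 2 * S * g * (- N%:R * c * g - lam * f))) =
  - g * (f ^+ 2 * ((N%:R - 1) - al * lam * S) + al * (1 - al) * S ^+ 2 * g ^+ 2)
  - ((N%:R - 1) * c * f - al * S * g) *
    ((N%:R - 1) * c * g * f + lam * f ^+ 2 + (1 - al) * S * g ^+ 2) by ring.
rewrite E mulr0 subr0 mulr_gt0 ?oppr_gt0 //.
have A1 : 0 < f ^+ 2 * (N%:R - 1 - al * lam * S) by rewrite mulr_gt0 ?exprn_gt0 // subr_gt0.
have A2 : 0 <= al * (1 - al) * S ^+ 2 * g ^+ 2.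
  apply: mulr_ge0 (sqr_ge0 g); apply: mulr_ge0 (sqr_ge0 S).
  by rewrite mulr_ge0 ?subr_ge0 // ltW.
exact: ltr_wpDr.
Qed.

End radial_profile.

(** * Positive solutions are radial *)

Section compactness.
Context {R : realType} {N : nat}.
Implicit Types (y : 'rV[R]_N).

Lemma compact_shell (a b : R) : compact [set y : 'rV[R]_N | a <= sqnorm y <= b].
Proof.
apply: bounded_closed_compact.
  exists (b + 1); split; first exact: num_real.
  move=> M bM y /= /andP[_ yb].
  have b0 : 0 <= b by apply: le_trans yb; exact: sqnorm_ge0.
  have M0 : 0 <= M by rewrite (le_trans _ (ltW bM)) // addr_ge0.
  rewrite /Num.norm /= mx_normrE; apply: bigmax_le => //= -[i j] _ /=.
  rewrite (ord1 i); have yj : y ord0 j ^+ 2 <= b.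
    apply: le_trans yb; rewrite /sqnorm (bigD1 j) //= lerDl.
    by apply: sumr_ge0 => k _; exact: sqr_ge0.
  have : `|y ord0 j| ^+ 2 <= b by rewrite -normrX ger0_norm ?sqr_ge0.
  have : 0 <= (`|y ord0 j| - 1) ^+ 2 by exact: sqr_ge0.
  rewrite sqrrB1; lra.
have -> : [set y : 'rV[R]_N | a <= sqnorm y <= b] =
    (@sqnorm R N) @^-1` [set x | a <= x] `&` (@sqnorm R N) @^-1` [set x | x <= b].
  by apply/seteqP; split=> y /= => [/andP[]|[-> ->]].
apply: closedI.
  by apply: closed_comp; [move=> y _; exact: continuous_sqnorm | exact: closed_ge].
by apply: closed_comp; [move=> y _; exact: continuous_sqnorm | exact: closed_le].
Qed.

(** On a compact set, a continuous [g] that is positive on the zero set of a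
    nonnegative [f] is still positive where [f] is small. *)
Lemma compact_separation (A : set 'rV[R]_N) (f g : 'rV[R]_N -> R) : compact A ->
  {within A, continuous f} -> {within A, continuous g} ->
  (forall y, A y -> 0 <= f y) -> (forall y, A y -> f y = 0 -> 0 < g y) ->
  exists2 k, 0 < k & forall y, A y -> f y < k -> 0 < g y.
Proof.
move=> cA cf cg f0 fg.
have [A0|A0] := pselect (A !=set0); last first.
  by exists 1 => // y Ay; exfalso; apply: A0; exists y.
pose h y := f y + Num.max (g y) 0.
have ch : {within A, continuous h}.
  move=> x; apply: cvgD; first exact: cf.
  by apply: continuous_max; [exact: cg | exact: cst_continuous].
have [c cAc hmin] := EVT_min_rV A0 cA ch.
have Ac : A c by rewrite inE in cAc.
have hc : 0 < h c.
  have := f0 _ Ac; rewrite le_eqVlt => /orP[/eqP E|fc].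
    by rewrite /h -E add0r lt_max fg.
  by rewrite /h ltr_pwDl // le_max lexx orbT.
exists (h c) => // y Ay fy.
have yA : y \in A by rewrite inE.
have := hmin y yA; rewrite /h => H.
have : 0 < Num.max (g y) 0 by rewrite /h in fy; lra.
by rewrite lt_max ltxx orbF.
Qed.

End compactness.

Section radial_uniqueness.
Context {R : realType} (N : nat) (K lam Z : R) (F F1 F2 : R -> R).
Hypothesis N2 : (2 <= N)%N.
Hypothesis Z0 : 0 < Z.
Hypothesis KZ : K * Z <= 1.
Hypothesis lam0 : 0 < lam.
Hypothesis F0 : F 0 = 1.
Hypothesis F_ode : forall z, K * z < 1 -> [/\ is_derive z 1 F (F1 z),
  is_derive z 1 F1 (F2 z) & radial_op N K lam (F z) (F1 z) (F2 z) z = 0].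
Implicit Types (y : 'rV[R]_N).

Local Notation zc := (chord_coord K).

(** The value of [sqnorm] on the sphere where [chord_coord] is [z]. *)
Definition sq z : R := 4 * z / (2 - K * z).

Let ball : set 'rV[R]_N := [set y | sqnorm y < sq Z].

Let Kz1 z : 0 <= z <= Z -> K * z <= 1.
Proof.
move=> /andP[z0 zZ]; have [K0|K0] := leP K 0.
  by apply: (@le_trans _ _ 0) => //; rewrite mulr_le0_ge0.
by apply: le_trans KZ; rewrite ler_pM2l.
Qed.

Let sq_le a b : 0 <= a <= Z -> 0 <= b <= Z -> a <= b -> sq a <= sq b.
Proof.
move=> /Kz1 Ka /Kz1 Kb ab.
rewrite /sq ler_pdivrMr; last by lra.
rewrite mulrAC ler_pdivlMr; last by lra.
by lra.
Qed.

Let sq_lt a b : 0 <= a <= Z -> 0 <= b <= Z -> a < b -> sq a < sq b.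
Proof.
move=> /Kz1 Ka /Kz1 Kb ab.
rewrite /sq ltr_pdivrMr; last by lra.
rewrite mulrAC ltr_pdivlMr; last by lra.
by lra.
Qed.

Let ZZ : 0 <= Z <= Z. Proof. by rewrite lexx ltW. Qed.

Let K2 z : 0 <= z <= Z -> K * z < 2.
Proof. by move=> /Kz1; lra. Qed.

Let closed_dom y : sqnorm y <= sq Z -> conf_domain K y.
Proof. by move=> H; apply: (conf_domain_bounded (Z := Z)) => //; [exact: K2 | exact: ltW]. Qed.

Let ball_dom y : ball y -> conf_domain K y.
Proof. by move=> /ltW; exact: closed_dom. Qed.

Let shellP a b y : 0 <= a <= Z -> 0 <= b <= Z -> sq a <= sqnorm y <= sq b ->
  conf_domain K y /\ a <= zc y <= b.
Proof.
move=> aZ bZ /andP[ya yb].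
have yS : sqnorm y <= sq Z by apply: le_trans yb _; apply: sq_le => //; case/andP: bZ.
have yU := closed_dom yS; split=> //.
rewrite (chord_coord_le (K2 bZ) yU) yb andbT leNgt (chord_coord_lt (K2 aZ) yU).
by rewrite -leNgt.
Qed.

Let shellP' a b y : 0 <= a <= Z -> 0 <= b <= Z -> conf_domain K y ->
  a <= zc y <= b -> sq a <= sqnorm y <= sq b.
Proof.
move=> aZ bZ yU /andP[ya yb].
move: yb ya; rewrite (chord_coord_le (K2 bZ) yU) => ->; rewrite andbT.
by rewrite leNgt (chord_coord_lt (K2 aZ) yU) -leNgt.
Qed.

Let shell_ball a b y : 0 <= a <= Z -> 0 <= b < Z -> sq a <= sqnorm y <= sq b ->
  ball y.
Proof.
move=> aZ /andP[b0 bZ] /andP[_ yb]; apply: (le_lt_trans yb).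
by apply: sq_lt => //; rewrite b0 ltW.
Qed.

Let sqnorm0 : sqnorm (0 : 'rV[R]_N) = 0.
Proof. by rewrite /sqnorm big1 // => i _; rewrite mxE expr0n. Qed.

Let zc0 : zc (0 : 'rV[R]_N) = 0.
Proof. by rewrite /chord_coord sqnorm0 mulr0 mul0r. Qed.

Let sq0 : sq 0 = 0.
Proof. by rewrite /sq mulr0 mul0r. Qed.

Let ball0 : ball 0.
Proof. by rewrite /ball /= sqnorm0 divr_gt0 ?mulr_gt0 //; have := K2 ZZ; lra. Qed.

Let zc_ge0 y : ball y -> 0 <= zc y.
Proof. by move=> /ball_dom; exact: chord_coord_ge0. Qed.

Let zc_lt y : ball y -> zc y < Z.
Proof. by move=> By; rewrite (chord_coord_lt (K2 ZZ) (ball_dom By)). Qed.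

Let zc_Kz y : ball y -> K * zc y < 1.
Proof. by move=> By; apply: (curvature_lt1 (Z := Z)) => //; rewrite zc_ge0 //= zc_lt. Qed.

Let zc_eq0 y : ball y -> zc y = 0 -> y = 0.
Proof.
move=> By; rewrite /chord_coord => E.
have /eqP : conf K y * sqnorm y = 0 by lra.
rewrite mulf_eq0 gt_eqF ?(conf_gt0 (ball_dom By)) //= /sqnorm psumr_eq0;
  last by move=> i _; exact: sqr_ge0.
move=> /allP H; apply/rowP => j; rewrite mxE.
by have := H j (mem_index_enum _); rewrite /= sqrf_eq0 => /eqP.
Qed.

Let Kz_near z : K * z < 1 -> exists2 eta, 0 < eta & forall x, `|x - z| < eta -> K * x < 1.
Proof.
move=> Kz; have K1 : 0 < `|K| + 1 by rewrite ltr_pwDr.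
exists ((1 - K * z) / (`|K| + 1)); first by rewrite divr_gt0 // subr_gt0.
move=> x; rewrite ltr_pdivlMr // => H.
have : K * (x - z) <= `|x - z| * `|K| by rewrite -normrM mulrC ler_norm.
have : 0 <= `|x - z| by [].
by lra.
Qed.

Let open_ball_sq a : open [set y : 'rV[R]_N | sqnorm y < a].
Proof. exact: open_sqnorm_lt. Qed.

Let cont_radial (h : R -> R) y dh : ball y -> is_derive (zc y) 1 h dh ->
  {for y, continuous (fun y => h (zc y))}.
Proof.
move=> By hd; apply: continuous_comp; first exact: continuous_chord_coord (ball_dom By).
exact: is_derive_continuous hd.
Qed.

Let within_of_at (A : set 'rV[R]_N) (h : 'rV[R]_N -> R) :
  (forall y, A y -> {for y, continuous h}) -> {within A, continuous h}.
Proof. by move=> H; apply: continuous_in_subspaceT => y; rewrite inE; exact: H. Qed.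

Section solution.
Variable v : 'rV[R]_N -> R.
Hypothesis v_C2 : C2_on ball v.
Hypothesis v_eq : eigen_eq K lam ball v.

Let touch y (e e1 : R -> R) (e2 eta : R) : ball y -> 0 < eta ->
  (forall z, `|z - zc y| < eta -> is_derive z 1 e (e1 z)) ->
  is_derive (zc y) 1 e1 e2 -> (\near y, v y <= e (zc y)) -> v y = e (zc y) ->
  0 <= radial_op N K lam (e (zc y)) (e1 (zc y)) e2 (zc y).
Proof.
move=> By eta0 de de1 vle vy.
exact: (radial_touch_above N2 (@open_ball_sq _) (fun y => @ball_dom y) v_C2 v_eq
  By eta0 de de1 vle vy).
Qed.

(** The radial operator kills [F] and multiplies constants by [lam], so it is
    negative on [a + M * F] when [a < 0]; such a function cannot touch a solution
    from above. *)
Lemma no_touch_above y (a M : R) : ball y -> a < 0 ->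
  (\near y, v y <= a + M * F (zc y)) -> v y = a + M * F (zc y) -> False.
Proof.
move=> By a0 vle vy; have Kz := zc_Kz By.
have [eta eta0 Keta] := Kz_near Kz.
have [_ d1 E] := F_ode Kz.
have := @touch y (fun z => a + M * F z) (fun z => M * F1 z) (M * F2 (zc y)) eta By eta0.
have -> : radial_op N K lam (a + M * F (zc y)) (M * F1 (zc y)) (M * F2 (zc y)) (zc y) = lam * a.
  have -> : lam * a = lam * a + M * radial_op N K lam (F (zc y)) (F1 (zc y)) (F2 (zc y)) (zc y).
    by rewrite E mulr0 addr0.
  by rewrite /radial_op; ring.
rewrite leNgt pmulr_rlt0 // a0 => H.
have : ~~ true; last by [].
apply: H => [z /Keta /F_ode[d _ _]|//|//].
by apply: is_derive_eq (is_derive_add (is_derive_const a z 1) (is_derive_scale M d)) _; ring.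
Qed.

End solution.

Let shell_max (h : 'rV[R]_N -> R) a b y0 : 0 <= a <= Z -> 0 <= b < Z ->
  ball y0 -> a <= zc y0 <= b ->
  (forall y, ball y -> a <= zc y <= b -> {for y, continuous h}) ->
  exists y, [/\ ball y, a <= zc y <= b &
    forall x, ball x -> a <= zc x <= b -> h x <= h y].
Proof.
move=> aZ bZ By0 y0s ch.
have bZ' : 0 <= b <= Z by case/andP: bZ => ? /ltW ->; rewrite andbT.
pose A := [set y : 'rV[R]_N | sq a <= sqnorm y <= sq b].
have AP y : A y <-> ball y /\ a <= zc y <= b.
  split=> [Ay|[By ys]]; last exact: (shellP' aZ bZ' (ball_dom By) ys).
  by split; [exact: shell_ball Ay | exact: (shellP aZ bZ' Ay).2].
have A0 : A !=set0 by exists y0; apply/AP.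
have cA : {within A, continuous h}.
  by apply: within_of_at => y /AP[By ys]; exact: ch.
have [y yA ymax] := EVT_max_rV A0 (@compact_shell R N _ _) cA.
have /AP[By ys] : A y by rewrite inE in yA.
exists y; split=> // x Bx xs; apply: ymax; rewrite inE; exact/AP.
Qed.

(** Turns maxima over a closed shell into the local maxima of the touching lemmas. *)
Let near_shell (P : set 'rV[R]_N) a b y : 0 <= a <= Z -> 0 <= b < Z -> ball y ->
  a < zc y < b -> (forall x, ball x -> a <= zc x <= b -> P x) -> \near y, P y.
Proof.
move=> aZ bZ By /andP[ay yb] H.
have C := continuous_chord_coord (ball_dom By).
have N1 : \near y, ball y by apply: open_nbhs_nbhs; split => //; exact: open_ball_sq.
have N3 : \forall x \near y, zc x < b by exact: (cvgr_lt _ C).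
have N4 : \forall x \near y, a < zc x by exact: (cvgr_gt _ C).
by apply: filterS3 N1 N3 N4 => x Bx xb ax; apply: H => //; rewrite !ltW.
Qed.

Section liouville.
Hypothesis F_gt0 : forall z, 0 <= z < Z -> 0 < F z.

Let N0 : (0 < N)%N. Proof. exact: ltnW. Qed.

(** The quotient by [F] of a second solution of the radial equation has derivative
    [1 / (S ^ (N / 2) F ^ 2)], where [S = 2 z - K z ^ 2].  Here [J] is a primitive of
    [1 / (S ^ N F ^ 2)]: the larger exponent makes the operator negative on [F * J],
    by the second property.  By the third, [J] grows at least like a multiple of
    [1 / F], so that [F * J] does not tend to zero at the boundary with [F]. *)
Lemma barrier_exists a : 0 < a -> exists J J1 J2 : R -> R,
  (forall z, a < z < Z -> [/\ is_derive z 1 J (J1 z), is_derive z 1 J1 (J2 z) & 0 < J1 z]) /\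
  (forall z, a < z < Z -> (2 * z - K * z ^+ 2) * (2 * F1 z * J1 z + F z * J2 z)
     + N%:R * (1 - K * z) * (F z * J1 z) < 0) /\
  exists2 c, 0 < c & forall z, a < z < Z -> c * - F1 z / F z ^+ 2 <= J1 z.
Proof.
move=> a0; pose S z := 2 * z - K * z ^+ 2.
pose D z := S z ^+ N * F z ^+ 2.
have inZ z : a <= z < Z -> 0 <= z < Z.
  by move=> /andP[az ->]; rewrite andbT (le_trans (ltW a0)).
have S_gt0 z : a <= z < Z -> 0 < S z.
  move=> zZ; apply: sigma_sqr_gt0; first by case/andP: zZ => + _; exact: lt_le_trans.
  by apply: (curvature_lt1 (Z := Z)) => //; exact: inZ.
have D_gt0 z : a <= z < Z -> 0 < D z.
  by move=> zZ; rewrite mulr_gt0 // exprn_gt0 // ?S_gt0 // F_gt0 // inZ.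
pose D1 z := S z ^+ N * (2 * F z * F1 z) + F z ^+ 2 * (N%:R * S z ^+ N.-1 * (2 - 2 * K * z)).
have dD z : a <= z < Z -> is_derive z 1 D (D1 z).
  move=> zZ; have [d _ _] := F_ode (curvature_lt1 KZ (inZ _ zZ)).
  have DS := is_derive_sub (is_derive_scale 2 (is_derive_var z))
     (is_derive_scale K (is_derive_pow 1 (is_derive_var z))).
  have DP := is_derive_pow N.-1 DS; rewrite (prednK N0) in DP.
  by apply: is_derive_eq (is_derive_mul DP (is_derive_pow 1 d)) _; rewrite /D1 /S; ring.
pose J1 z := (D z)^-1.
have dJ1 z : a <= z < Z -> is_derive z 1 J1 (- (D z) ^- 2 * D1 z).
  by move=> zZ; apply: is_derive_inv (dD _ zZ); rewrite gt_eqF // D_gt0.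
have [J dJ] : exists J, forall z, a < z < Z -> is_derive z 1 J (J1 z).
  by apply: primitive_exists => z /dJ1; exact: is_derive_continuous.
have sub z : a < z < Z -> a <= z < Z by move=> /andP[/ltW -> ->].
exists J, J1, (fun z => - (D z) ^- 2 * D1 z); split; last split.
- move=> z zZ; split; [exact: dJ | exact: dJ1 (sub _ zZ) |].
  by rewrite invr_gt0 D_gt0 // sub.
- move=> z /sub zZ.
  have S0 := S_gt0 _ zZ; have f0 := F_gt0 (inZ _ zZ).
  have Kz := curvature_lt1 KZ (inZ _ zZ).
  have SN : S z ^+ N = S z * S z ^+ N.-1 by rewrite -exprS (prednK N0).
  rewrite -/(S z) /J1 /D1 /D SN.
  have T0 : 0 < S z ^+ N.-1 by rewrite exprn_gt0.
  move: S0 T0 f0; move: (S z) (S z ^+ N.-1) (F z) (F1 z) => s t f g s0 t0 f0.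
  rewrite [ltLHS](_ : _ = - (N%:R * (1 - K * z) / (s * t * f))).
    by rewrite oppr_lt0 divr_gt0 ?mulr_gt0 ?subr_gt0 // ltr0n.
  by field; rewrite !gt_eqF.
have [C C0 HC] := F1_bounded N0 Z0 KZ lam0 F0 F_ode F_gt0.
pose SM := 2 * Z - K * Z ^+ 2.
have S_le z : a <= z < Z -> S z <= SM.
  move=> zZ; have := curvature_lt1 KZ (inZ _ zZ) => Kz.
  have -> : SM = S z + (Z - z) * ((1 - K * z) + (1 - K * Z)) by rewrite /SM /S; ring.
  rewrite lerDl mulr_ge0 //; first by case/andP: zZ => _ /ltW; rewrite subr_ge0.
  by have := KZ; lra.
have SM0 : 0 < SM.
  have -> : SM = Z * (2 - K * Z) by rewrite /SM; ring.
  by rewrite mulr_gt0 //; have := KZ; lra.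
exists (SM ^+ N * C)^-1; first by rewrite invr_gt0 mulr_gt0 // exprn_gt0.
move=> z /sub zZ; rewrite /J1 /D [(S z ^+ N * _)^-1]invfM.
have f0 := F_gt0 (inZ _ zZ); have S0 := S_gt0 _ zZ.
have f2 : 0 <= (F z ^+ 2)^-1 by rewrite invr_ge0 sqr_ge0.
apply: ler_wpM2r => //; rewrite invfM -mulrA.
have H1 : C^-1 * - F1 z <= 1 by rewrite mulrC ler_pdivrMr // mul1r HC // inZ.
apply: (@le_trans _ _ (SM ^+ N)^-1).
  by rewrite ler_piMr // invr_ge0 exprn_ge0 // ltW.
rewrite lef_pV2 ?posrE ?exprn_gt0 // ler_pXn2r ?nnegrE ?(ltW S0) ?(ltW SM0) //.
exact: S_le.
Qed.

(** Let [w = (v - v 0 * F) / F], and suppose that [w] is positive at some point.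
    For a suitable [eps], the maximum of [w - eps * j] is positive, [j] being the barrier
    normalized to vanish on a small sphere of radius [d].  It is not reached on that
    sphere, where [w] is small because [w 0 = 0], nor near the boundary, where
    [v - v 0 * F] is small and [F * j] is not.  At an interior maximum, [v] is touched
    from above by a multiple of [F] plus [eps * F * j], on which the operator is
    negative. *)
Lemma liouville_above (v : 'rV[R]_N -> R) : C2_on ball v -> eigen_eq K lam ball v ->
  (forall y, ball y -> {for y, continuous v}) ->
  (forall d, 0 < d -> exists2 z, 0 <= z < Z & forall y, ball y -> z <= zc y ->
     v y - v 0 * F (zc y) < d) ->
  forall y, ball y -> v y <= v 0 * F (zc y).
Proof.
move=> vC2 veq vc vb y1 By1; rewrite leNgt; apply/negP; rewrite -subr_gt0 => W1.
pose w y := (v y - v 0 * F (zc y)) / F (zc y).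
have Fz y : ball y -> 0 < F (zc y) by move=> By; rewrite F_gt0 // zc_ge0 //= zc_lt.
have cF y : ball y -> {for y, continuous (fun y => F (zc y))}.
  by move=> By; have [d _ _] := F_ode (zc_Kz By); exact: (cont_radial By d).
have cw y : ball y -> {for y, continuous w}.
  move=> By; apply: continuousM.
    apply: continuousB; first exact: vc.
    by apply: continuousM; [exact: cst_continuous | exact: cF].
  by apply: continuousV; [rewrite gt_eqF // Fz | exact: cF].
pose z1 := zc y1; pose tau := w y1.
have tau0 : 0 < tau by rewrite divr_gt0 // Fz.
have z1Z : z1 < Z by exact: zc_lt.
have z10 : 0 < z1.
  rewrite lt_neqAle zc_ge0 // andbT; apply/eqP => E.
  by move: W1; rewrite (zc_eq0 By1 (esym E)) zc0 F0 mulr1 subrr ltxx.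
have z1s : 0 <= z1 <= Z by rewrite !ltW.
have [k k0 Hk] : exists2 k, 0 < k & forall y, ball y -> zc y <= z1 -> zc y < k -> w y < tau / 4.
  pose A := [set y : 'rV[R]_N | sq 0 <= sqnorm y <= sq z1].
  have i0 : 0 <= (0 : R) <= Z by rewrite lexx ltW.
  have AP y : A y -> ball y by move=> Ay; apply: shell_ball Ay => //; rewrite z1Z ltW.
  have [|||||k k0 Hk] := @compact_separation R N A zc (fun y => tau / 4 - w y).
  - exact: compact_shell.
  - by apply: within_of_at => y /AP /ball_dom; exact: continuous_chord_coord.
  - apply: within_of_at => y /AP By; apply: continuousB; last exact: cw.
    exact: cst_continuous.
  - by move=> y /AP; exact: zc_ge0.
  - move=> y /AP By /(zc_eq0 By) ->; rewrite /w zc0 F0 mulr1 subrr mul0r subr0.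
    by rewrite divr_gt0.
  exists k => // y By yz yk; rewrite -subr_gt0; apply: Hk => //.
  by apply: (shellP' i0 z1s (ball_dom By)); rewrite zc_ge0.
(* inner radius of the shell: [w] is small up to [k], and [y1] stays in the shell *)
pose d := Num.min (k / 2) (z1 / 2).
have d0 : 0 < d by rewrite lt_min; apply/andP; split; lra.
have dk : d < k by rewrite gt_min; apply/orP; left; lra.
have dz : d < z1 by rewrite gt_min; apply/orP; right; lra.
have dZ : 0 <= d <= Z by rewrite ltW //= ltW // (lt_trans dz).
have d20 : 0 < d / 2 by rewrite divr_gt0.
have [J [J1 [J2 [dJ [LJ [c c0 Jc]]]]]] := barrier_exists d20.
have inJ z : d <= z < Z -> d / 2 < z < Z.
  by move=> /andP[dz' ->]; rewrite andbT; lra.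
have inF z : d <= z < Z -> 0 <= z < Z by move=> /andP[dz' ->]; rewrite andbT; lra.
pose j z := J z - J d.
have dj z : d <= z < Z -> is_derive z 1 j (J1 z).
  move=> /inJ /dJ[d' _ _].
  by apply: is_derive_eq (is_derive_sub d' (is_derive_const (J d) z 1)) _; rewrite subr0.
have jlow z : d <= z < Z -> c * (1 / F z - 1 / F d) <= j z.
  move=> /andP[]; rewrite le_eqVlt => /orP[/eqP <- _|dz' zZ].
    by rewrite subrr mulr0 /j subrr.
  pose h x := j x - c * (1 / F x); pose h' x := J1 x - c * - F1 x / F x ^+ 2.
  have dh x : d <= x < Z -> is_derive x 1 h (h' x).
    move=> xx; have [dF _ _] := F_ode (curvature_lt1 KZ (inF _ xx)).
    have f0 := F_gt0 (inF _ xx).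
    have DI := is_derive_inv (lt0r_neq0 f0) dF.
    have DI1 : is_derive x 1 (fun t => 1 / F t) (- (F x) ^- 2 * F1 x).
      by under eq_fun do rewrite mul1r.
    apply: is_derive_eq (is_derive_sub (dj _ xx) (is_derive_scale c DI1)) _.
    by rewrite /h'; field; rewrite gt_eqF.
  have [||x] := @MVT R h h' d z dz'.
  - by move=> x /[!in_itv]/= /andP[? ?]; apply: dh; apply/andP; split; lra.
  - apply: derivable_within_continuous => x /[!in_itv]/= /andP[? ?].
    by apply: ex_derive; apply: dh; apply/andP; split; lra.
  rewrite in_itv/= => /andP[dx xz] E.
  have : 0 <= h z - h d.
    rewrite E mulr_ge0 ?(subr_ge0 d z) ?(ltW dz') // /h' subr_ge0; apply: Jc.
    by apply: inJ; apply/andP; split; lra.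
  by rewrite /h /j subrr; lra.
have Fd0 : 0 < F d by apply: F_gt0; apply: inF; rewrite lexx (lt_trans dz).
have Fdz : F z1 < F d.
  by apply: (F_decr N0 KZ lam0 F0 F_ode F_gt0); rewrite // ltW.
(* a positive lower bound of [F * j] beyond [z1], valid up to the boundary *)
pose m := c * (1 - F z1 / F d).
have m0 : 0 < m by rewrite mulr_gt0 // subr_gt0 ltr_pdivrMr // mul1r.
have Fj z : z1 <= z < Z -> m <= F z * j z.
  move=> /andP[zz zZ]; have zin : d <= z < Z by rewrite zZ andbT (le_trans (ltW dz)).
  have fz := F_gt0 (inF _ zin).
  have : F z * (c * (1 / F z - 1 / F d)) <= F z * j z by rewrite ler_pM2l // jlow.
  apply: le_trans.
  have -> : F z * (c * (1 / F z - 1 / F d)) = c * (1 - F z / F d).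
    by field; rewrite !gt_eqF.
  rewrite /m ler_pM2l // lerD2l lerN2 ler_pM2r ?invr_gt0 //.
  move: zz; rewrite le_eqVlt => /orP[/eqP -> //|zz].
  by rewrite ltW // (F_decr N0 KZ lam0 F0 F_ode F_gt0) // ltW.
have f1 := Fz _ By1.
have jz1 : 0 < j z1.
  by rewrite -(pmulr_rgt0 _ f1) (lt_le_trans m0) // Fj // lexx.
(* leaves three quarters of [tau] at [y1] *)
pose eps := tau / (4 * j z1).
have eps0 : 0 < eps by rewrite divr_gt0 // mulr_gt0.
have em0 : 0 < eps * m by rewrite mulr_gt0.
have [z2 /andP[z20 z2Z] Hz2] := vb _ em0.
(* outer radius of the shell *)
pose z3 := Num.max z1 z2.
have z13 : z1 <= z3 by rewrite le_max lexx.
have z23 : z2 <= z3 by rewrite le_max lexx orbT.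
have z3Z : 0 <= z3 < Z by rewrite gt_max z1Z z2Z (le_trans z20).
pose h y := w y - eps * j (zc y).
have ch y : ball y -> d <= zc y <= z3 -> {for y, continuous h}.
  move=> By /andP[dy _]; apply: continuousB; first exact: cw.
  apply: continuousM; first exact: cst_continuous.
  by apply: (cont_radial By (dh := J1 (zc y))); apply: dj; rewrite dy zc_lt.
have y1s : d <= zc y1 <= z3 by rewrite (ltW dz).
have [y [By /andP[dy y3] ymax]] := shell_max dZ z3Z By1 y1s ch.
have h1 : 0 < h y1.
  rewrite /h -/tau -/z1 /eps.
  have -> : tau / (4 * j z1) * j z1 = tau / 4 by field; rewrite gt_eqF.
  by lra.
have hy : tau - tau / 4 <= h y.
  apply: le_trans (ymax _ By1 y1s); rewrite /h -/tau -/z1 /eps.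
  have -> : tau / (4 * j z1) * j z1 = tau / 4 by field; rewrite gt_eqF.
  by [].
have dy' : d < zc y.
  rewrite lt_neqAle dy andbT; apply/eqP => E.
  have : w y < tau / 4 by apply: Hk => //; rewrite -E // ltW.
  by move: hy; rewrite /h -E /j subrr mulr0 subr0; lra.
have y3' : zc y < z3.
  rewrite lt_neqAle y3 andbT; apply/eqP => E.
  have := Hz2 _ By; rewrite E => /(_ z23) Hs.
  have Fz3 := Fz _ By; rewrite E in Fz3.
  have : eps * m <= eps * (F z3 * j z3).
    by rewrite ler_pM2l // Fj // z13; case/andP: z3Z.
  have hE : h y * F z3 = (v y - v 0 * F z3) - eps * (F z3 * j z3).
    by rewrite /h /w E; field; rewrite gt_eqF.
  have : 0 < h y * F z3 by rewrite mulr_gt0 //; lra.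
  by rewrite hE; lra.
pose M := h y + v 0.
have Kz := zc_Kz By.
have [_ _ ode] := F_ode Kz.
pose e z := M * F z + eps * (F z * j z).
pose e1 z := M * F1 z + eps * (F z * J1 z + j z * F1 z).
pose e2 := M * F2 (zc y) + eps * ((F (zc y) * J2 (zc y) + J1 (zc y) * F1 (zc y)) +
    (j (zc y) * F2 (zc y) + F1 (zc y) * J1 (zc y))).
pose eta := Num.min (zc y - d) (Z - zc y).
have eta0 : 0 < eta by rewrite lt_min !subr_gt0 dy' zc_lt.
have near_in z : `|z - zc y| < eta -> d <= z < Z.
  by rewrite lt_min !ltr_norml => /andP[/andP[? ?] /andP[? ?]]; apply/andP; split; lra.
have yin : d <= zc y < Z by rewrite (ltW dy') zc_lt.
have := radial_touch_above N2 (@open_ball_sq _) (fun y => @ball_dom y) vC2 veq By eta0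
  (e := e) (e1 := e1) (e2 := e2).
have eE x : ball x -> e (zc x) - v x = (h y - h x) * F (zc x).
  move=> Bx; have := Fz _ Bx; rewrite /e /h /w /M => fx.
  rewrite -/(w y) -/(h y) /h; field; rewrite gt_eqF //.
have neg : radial_op N K lam (e (zc y)) (e1 (zc y)) e2 (zc y) < 0.
  have -> : radial_op N K lam (e (zc y)) (e1 (zc y)) e2 (zc y) =
    (M + eps * j (zc y)) * radial_op N K lam (F (zc y)) (F1 (zc y)) (F2 (zc y)) (zc y)
    + eps * ((2 * zc y - K * zc y ^+ 2) * (2 * F1 (zc y) * J1 (zc y) + F (zc y) * J2 (zc y))
     + N%:R * (1 - K * zc y) * (F (zc y) * J1 (zc y))).
    by rewrite /radial_op /e /e1 /e2; ring.
  by rewrite ode mulr0 add0r pmulr_rlt0 // LJ // inJ.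
move=> H; have : 0 <= radial_op N K lam (e (zc y)) (e1 (zc y)) e2 (zc y); last by rewrite leNgt neg.
apply: H.
- move=> z /near_in zin.
  have [dF _ _] := F_ode (curvature_lt1 KZ (inF _ zin)).
  exact: is_derive_add (is_derive_scale M dF)
    (is_derive_scale eps (is_derive_mul dF (dj _ zin))).
- have [dF dF1 _] := F_ode Kz; have [_ dJ1 _] := dJ _ (inJ _ yin).
  exact: is_derive_add (is_derive_scale M dF1) (is_derive_scale eps
    (is_derive_add (is_derive_mul dF dJ1) (is_derive_mul (dj _ yin) dF1))).
- apply: (near_shell dZ z3Z By); first by rewrite dy' y3'.
  move=> x Bx xs; rewrite -subr_ge0 eE // mulr_ge0 ?(ltW (Fz _ Bx)) // subr_ge0.
  exact: ymax.
- by apply/esym/eqP; rewrite -subr_eq0 eE // subrr mul0r.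
Qed.

End liouville.

Section positive_solution.
Variable u : 'rV[R]_N -> R.
Hypothesis u_C2 : C2_on ball u.
Hypothesis u_eq : eigen_eq K lam ball u.
Hypothesis u_gt0 : forall y, ball y -> 0 < u y.
Hypothesis u_cont : {within [set y : 'rV[R]_N | 0 <= sqnorm y <= sq Z], continuous u}.
Hypothesis u_bdry : forall y, sqnorm y = sq Z -> u y = 0.

Let u_at y : ball y -> {for y, continuous u}.
Proof.
move=> By; have yA : [set y : 'rV[R]_N | 0 <= sqnorm y <= sq Z] y.
  by rewrite /= sqnorm_ge0 ltW.
have C := (subspace_continuousP _ _).1 u_cont y yA.
apply: cvg_trans C => P; rewrite /= /nbhs /= => HP.
have nB : \near y, ball y by apply: open_nbhs_nbhs; split => //; exact: open_ball_sq.
apply: filterS2 nB HP => x Bx; apply.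
by rewrite /= sqnorm_ge0 ltW.
Qed.

Let boundary_small d : 0 < d -> exists2 z, 0 <= z < Z & forall y, ball y -> z <= zc y -> u y < d.
Proof.
move=> d0; pose A := [set y : 'rV[R]_N | 0 <= sqnorm y <= sq Z].
have i0 : 0 <= (0 : R) <= Z by rewrite lexx ltW.
have AP y : A y -> conf_domain K y /\ 0 <= zc y <= Z.
  by move=> /andP[y0 yS]; apply: (shellP i0 ZZ); rewrite sq0 y0 yS.
have [|||||k k0 Hk] := @compact_separation R N A (fun y => Z - zc y) (fun y => d - u y).
- exact: compact_shell.
- apply: within_of_at => y /AP[yU _]; apply: continuousB; first exact: cst_continuous.
  exact: continuous_chord_coord.
- move=> y; apply: cvgB; first exact: cst_continuous.
  exact: u_cont.
- by move=> y /AP[_ /andP[_]]; rewrite subr_ge0.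
- move=> y Ay; have [yU _] := AP _ Ay; have /andP[_ yS] := Ay => /eqP.
  rewrite subr_eq0 => /eqP E; rewrite u_bdry ?subr0 //.
  apply/eqP; rewrite eq_le yS leNgt -(chord_coord_lt (K2 ZZ) yU) -E.
  by rewrite ltxx.
exists (Num.max 0 (Z - k / 2)); first by rewrite le_max lexx gt_max Z0 /= ltrBlDr ltrDl divr_gt0.
move=> y By; rewrite ge_max => /andP[_ yz]; rewrite -subr_gt0; apply: Hk.
  by rewrite /A /= sqnorm_ge0 ltW.
by lra.
Qed.

Let u0 : 0 < u 0. Proof. exact: u_gt0. Qed.

(** If [F] is not positive at [z], the maximum of [F / (u - eps)] over the ball of
    radius [z], where [u > eps], is not reached on its boundary.  At an interior
    maximum [h], the function [- eps - F / h] touches [- u] from above, against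
    [no_touch_above]. *)
Lemma profile_gt0 z : 0 <= z < Z -> 0 < F z.
Proof.
move=> zZ; rewrite ltNge; apply/negP => Fz.
have i0 : 0 <= (0 : R) <= Z by rewrite lexx ltW.
have s0 : 0 <= zc (0 : 'rV[R]_N) <= z by rewrite zc0 lexx; case/andP: zZ.
have zlt : z < Z by case/andP: zZ.
have z00 : 0 < z.
  case/andP: zZ; rewrite le_eqVlt => /orP[/eqP E|//].
  by move: Fz; rewrite -E F0 ler10.
have [c [Bc cs cmin]] := shell_max i0 zZ ball0 s0 (fun y By _ => continuousN (u_at By)).
pose eps := u c / 2; have eps0 : 0 < eps by rewrite divr_gt0 // u_gt0.
have ue y : ball y -> 0 <= zc y <= z -> 0 < u y - eps.
  move=> By ys; have := cmin _ By ys; rewrite /= lerN2.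
  by have := u_gt0 Bc; rewrite /eps; lra.
pose h y := F (zc y) / (u y - eps).
have ch y : ball y -> 0 <= zc y <= z -> {for y, continuous h}.
  move=> By ys; have [d _ _] := F_ode (zc_Kz By).
  apply: continuousM; first exact: (cont_radial By d).
  apply: continuousV; first by rewrite gt_eqF // ue.
  by apply: continuousB; [exact: u_at | exact: cst_continuous].
have [y [By ys ymax]] := shell_max i0 zZ ball0 s0 ch.
have M0 : 0 < h y.
  apply: (lt_le_trans _ (ymax _ ball0 s0)).
  by rewrite /h zc0 F0 divr_gt0 // ue.
have [eqU2 eqU] := eigen_eqN (@open_ball_sq _) u_C2 u_eq.
have Fy : F (zc y) = h y * (u y - eps) by rewrite /h divfK // gt_eqF // ue.
have eN : - eps < 0 by rewrite oppr_lt0.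
apply: (no_touch_above eqU2 eqU By eN (M := - (h y)^-1)).
  have [y0|yn0] := eqVneq (zc y) 0.
    have Bz : \near y, ball y by apply: open_nbhs_nbhs; split => //; exact: open_ball_sq.
    have Cz : \forall x \near y, zc x < z.
      have C := continuous_chord_coord (ball_dom By); apply: (cvgr_lt _ C).
      by rewrite y0.
    apply: filterS2 Bz Cz => x Bx xz.
    have xs : 0 <= zc x <= z by rewrite zc_ge0 //= ltW.
    have := ymax _ Bx xs; rewrite {1}/h ler_pdivrMr ?ue // => H.
    by rewrite mulNr -opprD lerN2 -lerBrDl mulrC ler_pdivrMr // [(u x - eps) * _]mulrC.
  have uy := ue _ By ys.
  have ylt : zc y < z.
    case/andP: ys => _; rewrite le_eqVlt => /orP[/eqP E|//].
    move: M0; rewrite /h E pmulr_lgt0 ?invr_gt0 //.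
    by rewrite ltNge Fz.
  apply: (near_shell i0 zZ By).
    by rewrite ylt andbT lt_neqAle eq_sym yn0; case/andP: ys.
  move=> x Bx xs; have := ymax _ Bx xs; rewrite {1}/h ler_pdivrMr ?ue // => H.
  by rewrite mulNr -opprD lerN2 -lerBrDl mulrC ler_pdivrMr // [(u x - eps) * _]mulrC.
by rewrite Fy; field; rewrite gt_eqF.
Qed.

(** If [F] stayed away from [0], the maximum of [(u + d) / F] would be interior for
    small [d], because [u] vanishes on the boundary; there [h * F - d] would touch [u]
    from above. *)
Lemma profile_vanishes c : 0 < c -> exists2 z, 0 <= z < Z & F z < c.
Proof.
move=> c0; have [//|H] := pselect (exists2 z, 0 <= z < Z & F z < c).
exfalso; have Fc z : 0 <= z < Z -> c <= F z.
  by move=> zZ; rewrite leNgt; apply/negP => Fz; apply: H; exists z.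
pose d := u 0 * c / 4; have d0 : 0 < d by rewrite divr_gt0 // mulr_gt0.
have [z zZ Hz] := boundary_small d0.
have i0 : 0 <= (0 : R) <= Z by rewrite lexx ltW.
have s0 : 0 <= zc (0 : 'rV[R]_N) <= z by rewrite zc0 lexx; case/andP: zZ.
have Fz y : ball y -> c <= F (zc y) by move=> By; apply: Fc; rewrite zc_ge0 //= zc_lt.
have Fz0 y : ball y -> 0 < F (zc y) by move=> /Fz; exact: lt_le_trans.
pose h y := (u y + d) / F (zc y).
have ch y : ball y -> 0 <= zc y <= z -> {for y, continuous h}.
  move=> By ys; have [dF _ _] := F_ode (zc_Kz By).
  apply: continuousM; last by apply: continuousV;
    [rewrite gt_eqF // Fz0 | exact: (cont_radial By dF)].
  by apply: continuousD; [exact: u_at | exact: cst_continuous].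
have [y [By ys ymax]] := shell_max i0 zZ ball0 s0 ch.
have hy : u 0 < h y.
  apply: (lt_le_trans _ (ymax _ ball0 s0)).
  by rewrite /h zc0 F0 divr1 ltrDl.
have yz : zc y < z.
  rewrite ltNge; apply/negP => zy; have us := Hz _ By zy.
  have : h y <= 2 * d / c.
    rewrite /h ler_pdivrMr ?Fz0 // mulrAC ler_pdivlMr //.
    apply: (@le_trans _ _ (2 * d * c)); first by rewrite ler_pM2r //; lra.
    by rewrite ler_pM2l ?Fz // mulr_gt0.
  have -> : 2 * d / c = u 0 / 2 by rewrite /d; field; rewrite gt_eqF.
  by have := u0; lra.
have dN : - d < 0 by rewrite oppr_lt0.
apply: (no_touch_above u_C2 u_eq By dN (M := h y)); last first.
  by rewrite /h divfK ?gt_eqF ?Fz0 //; ring.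
have C := continuous_chord_coord (ball_dom By).
have Bz : \near y, ball y by apply: open_nbhs_nbhs; split => //; exact: open_ball_sq.
have Cz : \forall x \near y, zc x < z by exact: (cvgr_lt _ C).
apply: filterS2 Bz Cz => x Bx xz.
have xs : 0 <= zc x <= z by rewrite zc_ge0 //= ltW.
have := ymax _ Bx xs; rewrite {1}/h ler_pdivrMr ?Fz0 //; lra.
Qed.

(** Near the boundary, [u - u 0 * F] is small because [u] is small and [F > 0], and its
    opposite is small because [F] is small and [u > 0]. *)
Theorem positive_solution_radial y : ball y -> u y = u 0 * F (zc y).
Proof.
move=> By; have Fp := profile_gt0.
have up : forall y, ball y -> u y <= u 0 * F (zc y).
  apply: (liouville_above Fp u_C2 u_eq u_at) => d d0.
  have [z zZ Hz] := boundary_small d0; exists z => // x Bx xz.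
  have : 0 <= u 0 * F (zc x) by rewrite mulr_ge0 ?(ltW u0) // ltW // Fp // zc_ge0 //= zc_lt.
  by have := Hz _ Bx xz; lra.
have [C2N eqN] := eigen_eqN (@open_ball_sq _) u_C2 u_eq.
have low : forall y, ball y -> - u y <= - u 0 * F (zc y).
  apply: (liouville_above Fp C2N eqN) => [x Bx|d d0]; first exact: continuousN (u_at Bx).
  have [z /[dup] zZ /andP[z0 zlt] Fz] := profile_vanishes (divr_gt0 d0 u0).
  exists z => // x Bx xz.
  have Fx : F (zc x) <= F z.
    move: xz; rewrite le_eqVlt => /orP[/eqP -> //|xz].
    by rewrite ltW // (F_decr (ltnW N2) KZ lam0 F0 F_ode Fp) // zc_lt.
  have : F (zc x) * u 0 < d by rewrite -ltr_pdivlMr // (le_lt_trans Fx).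
  by have := u_gt0 Bx; lra.
by apply/eqP; rewrite eq_le up //=; have := low _ By; lra.
Qed.

End positive_solution.

End radial_uniqueness.

(** * Power concavity of the first eigenfunction *)

Section eigenfunction.
Context {R : realType} (N : nat) (K r lam : R) (o : 'rV[R]_N.+1) (phi : 'rV[R]_N.+1 -> R).
Hypothesis N2 : (2 <= N)%N.
Hypothesis oS : space_form K o.
Hypothesis r0 : 0 < r.
Hypothesis rK : 0 < K -> Num.sqrt K * r <= pi / 2.
Hypothesis lam0 : 0 < lam.
Hypothesis phi_sol : dirichlet_solution K o r lam phi.
Hypothesis phi_gt0 : forall x, geod_ball K o r x -> 0 < phi x.

Let N0 : (0 < N)%N. Proof. exact: ltnW. Qed.

Local Notation Z := (vers K r).

Lemma half_diam : within_diam K r.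
Proof. by move=> /rK /le_trans; apply; rewrite ler_pdivrMr // ler_peMr ?pi_ge0 // ler1n. Qed.

Lemma vers_radius_gt0 : 0 < Z.
Proof. by have := vers_lt (lexx 0) r0 half_diam; rewrite vers0. Qed.

Lemma vers_radius_le1 : K * Z <= 1.
Proof.
rewrite cos_K_vers; suff : 0 <= cos_K K r by lra.
rewrite /cos_K; have [K0|K0] := ltP 0 K.
  apply: cos_ge0_pihalf; rewrite rK // andbT (@le_trans _ _ 0) //.
    by rewrite oppr_le0 divr_ge0 ?pi_ge0.
  by rewrite mulr_ge0 ?sqrtr_ge0 // ltW.
by case: ifP => // _; rewrite divr_ge0 // addr_ge0 ?expR_ge0.
Qed.

Lemma geod_ballE : geod_ball K o r = [set x | space_form K x /\ chord K o x < Z].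
Proof. exact: geod_ball_chord N0 oS r0 half_diam. Qed.

(** The eigenfunction, pulled back by the stereographic chart, is a positive
    solution on a Euclidean ball. *)
Theorem eigenfunction_radial (F F1 F2 : R -> R) : F 0 = 1 ->
  (forall z, K * z < 1 -> [/\ is_derive z 1 F (F1 z),
    is_derive z 1 F1 (F2 z) & radial_op N K lam (F z) (F1 z) (F2 z) z = 0]) ->
  (forall z, 0 <= z < Z -> 0 < F z) /\
  exists2 a, 0 < a & forall x, geod_ball K o r x -> phi x = a * F (chord K o x).
Proof.
move=> F0 F_ode; have [e [te ee e_full]] := frame_exists oS.
have Z0 := vers_radius_gt0; have KZ := vers_radius_le1.
have KZ2 : K * Z < 2 by lra.
pose U : set 'rV[R]_N := [set y | sqnorm y < sq K Z].
pose u y := phi (stereo K o e y).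
have sZ : 0 < sq K Z.
  by rewrite /sq; apply: divr_gt0; [apply: mulr_gt0|]; lra.
have closed_dom (y : 'rV[R]_N) : sqnorm y <= sq K Z -> conf_domain K y.
  by apply: conf_domain_bounded => //; exact: ltW.
have Udom y : U y -> conf_domain K y by move=> /ltW; exact: closed_dom.
have Uball y : U y -> geod_ball K o r (stereo K o e y).
  move=> Uy; have yU := Udom _ Uy; rewrite geod_ballE; split.
    exact: stereo_space_form.
  by rewrite chord_stereo // chord_coord_lt.
have oU : open U by exact: open_sqnorm_lt.
have lp := stereo_local_param oS te ee oU Udom Uball.
have [phi_C2 phi_cont phi_eq phi_bd] := phi_sol.
have u_C2 : C2_on U u by exact: phi_C2 lp.
have u_eq : eigen_eq K lam U u.
  move=> y Uy; apply: (laplacian_stereo oS te ee N2 oU Udom u_C2 Uy (f := fun y => - (lam * u y))).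
  exact: phi_eq lp _ Uy.
have u_gt0 y : U y -> 0 < u y by move=> /Uball /phi_gt0.
(* on the boundary sphere [y] is approached by the points [(1 + t) y], [t < 0] *)
have cl_stereo y : sqnorm y <= sq K Z -> closure (geod_ball K o r) (stereo K o e y).
  rewrite le_eqVlt => /orP[/eqP yZ|yZ]; last by apply: subset_closure; exact: Uball.
  move=> P HP; have yU : conf_domain K y by apply: closed_dom; rewrite yZ.
  have nP : \near y, P (stereo K o e y) by exact: (continuous_stereo (o := o) (e := e) yU).
  have [d d0 Hd] := near_line y nP.
  pose t := - Num.min (d / 2) (1 / 2).
  have t1 : Num.min (d / 2) (1 / 2) <= 1 / 2 by rewrite ge_min lexx orbT.
  have t2 : Num.min (d / 2) (1 / 2) <= d / 2 by rewrite ge_min lexx.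
  have t3 : 0 < Num.min (d / 2) (1 / 2) by rewrite lt_min; apply/andP; split; lra.
  exists (stereo K o e (y + t *: y)); split; last first.
    by apply: Hd; rewrite /t normrN gtr0_norm //; lra.
  apply: Uball; rewrite /U /=.
  have -> : sqnorm (y + t *: y) = (1 + t) ^+ 2 * sqnorm y.
    by rewrite /sqnorm mulr_sumr; apply: eq_bigr => i _; rewrite !mxE; ring.
  rewrite yZ.
  rewrite gtr_pMl // expr_lt1 //; rewrite /t; lra.
have u_cont : {within [set y : 'rV[R]_N | 0 <= sqnorm y <= sq K Z], continuous u}.
  apply/subspace_continuousP => y /= /andP[_ yZ].
  have yU := closed_dom _ yZ.
  have C := (subspace_continuousP _ _).1 phi_cont _ (cl_stereo _ yZ).
  have S := continuous_stereo (o := o) (e := e) yU.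
  move=> P HP; have := C P HP; rewrite /= /within /= => H.
  have near_cl : \near y, closure (geod_ball K o r) (stereo K o e y) -> P (u y).
    exact: (S _ H).
  apply: (filterS _ near_cl) => x Hx /andP[_ xZ].
  by apply: Hx; exact: cl_stereo.
have u_bdry y : sqnorm y = sq K Z -> u y = 0.
  move=> yZ; apply: phi_bd; split; first by apply: cl_stereo; rewrite yZ.
  rewrite geod_ballE => -[_].
  have yU : conf_domain K y by apply: closed_dom; rewrite yZ.
  by rewrite chord_stereo // chord_coord_lt // -/(sq K Z) yZ ltxx.
split.
  exact: (profile_gt0 N2 Z0 KZ lam0 F0 F_ode u_C2 u_eq u_gt0 u_cont).
exists (u 0).
  by apply: u_gt0; rewrite /U /= /sqnorm big1 // => i _; rewrite mxE expr0n.
move=> x; rewrite geod_ballE => -[xS xZ].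
have z0 := chord_ge0 oS xS.
have Kz : K * chord K o x < 1 by apply: (curvature_lt1 KZ); rewrite z0.
have [|y yU yx] := stereo_surj oS e_full xS; first by lra.
have Uy : U y by rewrite /U /= -chord_coord_lt // -(chord_stereo oS te ee yU) yx.
rewrite -yx (chord_stereo oS te ee yU).
exact: (positive_solution_radial N2 Z0 KZ lam0 F0 F_ode u_C2 u_eq u_gt0 u_cont u_bdry Uy).
Qed.

(** Points of the ball are never antipodal: for the antipode [- p] of [p], the
    products [B(p, o)] and [B(- p, o)] would both be positive. *)
Lemma chord_lt2 p q : 0 < K -> geod_ball K o r p -> geod_ball K o r q ->
  K * chord K p q < 2.
Proof.
move=> K0; rewrite geod_ballE => -[pS pZ] [qS qZ].
have Kn : K != 0 by rewrite gt_eqF.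
rewrite lt_neqAle chord_le2 // andbT; apply/eqP => E.
have KZ := vers_radius_le1.
have cos_gt0 x : space_form K x -> chord K o x < Z -> 0 < K * space_form_bilin K x o.
  move=> xS xZ; rewrite chord_cos // subr_gt0.
  by apply: (curvature_lt1 KZ); rewrite chord_ge0.
have := (tangent_bilin qS (tangent_proj qS pS)).2; rewrite bilin_proj // E.
have -> : 2 * chord K p q - K * chord K p q ^+ 2 = chord K p q * (2 - K * chord K p q) by ring.
rewrite E subrr mulr0 => /(_ erefl) /eqP; rewrite subr_eq0 => /eqP H.
have : space_form_bilin K (q - p) o = space_form_bilin K (2 *: q) o by rewrite H.
rewrite bilinDl bilinNl bilinZl.
have := cos_gt0 _ pS pZ; have := cos_gt0 _ qS qZ; rewrite !pmulr_rgt0 //; lra.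
Qed.

Section along_geodesic.
Variables (p v : 'rV[R]_N.+1) (D : R).
Hypothesis pS : space_form K p.
Hypothesis pv : unit_tangent K p v.

Let g (t : R) : 'rV[R]_N.+1 := geodesic K p v (t * D).
Let g1 (t : R) : 'rV[R]_N.+1 := (- (K * sigma K (t * D)) * D) *: p + (cos_K K (t * D) * D) *: v.

Lemma geodesic_tangent t : tangent K (g t) (g1 t).
Proof.
have [[tv v0] v1] := pv; split.
  rewrite /g /g1 /geodesic !bilinE (bilinC _ v p) v1.
  set C := cos_K K _; set S := sigma K _.
  rewrite [LHS](_ : _ = D * (S * C * (K - K * (K * space_form_bilin K p p)) +
     (C ^+ 2 - K * S ^+ 2) * (K * space_form_bilin K p v))); last by ring.
  by rewrite tv space_form_norm2 // subrr !mulr0 addr0 mulr0.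
by move=> K0; rewrite !mxE (space_form_flat pS K0) (v0 K0) !mulr0 addr0.
Qed.

Lemma geodesic_velocity t : space_form_bilin K (g1 t) (g1 t) = D ^+ 2.
Proof.
have -> : g1 t = D *: ((- (K * sigma K (t * D))) *: p + cos_K K (t * D) *: v).
  by rewrite scalerDr !scalerA ![D * _]mulrC.
by rewrite bilinZl bilinZr (geodesic_speed _ pS pv) mulr1 expr2.
Qed.

(** Along a geodesic the chord distance to [o] satisfies the harmonic oscillator
    equation of its curvature. *)
Lemma chord_along_geodesic (t : R) :
  [/\ is_derive t 1 (fun t : R => chord K o (g t)) (space_form_bilin K (g1 t) (g t - o)),
      is_derive t 1 (fun t : R => space_form_bilin K (g1 t) (g t - o))
        (D ^+ 2 * (1 - K * chord K o (g t))) &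
      space_form_bilin K (g1 t) (g t - o) ^+ 2 <=
        D ^+ 2 * (2 * chord K o (g t) - K * chord K o (g t) ^+ 2)].
Proof.
have gS : space_form K (g t) by exact: geodesic_space_form.
have dg : is_derive t 1 (fun t : R => g t - o) (g1 t).
  have := is_deriveB (is_derive_geodesic K p v D t) (is_derive_cst o t (1 : R)).
  by rewrite subr0.
split.
- have DB := is_derive_mul (is_derive_bilin K dg dg) (is_derive_const (2^-1 : R) t 1).
  by apply: is_derive_eq DB _; rewrite (bilinC _ (g t - o)); field.
- have Dt : is_derive t 1 (fun t : R => t * D) D.
    by apply: is_derive_eq (is_derive_mul (is_derive_var t) (is_derive_const D t 1)) _; ring.
  have dS := is_derive_comp (f := fun t : R => t * D) (is_derive_sigma K (t * D)) Dt.
  have dC := is_derive_comp (f := fun t : R => t * D) (is_derive_cos_K K (t * D)) Dt.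
  have dg1 : is_derive t 1 g1 (- (K * D ^+ 2) *: g t).
    have D1 := is_derive_scalel p (is_derive_mul (is_derive_opp (is_derive_scale K dS)) (is_derive_const D t 1)).
    have D2 := is_derive_scalel v (is_derive_mul dC (is_derive_const D t 1)).
    apply: is_derive_eq (is_derive_vadd D1 D2) _.
    by rewrite /g /geodesic scalerDr !scalerA; congr (_ *: _ + _ *: _); ring.
  apply: is_derive_eq (is_derive_bilin K dg1 dg) _.
  rewrite geodesic_velocity bilinZl -(chord_bilin gS oS) mulrBr mulr1; ring.
- by rewrite -(geodesic_velocity t); apply: chord_speed => //; exact: geodesic_tangent.
Qed.

End along_geodesic.

(** The power [h = (a F(z)) ^ al] is handled as [expR (al * ln (a F(z)))], and the
    sign of its second derivative is [radial_concavity] for radial geodesics; the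
    general case follows from the bound on [z'] of [chord_along_geodesic]. *)
Theorem eigenfunction_power_concave al : 0 < al -> al < 1 ->
  al * lam * sigma K r ^+ 2 <= N%:R - 1 ->
  strictly_concave K al (geod_ball K o r) phi.
Proof.
move=> al0 al1; rewrite sigma_sqr_vers => alA.
split=> [x /phi_gt0 /ltW //|c cmin cnon cball t0 t01].
have [F [F1 [F2 [F0 F_ode]]]] := radial_solution_exists K lam N0.
have [Fp [a a0 phiE]] := eigenfunction_radial F0 F_ode.
have KZ := vers_radius_le1.
have in0 : 0 <= (0 : R) <= 1 by rewrite lexx ler01.
have in1 : 0 <= (1 : R) <= 1 by rewrite lexx ler01.
have far : 0 < K -> K * chord K (c 0) (c 1) < 2.
  by move=> K0; apply: chord_lt2 => //; exact: cball.
have [v [D [pv D0 cE]]] := minimal_geodesic_arc N0 cmin cnon far.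
have pS : space_form K (c 0) by have := cball _ in0; rewrite geod_ballE => -[].
pose g (t : R) := geodesic K (c 0) v (t * D).
pose z (t : R) := chord K o (g t).
pose z1 (t : R) := space_form_bilin K
  ((- (K * sigma K (t * D)) * D) *: c 0 + (cos_K K (t * D) * D) *: v) (g t - o).
have Hz (t : R) : [/\ is_derive t 1 z (z1 t), is_derive t 1 z1 (D ^+ 2 * (1 - K * z t)) &
    z1 t ^+ 2 <= D ^+ 2 * (2 * z t - K * z t ^+ 2)].
  exact: (chord_along_geodesic D pS pv t).
have zZ (t : R) : 0 <= t <= 1 -> 0 <= z t < Z.
  move=> tt; have := cball _ tt; rewrite geod_ballE (cE _ tt) => -[gS gZ].
  by rewrite /z gZ andbT chord_ge0.
pose L (t : R) := al * ln (a * F (z t)).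
pose L1 (t : R) := al * (F1 (z t) * z1 t / F (z t)).
pose L2 (t : R) := al * ((F2 (z t) * z1 t ^+ 2 + F1 (z t) * (D ^+ 2 * (1 - K * z t))) / F (z t)
   - (F1 (z t) * z1 t) ^+ 2 / F (z t) ^+ 2).
have dL (t : R) : 0 <= t <= 1 -> is_derive t 1 L (L1 t) /\ is_derive t 1 L1 (L2 t).
  move=> tt; have [dz dz1 _] := Hz t; have f0 := Fp _ (zZ _ tt).
  have [dF dF1 _] := F_ode _ (curvature_lt1 KZ (zZ _ tt)).
  have dFz := is_derive_comp dF dz; have dF1z := is_derive_comp dF1 dz.
  have af0 : 0 < a * F (z t) by rewrite mulr_gt0.
  split.
    have dln := is_derive_comp (f := fun t : R => a * F (z t)) (is_derive1_ln af0) (is_derive_scale a dFz).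
    apply: is_derive_eq (is_derive_scale al dln) _.
    by rewrite /L1; field; rewrite !gt_eqF.
  have dI := is_derive_inv (f := fun t : R => F (z t)) (lt0r_neq0 f0) dFz.
  apply: is_derive_eq (is_derive_scale al (is_derive_mul (is_derive_mul dF1z dz1) dI)) _.
  by rewrite /L2; field; rewrite gt_eqF.
pose h (t : R) := expR (L t).
have hE (t : R) : 0 <= t <= 1 -> h t = phi (c t) `^ al.
  move=> tt; rewrite (phiE _ (cball _ tt)) (cE _ tt) -/(g t) -/(z t) /h /L /powR.
  by rewrite gt_eqF // mulr_gt0 // Fp // zZ.
have concave : (1 - t0) * h 0 + t0 * h 1 < h t0.
  apply: (chord_lt_of_second_derivative (f1 := fun t : R => h t * L1 t)
    (f2 := fun t : R => h t * L2 t + L1 t * (h t * L1 t))) => // t tt.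
    exact: is_derive_comp (is_derive_expR (L t)) (dL _ tt).1.
  have tt' : 0 <= t <= 1 by case/andP: tt => /ltW -> /ltW.
  have dh := is_derive_comp (is_derive_expR (L t)) (dL _ tt').1.
  split; first exact: is_derive_mul dh (dL _ tt').2.
  have [_ _ speed] := Hz t; have zt := zZ _ tt'.
  have f0 := Fp _ zt; have Kz := curvature_lt1 KZ zt.
  have f1 := F1_lt0 N0 KZ lam0 F0 F_ode Fp zt.
  have Q := radial_concavity N0 KZ lam0 F0 F_ode Fp al0 al1 alA zt.
  have ode := F2_ode F_ode Kz.
  have -> : h t * L2 t + L1 t * (h t * L1 t) = h t * (al / F (z t) ^+ 2) *
     (z1 t ^+ 2 * (F (z t) * F2 (z t) - (1 - al) * F1 (z t) ^+ 2)
      + F (z t) * F1 (z t) * (D ^+ 2 * (1 - K * z t))).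
    by rewrite /L2 /L1; field; rewrite gt_eqF.
  rewrite pmulr_rlt0; last by rewrite mulr_gt0 ?expR_gt0 // divr_gt0 // exprn_gt0.
  have D2 : 0 < D ^+ 2 by rewrite exprn_gt0.
  have base : F (z t) * F1 (z t) * (D ^+ 2 * (1 - K * z t)) < 0.
    by rewrite nmulr_rlt0 ?mulr_gt0 ?subr_gt0 // pmulr_rlt0.
  set X := F (z t) * F2 (z t) - _.
  (* [X] is the coefficient of [z' ^ 2]; when positive, the extreme value of [z' ^ 2]
     is the worst case *)
  have [X0|X0] := leP X 0.
    by rewrite -[ltRHS]addr0 ler_ltD // mulr_ge0_le0 // sqr_ge0.
  have : z1 t ^+ 2 * X <= D ^+ 2 * (2 * z t - K * z t ^+ 2) * X by rewrite ler_pM2r.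
  suff : D ^+ 2 * (2 * z t - K * z t ^+ 2) * X + F (z t) * F1 (z t) * (D ^+ 2 * (1 - K * z t)) < 0.
    by move=> ? ?; lra.
  have -> : D ^+ 2 * (2 * z t - K * z t ^+ 2) * X + F (z t) * F1 (z t) * (D ^+ 2 * (1 - K * z t)) =
    D ^+ 2 * (F (z t) * ((2 * z t - K * z t ^+ 2) * F2 (z t))
      - (1 - al) * (2 * z t - K * z t ^+ 2) * F1 (z t) ^+ 2 + F (z t) * F1 (z t) * (1 - K * z t)).
    by rewrite /X; ring.
  rewrite ode pmulr_rlt0 // -oppr_gt0; move: Q; congr (0 < _); ring.
have t0' : 0 <= t0 <= 1 by case/andP: t01 => /ltW -> /ltW.
rewrite -!hE //.
have -> : phi (c t0) = h t0 `^ al^-1.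
  by rewrite hE // -powRrM mulfV ?gt_eqF // powRr1 // ltW //; apply: phi_gt0; exact: cball.
apply: gt0_ltr_powR => //; first by rewrite invr_gt0.
  rewrite nnegrE addr_ge0 // mulr_ge0 ?expR_ge0 //; case/andP: t01 => ? ?; lra.
by rewrite nnegrE expR_ge0.
Qed.

End eigenfunction.

Theorem corollaryA1 (R : realType) (N : nat) (K r alpha : R)
    (o : 'rV[R]_N.+1) (phi : 'rV[R]_N.+1 -> R)
    (hN : (2 <= N)%N)
    (ho : space_form K o)
    (hr0 : 0 < r) (hr : (r%:E <= r_max K)%E)
    (halpha : 0 < alpha < 1)
    (hA : alpha <= A_const K o r)
    (hphi : first_dirichlet_eigenfunction K o r phi) :
  strictly_concave K alpha (geod_ball K o r) phi.
Proof.
have [al0 al1] := andP halpha.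
have rK : 0 < K -> Num.sqrt K * r <= pi / 2.
  move=> K0; have k0 : 0 < Num.sqrt K by rewrite sqrtr_gt0.
  move: hr; rewrite /r_max K0 lee_fin ler_pdivlMr ?mulr_gt0 //; lra.
have s0 : 0 < sigma K r.
  apply: sigma_gt0 => // K0; apply: le_lt_trans (rK K0) _.
  by rewrite ltr_pdivrMr // ltr_pMr ?pi_gt0 // ltr1n.
have N1 : 0 < N%:R - 1 :> R by rewrite subr_gt0 ltr1n.
have lam0 : 0 < lambda1 K o r.
  rewrite ltNge; apply/negP => l0; have := lt_le_trans al0 hA.
  rewrite /A_const ltNge => /negP; apply.
  rewrite mulr_ge0_le0 ?(ltW N1) // invr_le0 mulr_le0_ge0 // sqr_ge0.
  by [].
have [phi_sol phi_gt0] := hphi.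
apply: (eigenfunction_power_concave hN ho hr0 rK lam0 phi_sol phi_gt0 al0 al1).
move: hA; rewrite /A_const ler_pdivlMr ?mulr_gt0 ?exprn_gt0 //.
by rewrite mulrA.
Qed.
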